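(* Let $k_\theta,k_\omega,\alpha,\beta>0$ and $\kappa=k_\theta/\alpha^2$. Suppose that for every $\varepsilon>0$ there is a smooth solution $f^\varepsilon=f^\varepsilon(t,x,\theta,\omega)\ge 0$ of the kinetic equation $$\partial_t f^\varepsilon+\vec\tau(\theta)\cdot\nabla_x f^\varepsilon+\partial_\theta(\omega f^\varepsilon)=\frac1\varepsilon Q(f^\varepsilon)+\mathcal O(\varepsilon),$$ with $Q$ the operator defined in the context, and that $f^\varepsilon$ converges as $\varepsilon\to0$ to some function $f^0$ strongly enough that the limit $\varepsilon\to 0$ can be exchanged with integrals and derivatives (in the sense made explicit in the context). Then $$f^0(t,x,\theta,\omega)=\rho(t,x)\,\mathcal N_{\bar\theta(t,x)}(\theta)\,\mathcal M_{\bar\omega(t,x)}(\omega),$$ where $\mathcal N_{\bar\theta}$ and $\mathcal M_{\bar\omega}$ are the von Mises and Gaussian distributions $$\mathcal N_{\bar\theta}(\theta)=\frac{1}{2\pi I_0(\kappa)}\exp\big(\kappa\cos(\theta-\bar\theta)\big),\qquad \mathcal M_{\bar\omega}(\omega)=\sqrt{\frac{k_\omega}{2\pi\beta^2}}\,\exp\Big(-\frac{k_\omega}{2\beta^2}(\omega-\bar\omega)^2\Big),$$ and the density $\rho=\rho(t,x)$, the mean orientation $\Omega=\Omega(t,x)=(\cos\bar\theta(t,x),\sin\bar\theta(t,x))$ and the mean angular velocity $\bar\omega=\bar\omega(t,x)$ satisfy $$\partial_t\rho+c_1\nabla_x\cdot(\rho\,\Omega)=0,$$ $$\partial_t(\rho\,\bar\omega)+c_1\nabla_x\cdot(\rho\,\bar\omega\,\Omega)=0,$$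 $$\rho\big(\partial_t\Omega+c_2(\Omega\cdot\nabla_x)\Omega-\bar\omega\,\Omega^\perp\big)+\frac1\kappa P_{\Omega^\perp}\nabla_x\rho=0,$$ where $\Omega^\perp=(-\sin\bar\theta,\cos\bar\theta)$, $P_{\Omega^\perp}=\mathrm{Id}-\Omega\otimes\Omega$ (with $\mathrm{Id}$ the $2\times2$ identity matrix), $c_1=I_1(\kappa)/I_0(\kappa)$, and $c_2=K_2/K_1$ with $$K_1=\int_{-\pi}^{\pi}\sin\theta\,\mathcal N_0(\theta)\,g(\theta)\,d\theta,\qquad K_2=\int_{-\pi}^{\pi}\cos\theta\,\sin\theta\,\mathcal N_0(\theta)\,g(\theta)\,d\theta,$$ $$g(\Gamma)=\frac1\kappa\,\Gamma-\frac{\pi}{\kappa}\,\frac{\int_0^\Gamma e^{-\kappa\cos\varphi}\,d\varphi}{\int_0^\pi e^{-\kappa\cos\varphi}\,d\varphi}.$$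
   Context: Variables: $t\ge 0$, $x\in\mathbb R^2$, $\theta\in(-\pi,\pi]$ (all functions of $\theta$ are understood as $2\pi$-periodic), $\omega\in\mathbb R$. $\vec\tau(\theta)=(\cos\theta,\sin\theta)$. $I_j$ is the modified Bessel function of the first kind of order $j$. For a nonnegative function $f=f(t,x,\theta,\omega)$ define $$\rho_f(t,x)=\int_{(-\pi,\pi]\times\mathbb R}f\,d\theta\,d\omega,\quad J_f(t,x)=\int_{(-\pi,\pi]\times\mathbb R}\vec\tau(\theta)f\,d\theta\,d\omega,\quad \Omega_f=\frac{J_f}{|J_f|}=\vec\tau(\bar\theta_f),\quad \bar\omega_f(t,x)=\frac{1}{\rho_f}\int_{(-\pi,\pi]\times\mathbb R}\omega f\,d\theta\,d\omega,$$ (here $\rho_f>0$ and $J_f\neq0$ are implicit, so that $\Omega_f$, $\bar\omega_f$ are defined; this is understood for $f^\varepsilon$ and for $f^0$), and $$F_f=\sin(\bar\theta_f-\theta),\qquad G_f=\bar\omega_f-\omega,$$ $$Q(f)=-k_\theta\,\partial_\theta(f F_f)-k_\omega\,\partial_\omega(f G_f)+\alpha^2\partial_\theta^2 f+\beta^2\partial_\omega^2 f.$$ The derivation is formal. ''Strongly enough that limits can be exchanged with integrals and derivatives'' means: $f^\varepsilon$ and its derivatives appearing in the equation converge to the corresponding derivatives of $f^0$, and $Q(f^\varepsilon)\to Q(f^0)$; integrals over $(\theta,\omega)$ of $f^\varepsilon$ and these derivatives, multiplied by products of $1$ or $\omega$ with bounded functions of $\theta$ (possibly depending on $\varepsilon$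 and converging uniformly), converge to the corresponding integrals for $f^0$; derivatives in $t,x$ commute with integration over $(\theta,\omega)$; functions decay in $\omega$ fast enough that integrations by parts in $\omega$ produce no boundary terms; and the $\mathcal O(\varepsilon)$ remainder tends to $0$ pointwise and also after integration over $(\theta,\omega)$ against such multipliers. *)

(* Defs.v *)
From HB Require Import structures.
From mathcomp Require Import all_boot all_order all_algebra.
From mathcomp Require Import all_classical all_reals all_analysis.

Set Implicit Arguments.
Unset Strict Implicit.
Unset Printing Implicit Defensive.

Import Order.TTheory GRing.Theory Num.Theory.
Import numFieldNormedType.Exports.

Local Open Scope classical_set_scope.
Local Open Scope ring_scope.

(* Derivatives in time on the half-line t >= 0: the library's difference
   quotient, restricted to the increments that stay in the half-line, hence
   two-sided for t > 0 and one-sided at t = 0. *)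
Section TimeDerivative.
Context {R : realType} {V : normedModType R}.
Implicit Types (g : R -> V) (t : R).

Definition derivable_t g t : Prop :=
  cvg (h^-1 *: (g (t + h) - g t) @[h --> within [set h | 0 <= t + h] 0^']).

Definition derive_t g t : V :=
  lim (h^-1 *: (g (t + h) - g t) @[h --> within [set h | 0 <= t + h] 0^']).

End TimeDerivative.

Section SpaceDerivative.
Context {R : realType}.

Definition dirx (j : 'I_2) : 'rV[R]_2 := delta_mx 0 j.

Definition grad (g : 'rV[R]_2 -> R) (x : 'rV[R]_2) : 'rV[R]_2 :=
  \row_j 'D_(dirx j) g x.

Definition div (v : 'rV[R]_2 -> 'rV[R]_2) (x : 'rV[R]_2) : R :=
  \sum_j 'D_(dirx j) (fun y => v y 0 j) x.

(* (u . grad) v *)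
Definition advect (u : 'rV[R]_2) (v : 'rV[R]_2 -> 'rV[R]_2) (x : 'rV[R]_2) :
  'rV[R]_2 := \sum_j u 0 j *: 'D_(dirx j) v x.

Definition pdifferentiable {V : normedModType R} (g : R -> 'rV[R]_2 -> V)
    (t : R) (x : 'rV[R]_2) : Prop :=
  derivable_t (g ^~ x) t /\ forall j, derivable (g t) x (dirx j).

End SpaceDerivative.

(* Functions of (t, x, theta, omega): total in t, but every hypothesis on them
   is restricted to t >= 0. *)
Definition state (R : realType) := R -> 'rV[R]_2 -> R -> R -> R.

Inductive pvar := Vt | Vx of 'I_2 | Vtheta | Vomega.

Section PhaseSpace.
Context {R : realType}.
Implicit Types (f : state R) (t th om : R) (x : 'rV[R]_2).

Definition pderivable (v : pvar) f t x th om : Prop :=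
  match v with
  | Vt => derivable_t (fun s => f s x th om) t
  | Vx j => derivable (fun y => f t y th om) x (dirx j)
  | Vtheta => derivable (fun s => f t x s om) th 1
  | Vomega => derivable (fun s => f t x th s) om 1
  end.

Definition pd (v : pvar) f : state R := fun t x th om =>
  match v with
  | Vt => derive_t (fun s => f s x th om) t
  | Vx j => 'D_(dirx j) (fun y => f t y th om) x
  | Vtheta => derive1 (fun s => f t x s om) th
  | Vomega => derive1 (fun s => f t x th s) om
  end.

Definition continuous_state f : Prop :=
  {within [set p : R * 'rV[R]_2 * R * R | 0 <= p.1.1.1],
    continuous (fun p => f p.1.1.1 p.1.1.2 p.1.2 p.2)}.

(* C^infinity on [0, +oo[ x R^2 x R x R: all iterated partial derivatives
   exist and are jointly continuous. *)
Definition smooth f : Prop :=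
  forall s : seq pvar, let g := foldr pd f s in
    continuous_state g /\
    forall v t x th om, 0 <= t -> pderivable v g t x th om.

Definition periodic_theta f : Prop :=
  forall t x th om, 0 <= t -> f t x (th + 2 * pi) om = f t x th om.

Definition tau th : 'rV[R]_2 := \row_j (if j == 0 then cos th else sin th).

Definition tau_perp th : 'rV[R]_2 := \row_j (if j == 0 then - sin th else cos th).

(* The library norm on 'rV[R]_2 is the sup norm. *)
Definition enorm (v : 'rV[R]_2) : R := Num.sqrt (\sum_j v 0 j ^+ 2).

Definition plane_measure :
    {measure set (measurableTypeR R * measurableTypeR R) -> \bar R} :=
  (lebesgue_measure \x lebesgue_measure)%E.

(* ]-pi, pi] x R, the domain of (theta, omega) *)
Definition cell : set (measurableTypeR R * measurableTypeR R) :=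
  `]- pi, pi]%classic `*` [set: R].

Definition avg_integrable (h : R -> R -> R) : Prop :=
  plane_measure.-integrable cell (fun p => (h p.1 p.2)%:E).

Definition avg (h : R -> R -> R) : R :=
  \int[plane_measure]_(p in cell) h p.1 p.2.

Definition rho f t x : R := avg (f t x).

Definition flux f t x : 'rV[R]_2 :=
  \row_j avg (fun th om => tau th 0 j * f t x th om).

Definition orientation f t x : 'rV[R]_2 := (enorm (flux f t x))^-1 *: flux f t x.

Definition thetabar f t x : R :=
  xget 0 [set a | - pi < a <= pi /\ orientation f t x = tau a].

Definition omegabar f t x : R :=
  (rho f t x)^-1 * avg (fun th om => om * f t x th om).

Definition moments_nondegenerate f : Prop :=
  forall t x, 0 <= t -> 0 < rho f t x /\ flux f t x != 0.

Definition fF f : state R := fun t x th om =>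
  f t x th om * sin (thetabar f t x - th).

Definition fG f : state R := fun t x th om =>
  f t x th om * (omegabar f t x - om).

Definition omf f : state R := fun t x th om => om * f t x th om.

Definition Q (ktheta komega alpha beta : R) f : state R := fun t x th om =>
  - ktheta * pd Vtheta (fF f) t x th om - komega * pd Vomega (fG f) t x th om
  + alpha ^+ 2 * pd Vtheta (pd Vtheta f) t x th om
  + beta ^+ 2 * pd Vomega (pd Vomega f) t x th om.

Definition transport f : state R := fun t x th om =>
  pd Vt f t x th om
  + \sum_j tau th 0 j * pd (Vx j) f t x th om
  + pd Vtheta (omf f) t x th om.

End PhaseSpace.

(* f and its derivatives appearing in the kinetic equation *)
Inductive kterm :=
  | Tid | Tpd_t | Tpd_x of 'I_2 | Tpd_th_omf
  | Tpd_th_fF | Tpd_om_fG | Tpd_th_th | Tpd_om_om.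

Section StrongConvergence.
Context {R : realType}.
Implicit Types (f : state R) (t : R) (x : 'rV[R]_2).

Definition term (k : kterm) f : state R :=
  match k with
  | Tid => f
  | Tpd_t => pd Vt f
  | Tpd_x j => pd (Vx j) f
  | Tpd_th_omf => pd Vtheta (omf f)
  | Tpd_th_fF => pd Vtheta (fF f)
  | Tpd_om_fG => pd Vomega (fG f)
  | Tpd_th_th => pd Vtheta (pd Vtheta f)
  | Tpd_om_om => pd Vomega (pd Vomega f)
  end.

(* weight om ^ b a(theta), i.e. a(theta) or omega a(theta) *)
Definition weighted (b : bool) (a : R -> R) (h : R -> R -> R) (th om : R) : R :=
  om ^+ b * a th * h th om.

Definition multiplier (a : R -> R) : Prop :=
  measurable_fun `]- pi, pi]%classic a /\ [bounded a th | th in `]- pi, pi]%classic].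

Definition multiplier_family (a : R -> R -> R) (a0 : R -> R) : Prop :=
  [/\ forall eps : R, 0 < eps -> multiplier (a eps), multiplier a0 &
      {uniform `]- pi, pi]%classic, a @ 0^'+ --> a0}].

Definition integrable_terms f : Prop :=
  forall k t x b a, 0 <= t -> multiplier a ->
    avg_integrable (weighted b a (term k f t x)).

Definition avg_commutes f : Prop :=
  forall t x b a, 0 <= t -> multiplier a ->
    pdifferentiable (fun s y => avg (weighted b a (f s y))) t x /\
    derive_t (fun s => avg (weighted b a (f s x))) t =
      avg (weighted b a (pd Vt f t x)) /\
    forall j, 'D_(dirx j) (fun y => avg (weighted b a (f t y))) x =
      avg (weighted b a (pd (Vx j) f t x)).

(* No boundary terms when omega-derivatives in Q are integrated by parts
   against 1 or omega. *)
Definition omega_decay f : Prop :=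
  forall t x th, 0 <= t ->
    (forall n, (n <= 2)%N ->
       om ^+ n * f t x th om @[om --> +oo] --> 0 /\
       om ^+ n * f t x th om @[om --> -oo] --> 0) /\
    (forall n, (n <= 1)%N ->
       om ^+ n * pd Vomega f t x th om @[om --> +oo] --> 0 /\
       om ^+ n * pd Vomega f t x th om @[om --> -oo] --> 0).

(* The derivatives appearing in the kinetic equation exist in the classical
   sense; those in (theta, omega) are continuous in (theta, omega). *)
Definition classical_state f : Prop :=
  (forall t x th om, 0 <= t ->
     [/\ forall v, pderivable v f t x th om,
         pderivable Vtheta (pd Vtheta f) t x th om &
         pderivable Vomega (pd Vomega f) t x th om]) /\
  (forall t x, 0 <= t ->
     let cont (h : state R) := continuous (fun p : R * R => h t x p.1 p.2) in
     [/\ cont f, cont (pd Vtheta f), cont (pd Vomega f),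
         cont (pd Vtheta (pd Vtheta f)) & cont (pd Vomega (pd Vomega f))]).

Definition strongly_converges (ktheta komega alpha beta : R)
    (f : R -> state R) (f0 : state R) : Prop :=
  classical_state f0 /\
  (forall k t x th om, 0 <= t ->
     term k (f eps) t x th om @[eps --> 0^'+] --> term k f0 t x th om) /\
  (forall t x th om, 0 <= t ->
     Q ktheta komega alpha beta (f eps) t x th om @[eps --> 0^'+]
       --> Q ktheta komega alpha beta f0 t x th om) /\
  (forall eps : R, 0 < eps -> integrable_terms (f eps)) /\
  integrable_terms f0 /\
  (forall k t x b a a0, 0 <= t -> multiplier_family a a0 ->
     avg (weighted b (a eps) (term k (f eps) t x)) @[eps --> 0^'+]
       --> avg (weighted b a0 (term k f0 t x))) /\
  (forall eps : R, 0 < eps -> avg_commutes (f eps)) /\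
  avg_commutes f0 /\
  (forall eps : R, 0 < eps -> omega_decay (f eps)) /\
  omega_decay f0.

Definition negligible_remainder (r : R -> state R) : Prop :=
  (forall t x th om, 0 <= t ->
     exists C : R, \forall eps \near 0^'+, `|r eps t x th om| <= C * eps) /\
  (forall t x b, 0 <= t ->
     (forall (eps : R) a, 0 < eps -> multiplier a ->
        avg_integrable (weighted b a (r eps t x))) /\
     (forall a a0, multiplier_family a a0 ->
        avg (weighted b (a eps) (r eps t x)) @[eps --> 0^'+] --> 0)).

End StrongConvergence.

Section Equilibria.
Context {R : realType}.
Implicit Types (kappa : R).

(* modified Bessel function of the first kind, of order j *)
Definition besselI (j : nat) (z : R) : R :=
  limn (series (fun m : nat => (z / 2) ^+ (2 * m + j) / (m`!%:R * (m + j)`!%:R))).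

Definition von_mises kappa (thb th : R) : R :=
  (2 * pi * besselI 0 kappa)^-1 * expR (kappa * cos (th - thb)).

Definition gaussian (komega beta omb om : R) : R :=
  Num.sqrt (komega / (2 * pi * beta ^+ 2)) *
  expR (- (komega / (2 * beta ^+ 2)) * (om - omb) ^+ 2).

(* oriented integral from 0 to y *)
Definition int0 (h : R -> R) (y : R) : R :=
  if 0 <= y then \int[lebesgue_measure]_(s in `[0, y]) h s
  else - \int[lebesgue_measure]_(s in `[y, 0]) h s.

Definition gci kappa (y : R) : R :=
  let e s := expR (- kappa * cos s) in
  kappa^-1 * y - pi / kappa * (int0 e y / int0 e pi).

Definition K1 kappa : R :=
  \int[lebesgue_measure]_(th in `[- pi, pi])
    (sin th * von_mises kappa 0 th * gci kappa th).

Definition K2 kappa : R :=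
  \int[lebesgue_measure]_(th in `[- pi, pi])
    (cos th * sin th * von_mises kappa 0 th * gci kappa th).

Definition c1 kappa : R := besselI 1 kappa / besselI 0 kappa.

Definition c2 kappa : R := K2 kappa / K1 kappa.

(* Id - u (x) u, acting on row vectors (it is symmetric) *)
Definition proj_perp (u : 'rV[R]_2) : 'M[R]_2 := 1%:M - u^T *m u.

End Equilibria.

(* Main.v *)
(* The collision operator vanishes in the limit, so (theta, omega) |-> f0 solves
   a linear elliptic equation with drift. Dividing f0 by the product of the
   von Mises and the Gaussian weights gives a nonnegative g with L g = 0 for
   L = alpha^2 (d_theta^2 - kappa sin d_theta) + beta^2 (d_omega^2 - ... d_omega),
   and 1 / (1 + g) is bounded and L-subharmonic. Its average over theta against
   the von Mises weight has a monotone flux in omega, which boundedness forces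
   to be 0; the dissipation then vanishes and g is constant.

   The macroscopic equations are limits of moments of the kinetic equation that
   kill Q / eps for every eps: against 1, against omega, and against
   A = gci (theta - thetabar f), the generalized collision invariant, which
   depends on f eps and solves A'' - kappa sin (theta - thetabar f) A' =
   - sin (theta - thetabar f). Inserting the equilibrium and its derivatives
   into the last limit gives the component of the orientation equation along
   tau_perp; its leading coefficient K1 is the weighted square norm of gci',
   hence positive. *)

(* The angle [thetabar] is a representative in ]-pi, pi], so it may jump by 2 pi as eps tends to 0
   or as (t, x) varies. Only its cosine and sine, that is [tau], are therefore passed to the limit
   and differentiated. This suffices because the von Mises density and the collision invariant are 2
   pi-periodic; for [gci] the periodicity comes from the constant pi / kappa, which cancels the
   linear term over a period.

   Differentiability in (t, x) is assumed for averages of [f0], not for the direction or the mean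
   frequency. At equilibrium the flux is [rho] c1 Omega, and c1 is nonzero because the flux does not
   vanish, so density, direction and mean frequency are rational functions of averages; the
   derivatives of [f0] are then expressed through theirs. One calculus of slopes along a filter
   serves both the time derivative, one-sided at t = 0, and the space derivatives.

   The usual entropy estimate is not directly available for the uniqueness of the equilibrium:
   [omega_decay] is only polynomial, while the quotient by the Gaussian weight may grow in omega. *)
Require Import Defs.
From mathcomp Require Import all_boot all_order all_algebra.
From mathcomp Require Import all_classical all_reals all_analysis.
From mathcomp Require Import measurable_realfun ring lra.

Import Order.TTheory GRing.Theory Num.Theory.
Import numFieldNormedType.Exports.

Local Open Scope classical_set_scope.
Local Open Scope ring_scope.

Set Implicit Arguments.
Unset Strict Implicit.
Unset Printing Implicit Defensive.

(** * Differentiation and integration on segments *)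

Section Calculus.
Context {R : realType}.
Notation mu := (@lebesgue_measure R).
Implicit Types (f g h F G : R -> R) (x y a b : R).

Lemma der_eq f x (a b : R) : is_derive x 1 f a -> a = b -> is_derive x 1 f b.
Proof. by move=> + <-. Qed.

Lemma der_ext f g x a : is_derive x 1 f a -> f =1 g -> is_derive x 1 g a.
Proof. by move=> + /funext <-. Qed.

Lemma der_cst (c : R) x : is_derive x 1 (fun=> c) (0 : R).
Proof. exact: is_derive_cst. Qed.

Lemma der_id x : is_derive x 1 (fun y : R => y) (1 : R).
Proof. exact: is_derive_id. Qed.

Lemma der_scale (k : R) x : is_derive x 1 ( *%R k) k.
Proof.
have := is_deriveZ (f := @id R) (x := x) (v := 1) (df := 1) k.
by rewrite /GRing.scale /= mulr1; apply.
Qed.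

Lemma derD f g x a b : is_derive x 1 f a -> is_derive x 1 g b ->
  is_derive x 1 (fun y => f y + g y) (a + b).
Proof. by move=> fa gb; exact: (is_deriveD fa gb). Qed.

Lemma derN f x a : is_derive x 1 f a -> is_derive x 1 (fun y => - f y) (- a).
Proof. by move=> fa; exact: (is_deriveN fa). Qed.

Lemma der_oppr x : is_derive x 1 (-%R : R -> R) (- 1).
Proof. exact: (derN (der_id x)). Qed.

Lemma derM f g x a b : is_derive x 1 f a -> is_derive x 1 g b ->
  is_derive x 1 (fun y => f y * g y) (a * g x + f x * b).
Proof.
move=> fa gb; apply: (@der_eq _ _ (f x *: b + g x *: a)).
by rewrite addrC mulrC.
Qed.

Lemma der_comp F f x a b : is_derive (f x) 1 F a -> is_derive x 1 f b ->
  is_derive x 1 (fun y => F (f y)) (a * b).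
Proof.
by move=> Fa fb; have := @is_derive1_comp R F f x a b Fa fb; rewrite mulrC.
Qed.

Lemma derV f x a : f x != 0 -> is_derive x 1 f a ->
  is_derive x 1 (fun y => (f y)^-1) (- a / f x ^+ 2).
Proof.
move=> fx0 fa; apply: (@der_eq _ _ (- (f x) ^- 2 *: a)).
by rewrite /GRing.scale /= mulrC mulrN mulNr.
Qed.

Lemma derX f x a n : is_derive x 1 f a ->
  is_derive x 1 (fun y => f y ^+ n) (n%:R * f x ^+ n.-1 * a).
Proof.
move=> fa; elim: n => [|n IH].
  by apply: der_eq (der_cst 1 x) _; rewrite mul0r mul0r.
apply: (@der_ext (fun y => f y * f y ^+ n)) => [|y]; last by rewrite exprS.
apply: der_eq (derM fa IH) _.
case: n {IH} => [|n] /=; rewrite ?mul0r ?mulr0 ?expr0 ?addr0 ?mulr1 ?mul1r//.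
by rewrite -(natr1 n.+1) exprS; ring.
Qed.

Lemma der_expR f x a : is_derive x 1 f a ->
  is_derive x 1 (fun y => expR (f y)) (expR (f x) * a).
Proof. by move=> fa; apply: der_comp (is_derive_expR _) fa. Qed.

Lemma der_sin f x a : is_derive x 1 f a ->
  is_derive x 1 (fun y => sin (f y)) (cos (f x) * a).
Proof. by move=> fa; apply: der_comp (is_derive_sin _) fa. Qed.

Lemma der_cos f x a : is_derive x 1 f a ->
  is_derive x 1 (fun y => cos (f y)) (- sin (f x) * a).
Proof. by move=> fa; apply: der_comp (is_derive_cos _) fa. Qed.

Lemma der_continuous f x a : is_derive x 1 f a -> {for x, continuous f}.
Proof.
by move=> fa; apply/differentiable_continuous/derivable1_diffP/ex_derive.
Qed.

Lemma derives_continuous F f : (forall x, is_derive x 1 F (f x)) -> continuous F.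
Proof. by move=> Ff x; apply: der_continuous (Ff x). Qed.

Lemma der_derive1 f x a : is_derive x 1 f a -> f^`()%classic x = a.
Proof. by move=> fa; rewrite derive1E derive_val. Qed.

Lemma derivable_der f x : derivable f x 1 -> is_derive x 1 f (f^`()%classic x).
Proof. by move=> fx; rewrite derive1E; exact: derivableP. Qed.

Lemma segment_integrable h a b : continuous h -> mu.-integrable `[a, b] (EFin \o h).
Proof.
move=> ch; apply: continuous_compact_integrable; first exact: segment_compact.
exact: continuous_subspaceT.
Qed.

Lemma FTC_segment F f a b : a <= b -> (forall x, is_derive x 1 F (f x)) ->
  continuous f -> \int[mu]_(x in `[a, b]) f x = F b - F a.
Proof.
rewrite le_eqVlt => /predU1P[<- _ _|ab Ff cf].
  by rewrite set_itv1 Rintegral_set1 subrr.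
rewrite /Rintegral (@continuous_FTC2 _ f F)//.
- exact: continuous_subspaceT.
- split.
  + by move=> x _; exact: ex_derive.
  + by apply: cvg_at_right_filter; exact: (derives_continuous Ff).
  + by apply: cvg_at_left_filter; exact: (derives_continuous Ff).
- by move=> x _; exact: der_derive1.
Qed.

(** The case split on sign in [int0] disappears once it is written as [G z - G 0], where [G]
    integrates from a base point [c] lying to the left of both 0 and [y]. *)
Lemma der_int0 h y : continuous h -> is_derive y 1 (int0 h) (h y).
Proof.
move=> ch.
pose c := - (`|y| + 1); pose G z := \int[mu]_(s in `[c, z]) h s.
have c0 : c < 0 by rewrite oppr_lt0 ltr_wpDl.
have cy : c < y by rewrite ltrNl (le_lt_trans (ler_norm _))// normrN ltrDl.
have Gy : is_derive y 1 G (h y).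
  have [||] := @continuous_FTC1_closed R h c y (y + 1) _ _ cy (ch y).
  - by rewrite ltrDl.
  - exact: segment_integrable.
  - by move=> dG <-; rewrite derive1E; exact: derivableP.
have split_int (u v : R) : c <= u -> u <= v ->
    G v = G u + \int[mu]_(s in `[u, v]) h s.
  move=> cu uv; have -> : G u + \int[mu]_(s in `[u, v]) h s =
      G u + (G v - G u).
    congr (_ + _); rewrite /G Rintegral_itvB ?bnd_simp//.
      rewrite Rintegral_itv_obnd_cbnd//.
      apply: integrableS (@segment_integrable h u v ch) => //.
      by apply: subset_itv; rewrite bnd_simp.
    exact: segment_integrable.
  by rewrite addrC subrK.
have E : \forall z \near y, G z - G 0 = int0 h z.
  near=> z.
  have cz : c < z by near: z; exact: lt_nbhsr.
  rewrite /int0; case: (leP 0 z) => z0.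
    by rewrite (split_int 0 z)//; [ring | exact: ltW].
  by rewrite (split_int z 0) ?ltW//; ring.
have dG0 : is_derive y 1 (fun z => G z - G 0) (h y).
  by apply: der_eq (derD Gy (der_cst _ _)) _; rewrite addr0.
by apply: near_eq_is_derive dG0; rewrite ?oner_eq0.
Unshelve. all: by end_near. Qed.

Lemma derivative0_cst F x y : (forall z : R, is_derive z 1 F 0) -> F x = F y.
Proof. by move=> F0; apply: is_derive_0_is_cst. Qed.

(** A primitive is nondecreasing and takes equal values at both ends, so it is constant on the
    segment and its derivative vanishes in the interior. The endpoints are not reached this way. *)
Lemma int_segment_ge0_eq0 h a b : continuous h -> (forall x, 0 <= h x) ->
  \int[mu]_(x in `[a, b]) h x = 0 -> forall x, a < x < b -> h x = 0.
Proof.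
move=> ch h0 I0 x /andP[ax xb].
have dH z := @der_int0 h z ch; set H := int0 h in dH.
have mono : {homo H : u v / u <= v}.
  move=> u v uv; rewrite -subr_ge0.
  by rewrite -(@FTC_segment H h u v)//; exact: Rintegral_ge0.
have ab : a < b by exact: lt_trans xb.
have HE : H b = H a.
  by apply/eqP; rewrite -subr_eq0 -(@FTC_segment H h)// ?I0// ltW.
have E : \forall z \near x, H a = H z.
  near=> z.
  have az : a < z by near: z; exact: lt_nbhsr.
  have zb : z < b by near: z; exact: lt_nbhsl.
  by apply/eqP; rewrite eq_le -{2}HE !mono// ltW.
have : is_derive x 1 H 0.
  by apply: near_eq_is_derive (der_cst (H a) x); rewrite ?oner_eq0.
by move/der_derive1; rewrite (der_derive1 (dH x)).
Unshelve. all: by end_near. Qed.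

End Calculus.

(** Syntax-directed differentiation. The value of the derivative is an evar filled in by the rules,
    and [der] leaves the equation between that value and the expected one. [notypeclasses refine]
    keeps the premises as goals for the next step. *)
Ltac der_step :=
  first [eassumption | match goal with H : forall z, is_derive _ _ _ _ |- _ => exact (H _) end |
  lazymatch goal with
  | |- is_derive _ _ (fun y => y) _ => exact (der_id _)
  | |- is_derive _ _ (fun y => @?f y + @?g y) _ => notypeclasses refine (derD _ _)
  | |- is_derive _ _ (fun y => - @?f y) _ => notypeclasses refine (derN _)
  | |- is_derive _ _ (fun y => @?f y * @?g y) _ => first [exact (der_cst _ _) | notypeclasses
      refine (derM _ _)]
  | |- is_derive _ _ (fun y => @?f y ^+ _) _ => first [exact (der_cst _ _) | notypeclasses
      refine (derX _ _)]
  | |- is_derive _ _ (fun y => (@?f y)^-1) _ => first [exact (der_cst _ _) | notypeclasses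
      refine (derV _ _)]
  | |- is_derive _ _ (fun y => expR (@?f y)) _ => first [exact (der_cst _ _) | notypeclasses
      refine (der_expR _)]
  | |- is_derive _ _ (fun y => sin (@?f y)) _ => first [exact (der_cst _ _) | notypeclasses
      refine (der_sin _)]
  | |- is_derive _ _ (fun y => cos (@?f y)) _ => first [exact (der_cst _ _) | notypeclasses
      refine (der_cos _)]
  | |- is_derive _ _ _ _ => first [exact (is_derive_cos _) | exact (is_derive_sin _) | exact
      (is_derive_expR _) | exact (der_scale _ _) | exact (der_oppr _) | exact (der_cst _ _)]
  end].
Ltac der := notypeclasses refine (der_eq _ _); [repeat der_step | cbv beta].

(** * Integrals over one period *)

Section Circle.
Context {R : realType}.
Notation mu := (@lebesgue_measure R).
Implicit Types (h : R -> R) (x y c a : R).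

Definition circ h : R := \int[mu]_(x in `[- pi, pi]) h x.

Lemma Npi_le_pi : - pi <= pi :> R.
Proof. by have := pi_gt0 R; lra. Qed.

Lemma circ_primitive H h : (forall x, is_derive x 1 H (h x)) -> continuous h ->
  circ h = H pi - H (- pi).
Proof. exact: FTC_segment Npi_le_pi. Qed.

Lemma der_shift H x c a : is_derive (x + c) 1 H a ->
  is_derive x 1 (fun y => H (y + c)) a.
Proof.
move=> Ha; apply: (@der_eq _ _ _ (a * (1 + 0))); last by rewrite addr0 mulr1.
Qed.

Lemma der_opp H x a : is_derive (- x) 1 H a ->
  is_derive x 1 (fun y => H (- y)) (- a).
Proof.
move=> Ha; apply: (@der_eq _ _ _ (a * - 1)); last by rewrite mulrN1.
Qed.

Lemma continuous_shift h c : continuous h -> continuous (fun x => h (x - c)).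
Proof.
move=> ch x; apply: (@continuous_comp _ _ _ (fun y => y - c) h); last exact: ch.
by apply: (@der_continuous _ _ _ (1 + 0)); apply: derD.
Qed.

(** The increment of a primitive over one period does not depend on where the period starts, since
    its derivative [h (x + 2 pi) - h x] is 0. *)
Lemma circ_shift h c : continuous h -> (forall x, h (x + 2 * pi) = h x) ->
  circ (fun x => h (x - c)) = circ h.
Proof.
move=> ch hp; have dH x := der_int0 x ch; set H := int0 h in dH.
have -> : circ (fun x => h (x - c)) = H (pi - c) - H (- pi - c).
  apply: (@circ_primitive (fun x => H (x - c))); last exact: continuous_shift.
  by move=> x; exact: der_shift.
have -> : circ h = H pi - H (- pi) by exact: circ_primitive.
have D : H ((- pi - c) + 2 * pi) - H (- pi - c) = H (- pi + 2 * pi) - H (- pi).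
  apply: (@derivative0_cst _ (fun x => H (x + 2 * pi) - H x)) => x.
  have dHx := dH x; have dHs := der_shift (dH (x + 2 * pi)).
  by der; rewrite hp subrr.
have e1 : - pi - c + 2 * pi = pi - c by ring.
have e2 : - pi + 2 * pi = pi :> R by ring.
by rewrite e1 e2 in D.
Qed.

Lemma circ_odd h : continuous h -> (forall x, h (- x) = - h x) -> circ h = 0.
Proof.
move=> ch ho; have dH x := der_int0 x ch.
set H := int0 h in dH.
have -> : circ h = H pi - H (- pi) by exact: circ_primitive.
have -> : H pi - H (- pi) = H 0 - H (- 0).
  apply: (@derivative0_cst _ (fun x => H x - H (- x))) => x.
  have dHx := dH x; have dHo := der_opp (dH (- x)).
  by der; rewrite ho; ring.
by rewrite oppr0 subrr.
Qed.

Lemma circZl k h : continuous h -> circ (fun x => k * h x) = k * circ h.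
Proof. by move=> ch; rewrite /circ RintegralZl//; exact: segment_integrable. Qed.

Lemma circD h1 h2 : continuous h1 -> continuous h2 ->
  circ (fun x => h1 x + h2 x) = circ h1 + circ h2.
Proof. by move=> c1 c2; rewrite /circ RintegralD//; exact: segment_integrable. Qed.

Lemma eq_circ h1 h2 : h1 =1 h2 -> circ h1 = circ h2.
Proof. by move=> e; apply: eq_Rintegral => x _. Qed.

Lemma cosD2 x : cos (x + 2 * pi) = cos x.
Proof. by rewrite mulrC mulr_natr cosD2pi. Qed.

Lemma sinD2 x : sin (x + 2 * pi) = sin x.
Proof. by rewrite mulrC mulr_natr sinD2pi. Qed.

Lemma periodic_int (T : Type) (h : R -> T) (k : int) x :
  (forall x, h (x + 2 * pi) = h x) -> h (x + k%:~R * (2 * pi)) = h x.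
Proof.
move=> hp.
have N (n : nat) z : h (z + n%:R * (2 * pi)) = h z.
  elim: n => [|n IH]; first by rewrite mul0r addr0.
  by rewrite -natr1 mulrDl mul1r addrA hp IH.
case: k => n; first exact: N.
by rewrite NegzE mulrNz mulNr -{2}(subrK (n.+1%:R * (2 * pi)) x) N.
Qed.

Lemma cos_eq1 (z : R) : 0 <= z < 2 * pi -> cos z = 1 -> z = 0.
Proof.
move=> /andP[z0 zpi] cz; apply/eqP; rewrite eq_le z0 andbT leNgt; apply/negP => zp.
have zz : z = (z / 2) *+ 2 by rewrite -mulr_natr divfK.
have s0 : 0 < sin (z / 2) by apply: sin_gt0_pi; lra.
have := cz; rewrite zz cos_mulr2n cos2sin2 => e.
have : 0 < sin (z / 2) ^+ 2 by rewrite exprn_gt0.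
by lra.
Qed.

(** Cosine and sine determine an angle modulo 2 pi: after removing [k] full turns the difference
    lies in [0, 2 pi[ and has cosine 1, hence is 0. *)
Lemma periodic_angle (T : Type) (h : R -> T) x y :
  (forall x, h (x + 2 * pi) = h x) -> cos x = cos y -> sin x = sin y -> h x = h y.
Proof.
move=> hp cxy sxy.
have p0 : 0 < 2 * pi :> R by rewrite mulr_gt0 ?pi_gt0.
pose k := Num.floor ((x - y) / (2 * pi)).
have zb : 0 <= x - y - k%:~R * (2 * pi) < 2 * pi.
  have := Num.Theory.floor_itv ((x - y) / (2 * pi)); rewrite -/k => /andP[k1 k2].
  rewrite subr_ge0 -ler_pdivlMr// k1 /= ltrBlDl.
  by move: k2; rewrite intrD1 ltr_pdivrMr// mulrDl mul1r.
have cz : cos (x - y - k%:~R * (2 * pi)) = 1.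
  have -> : cos (x - y - k%:~R * (2 * pi)) = cos (x - y).
    by rewrite -mulNr -mulrNz (@periodic_int _ cos)// => z; exact: cosD2.
  by rewrite cosB cxy sxy -!expr2 cos2Dsin2.
have := cos_eq1 zb cz => e.
have -> : x = y + k%:~R * (2 * pi) by apply/eqP; rewrite -subr_eq0 opprD addrA e.
exact: periodic_int.
Qed.

Lemma continuous_cosX n : continuous (fun x : R => cos x ^+ n).
Proof.
move=> x; apply: (@der_continuous _ _ _ (n%:R * cos x ^+ n.-1 * (- sin x))).
by der; ring.
Qed.

(** Wallis recursion: the difference of the two sides integrates the derivative of cos^(n+1) sin,
    which vanishes at both ends. *)
Lemma circ_cosX_rec n :
  n.+2%:R * circ (fun x => cos x ^+ n.+2) = n.+1%:R * circ (fun x => cos x ^+ n).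
Proof.
rewrite -!circZl; try exact: continuous_cosX.
apply/eqP; rewrite -subr_eq0; apply/eqP.
have cZ k m : continuous (fun x : R => k * cos x ^+ m).
  move=> x; apply: (@der_continuous _ _ _ (k * (m%:R * cos x ^+ m.-1 * (- sin x)))).
  by der; ring.
rewrite -(@RintegralB _ _ _ mu)//; try (exact: segment_integrable).
rewrite [LHS](@circ_primitive (fun x => cos x ^+ n.+1 * sin x)).
- by rewrite sinN sinpi oppr0 !mulr0 subrr.
- move=> x; der.
  have := cos2Dsin2 x => e; rewrite -(natr1 n.+1) !exprS.
  have s2 : sin x * sin x = 1 - cos x * cos x by rewrite -e; ring.
  by rewrite [n.+1.-1]/= mulrN mulNr -mulrA s2; ring.
- by move=> x; apply: cvgB; exact: cZ.
Qed.

Lemma circ_cos0 : circ (fun x => cos x ^+ 0) = 2 * pi.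
Proof.
rewrite (@circ_primitive id) => [|x]; first by rewrite opprK; ring.
exact: continuous_cosX.
Qed.

Lemma circ_cos1 : circ (fun x => cos x ^+ 1) = 0.
Proof.
rewrite (@circ_primitive sin) => [|x]; first by rewrite sinN sinpi; ring.
exact: continuous_cosX.
Qed.

Lemma circ_cosX_odd m : circ (fun x => cos x ^+ (2 * m).+1) = 0.
Proof.
elim: m => [|m IH]; first exact: circ_cos1.
apply: (@mulfI _ (2 * m).+3%:R); first by rewrite pnatr_eq0.
by rewrite mulnS circ_cosX_rec IH !mulr0.
Qed.

Lemma circ_cosX_even m : circ (fun x => cos x ^+ (2 * m)) =
  2 * pi * (2 * m)`!%:R / (4 ^+ m * m`!%:R ^+ 2).
Proof.
elim: m => [|m IH].
  by rewrite muln0 circ_cos0 !fact0 expr0 expr1n; field.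
apply: (@mulfI _ (2 * m).+2%:R); first by rewrite pnatr_eq0.
rewrite mulnS [(2 + _)%N]/= circ_cosX_rec IH !factS !natrM (exprS 4 m).
have f0 : m`!%:R != 0 :> R by rewrite pnatr_eq0 -lt0n fact_gt0.
have m0 : m.+1%:R != 0 :> R by rewrite pnatr_eq0.
have m1 : 1 + m%:R != 0 :> R by rewrite nat1r.
have e1 : (2 * m).+2%:R = 2 * m.+1%:R :> R by rewrite -natrM mulnS.
by rewrite e1; field; rewrite m1 f0 expf_neq0.
Qed.

End Circle.

(** * Bessel functions *)

Section Bessel.
Context {R : realType}.
Notation mu := (@lebesgue_measure R).
Implicit Types (h : R -> R) (x y c a kappa : R).

Lemma exp_series_bound x y (N : nat) : `|x| <= y ->
  `|\sum_(0 <= n < N) exp_coeff x n| <= expR y.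
Proof.
move=> xy; have y0 : 0 <= y by exact: le_trans xy.
apply: (le_trans (ler_norm_sum _ _ _)).
apply: (@le_trans _ _ (series (exp_coeff y) N)).
  rewrite /series /=; apply: ler_sum => n _.
  rewrite /exp_coeff /= normrM normfV normr_nat normrX ler_wpM2r// ?invr_ge0//.
  by rewrite lerXn2r ?nnegrE.
rewrite /expR; apply: (@nondecreasing_cvgn_le _ (series (exp_coeff y))).
  by apply: nondecreasing_series => n _ _; rewrite exp_coeff_ge0.
exact: is_cvg_series_exp_coeff.
Qed.

Lemma continuous_von_mises_weight kappa j :
  continuous (fun x : R => cos x ^+ j * expR (kappa * cos x)).
Proof.
move=> x; apply: (@der_continuous _ _ _ (j%:R * cos x ^+ j.-1 * (- sin x) * expR (kappa * cos x)
    + cos x ^+ j * (expR (kappa * cos x) * (kappa * (- sin x))))).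
by der; ring.
Qed.

(** The exponential is expanded and integrated term by term; all partial sums are dominated by the
    constant exp |kappa|. *)
Lemma circ_exp_series kappa j :
  (\sum_(0 <= n < N) kappa ^+ n / n`!%:R * circ (fun x : R => cos x ^+ (n + j)))
    @[N --> \oo] --> circ (fun x => cos x ^+ j * expR (kappa * cos x)).
Proof.
pose u (N : nat) x := cos x ^+ j * \sum_(0 <= n < N) exp_coeff (kappa * cos x) n.
have cu N : continuous (u N).
  have ce x : {for x, continuous (fun x => \sum_(0 <= n < N) exp_coeff (kappa * cos x) n)}.
    elim: N => [|N IH].
      have -> : (fun x => \sum_(0 <= n < 0) exp_coeff (kappa * cos x) n) = cst 0.
        by apply/funext => z; rewrite big_nil.
      exact: cst_continuous.
    have -> : (fun x => \sum_(0 <= n < N.+1) exp_coeff (kappa * cos x) n) =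
        (fun x => \sum_(0 <= n < N) exp_coeff (kappa * cos x) n + exp_coeff (kappa * cos x) N).
      by apply/funext => z; rewrite big_nat_recr.
    apply: cvgD; first exact: IH.
    pose d := (N%:R * (kappa * cos x) ^+ N.-1 * (kappa * - sin x)) / N`!%:R.
    have := @der_continuous R (fun x => exp_coeff (kappa * cos x) N) x d; apply.
    by rewrite /exp_coeff /=; der; rewrite /d; ring.
  by move=> x; apply: cvgM; [exact: continuous_cosX | exact: ce].
have E N : circ (u N) = \sum_(0 <= n < N) kappa ^+ n / n`!%:R * circ (fun x : R => cos x ^+ (n +
    j)).
  elim: N {cu} (cu : forall N, continuous (u N)) => [|N IH] cu.
    rewrite big_nil /circ /u; under eq_Rintegral do rewrite big_nil mulr0.
    by rewrite Rintegral_cst// mul0r.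
  rewrite big_nat_recr//= -IH// -circZl; last exact: continuous_cosX.
  rewrite -circD//.
  - apply: eq_circ => x; rewrite /u big_nat_recr//= mulrDr; congr (_ + _).
    by rewrite /exp_coeff /= exprD exprMn; ring.
  - move=> x; apply: cvgM; [exact: cvg_cst | exact: continuous_cosX].
under eq_fun do rewrite -E.
have [|||||] := @dominated_convergence _ _ R mu `[- pi, pi]%classic (measurable_itv _)
  (fun N x => (u N x)%:E) (fun x => (cos x ^+ j * expR (kappa * cos x))%:E)
  (fun=> (expR `|kappa|)%:E).
- move=> N; apply/measurable_EFinP; apply: measurable_funS (measurableT) _ _ => //.
  exact: continuous_measurable_fun.
- apply/measurable_EFinP; apply: measurable_funS (measurableT) _ _ => //.
  by apply: continuous_measurable_fun; exact: continuous_von_mises_weight.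
- apply: aeW => x _; apply: cvg_EFin; first by apply: nearW.
  apply: cvgM; first exact: cvg_cst.
  exact: is_cvg_series_exp_coeff.
- by apply: (@segment_integrable _ (cst (expR `|kappa|))); exact: cst_continuous.
- apply: aeW => x N _; rewrite /= lee_fin /u normrM normrX.
  apply: (@le_trans _ _ (1 * `|\sum_(0 <= n < N) exp_coeff (kappa * cos x) n|)).
    by rewrite ler_wpM2r// exprn_ile1// cos_max.
  rewrite mul1r; apply: exp_series_bound.
  by rewrite normrM ler_piMr// cos_max.
move=> iw _ H.
have -> : (fun N => circ (u N)) =
  fine \o [sequence (\int[mu]_(x in `[(- pi)%R, pi]) (u n x)%:E)%E]_n by [].
apply: fine_cvg; rewrite /circ /Rintegral fineK; first exact: H.
exact: integrable_fin_num.
Qed.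

(** Integral representation of the Bessel function. It is limited to j <= 1, where cos (j x) and
    (cos x)^j coincide; for larger j the two differ. *)
Lemma besselI_circ j kappa : (j <= 1)%N ->
  2 * pi * besselI j kappa = circ (fun x => cos x ^+ j * expR (kappa * cos x)).
Proof.
move=> j1; set I := circ _.
pose v (m : nat) : R := (kappa / 2) ^+ (2 * m + j) / (m`!%:R * (m + j)`!%:R).
(* Odd powers of the cosine integrate to 0, so of each two consecutive terms of the exponential
   series one survives, and 2 N of them give N terms of the Bessel series. *)
have E N : \sum_(0 <= n < 2 * N) kappa ^+ n / n`!%:R * circ (fun x : R => cos x ^+ (n + j))
   = 2 * pi * series v N.
  have := @circ_cosX_even R; have := pi_gt0 R; move: (@pi R) => P P0 even.
  elim: N => [|N IH]; first by rewrite muln0 /series /= !big_nil mulr0.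
  rewrite mulnS [(2 + _)%N]/= !big_nat_recr//= IH /series /= big_nat_recr//= mulrDr -addrA.
  congr (_ + _); rewrite /v.
  have f0 n : n`!%:R != 0 :> R by rewrite pnatr_eq0 -lt0n fact_gt0.
  have s0 n : n.+1%:R != 0 :> R by rewrite pnatr_eq0.
  have s1 n : 1 + n%:R != 0 :> R by rewrite nat1r.
  have e1 (n : nat) : (2 * n).+2%:R = 2 * n.+1%:R :> R by rewrite -natrM mulnS.
  have e4 : 4 ^+ N = 2 ^+ (2 * N) :> R by rewrite exprM; congr (_ ^+ _); ring.
  have p2 n : 2 ^+ n != 0 :> R by rewrite expf_neq0.
  have [->|->] : j = 0%N \/ j = 1%N.
  - by clear -j1; case: j j1 => [|[|//]] _; [left|right].
  - rewrite addn0 even addSn addn0 circ_cosX_odd mulr0 addr0 !addn0 e4 expr_div_n.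
    by field; rewrite p2 !f0.
  - rewrite !addn1 circ_cosX_odd mulr0 add0r -[(2 * N).+2](mulnS 2 N) even.
  rewrite [(2 * N.+1)%N]mulnS [(2 + _)%N]/= !factS !natrM (exprS 4) e4 e1 expr_div_n.
  rewrite (exprS 2 (2 * N)%N).
  by field; rewrite p2 !f0 !s1 -natrM nat1r s0.
have cI := @circ_exp_series kappa j.
have : series v @ \oo --> I / (2 * pi).
  have -> : series v = fun N => (\sum_(0 <= n < 2 * N) kappa ^+ n / n`!%:R * circ (fun x : R =>
      cos x ^+ (n + j))) / (2 * pi).
    apply/funext => N; rewrite E mulrC mulrA mulVf ?mul1r//.
    by rewrite mulf_neq0// gt_eqF// pi_gt0.
  apply: cvgM; last exact: cvg_cst.
  apply: (cvg_comp (fun N => (2 * N)%N)) cI.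
  apply/cvgnyPge => A; exists A => // n /= An; rewrite (leq_trans An)// leq_pmull//.
move=> /cvg_lim vI; rewrite /besselI vI//.
by rewrite mulrC divfK// mulf_neq0// gt_eqF// pi_gt0.
Qed.

Lemma besselI0_gt0 kappa : 0 < besselI 0 kappa.
Proof.
have := @besselI_circ 0 kappa isT.
under eq_circ do rewrite expr0 mul1r.
move=> e; suff : 0 < 2 * pi * besselI 0 kappa by rewrite pmulr_rgt0// mulr_gt0// pi_gt0.
rewrite e lt0r; apply/andP; split; last first.
  by apply: Rintegral_ge0 => x _; exact: expR_ge0.
apply/negP => /eqP I0.
have cw : continuous (fun x : R => expR (kappa * cos x)).
  move=> x; apply: (@der_continuous _ _ _ (expR (kappa * cos x) * (kappa * - sin x))).
have := int_segment_ge0_eq0 cw (fun x => expR_ge0 _) I0 (x := 0).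
by rewrite oppr_lt0 pi_gt0 => /(_ isT) /eqP; rewrite gt_eqF// expR_gt0.
Qed.

End Bessel.

(** * The generalized collision invariant *)

Section CollisionInvariant.
Context {R : realType}.
Variable kappa : R.
Hypothesis kappa_gt0 : 0 < kappa.
Notation mu := (@lebesgue_measure R).
Implicit Types (x y c a : R).

Let e (s : R) := expR (- kappa * cos s).
Let E := int0 e pi.

Let der_e x : is_derive x 1 e (kappa * sin x * e x).
Proof. by rewrite /e; der; ring. Qed.

Let cont_e : continuous e.
Proof. exact: derives_continuous der_e. Qed.

Let E_gt0 : 0 < E.
Proof.
rewrite /E /int0 pi_ge0 lt0r; apply/andP; split; last first.
  by apply: Rintegral_ge0 => x _; exact: expR_ge0.
apply/negP => /eqP I0.
have := int_segment_ge0_eq0 cont_e (fun x => expR_ge0 _) I0 (x := pi / 2).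
have p0 := pi_gt0 R.
have -> : 0 < (pi / 2 : R) < pi by apply/andP; split; lra.
by move=> /(_ isT) /eqP; rewrite gt_eqF// expR_gt0.
Qed.

Definition dgci y : R := kappa^-1 - pi / kappa * (e y / E).
Definition ddgci y : R := - pi * sin y * e y / E.

Lemma der_gci y : is_derive y 1 (gci kappa) (dgci y).
Proof.
have de := der_int0 y cont_e.
by rewrite /gci -/e -/E; der; rewrite /dgci; ring.
Qed.

Lemma der_dgci y : is_derive y 1 dgci (ddgci y).
Proof.
have de := der_e y.
rewrite /dgci; der; rewrite /ddgci.
by field; rewrite !gt_eqF.
Qed.

(** Since e' = kappa sin e, the exponential part of [dgci] solves the homogeneous equation, and the
    constant 1 / kappa is a particular solution. *)
Lemma gci_ode y : ddgci y - kappa * sin y * dgci y = - sin y.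
Proof.
by rewrite /ddgci /dgci; field; rewrite !gt_eqF.
Qed.

Lemma continuous_gci : continuous (gci kappa).
Proof. exact: derives_continuous der_gci. Qed.

Lemma dgciD2 y : dgci (y + 2 * pi) = dgci y.
Proof. by rewrite /dgci /e cosD2. Qed.

Lemma dgciN y : dgci (- y) = dgci y.
Proof. by rewrite /dgci /e cosN. Qed.

Lemma gci0 : gci kappa 0 = 0.
Proof.
by rewrite /gci /int0 lexx set_itv1 Rintegral_set1 mul0r !mulr0 subr0.
Qed.

(** This fixes the factor pi / kappa in [gci]: together with oddness, vanishing at pi makes the
    function 2 pi-periodic despite its linear term. *)
Lemma gci_pi : gci kappa pi = 0.
Proof.
rewrite /gci -/e -/E divff; first by rewrite mulr1 mulrC subrr.
by rewrite gt_eqF.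
Qed.

Lemma gciN y : gci kappa (- y) = - gci kappa y.
Proof.
apply/eqP; rewrite -addr_eq0; apply/eqP.
have -> : gci kappa (- y) + gci kappa y = gci kappa (- 0) + gci kappa 0.
  apply: (@derivative0_cst _ (fun z => gci kappa (- z) + gci kappa z)) => z.
  have d1 := der_gci z; have d2 := der_opp (der_gci (- z)).
  by der; rewrite dgciN; ring.
by rewrite oppr0 gci0 addr0.
Qed.

Lemma gciD2 y : gci kappa (y + 2 * pi) = gci kappa y.
Proof.
apply/eqP; rewrite -subr_eq0; apply/eqP.
have -> : gci kappa (y + 2 * pi) - gci kappa y =
          gci kappa (- pi + 2 * pi) - gci kappa (- pi).
  apply: (@derivative0_cst _ (fun z => gci kappa (z + 2 * pi) - gci kappa z)) => z.
  have d1 := der_gci z; have d2 := der_shift (der_gci (z + 2 * pi)).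
  by der; rewrite dgciD2; ring.
have -> : - pi + 2 * pi = pi :> R by ring.
by rewrite gciN gci_pi oppr0 subrr.
Qed.

(** Turns convergence of the mean angle into uniform convergence of the test functions. The constant
    bounds [dgci], using that [e] is at most exp kappa. *)
Lemma gci_lipschitz : exists2 L : R, 0 <= L &
  forall x y, `|gci kappa x - gci kappa y| <= L * `|x - y|.
Proof.
pose L := kappa^-1 + pi / kappa * (expR kappa / E).
have p0 := pi_gt0 R.
have L0 : 0 <= L.
  by rewrite addr_ge0 ?invr_ge0 ?(ltW kappa_gt0)// !mulr_ge0 ?invr_ge0 ?expR_ge0// ltW.
exists L => // x y.
have dL z : `|dgci z| <= L.
  rewrite (le_trans (ler_normB _ _))// lerD//.
    by rewrite ger0_norm// invr_ge0 ltW.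
  have s0 : 0 <= pi / kappa * (e z / E).
    by rewrite !mulr_ge0 ?invr_ge0 ?expR_ge0// ltW.
  rewrite (ger0_norm s0) ler_wpM2l//; first by rewrite divr_ge0 ?ltW.
  rewrite ler_pM2r ?invr_gt0// ler_expR mulNr lerNl -[X in X <= _]mulrN1.
  by rewrite ler_pM2l// cos_geN1.
wlog xy : x y / x <= y.
  move=> H; have [xy|/ltW yx] := leP x y; first exact: H.
  by rewrite distrC (distrC x); exact: H.
rewrite distrC (distrC x).
have [||z _ ->] := @MVT_segment R (gci kappa) dgci x y xy.
- by move=> z _; exact: der_gci.
- by apply: continuous_subspaceT; exact: continuous_gci.
by rewrite normrM ler_wpM2r.
Qed.

Local Notation N := (von_mises kappa 0).

Lemma von_misesE y : N y = (2 * pi * besselI 0 kappa)^-1 * expR (kappa * cos y).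
Proof. by rewrite /von_mises subr0. Qed.

Lemma von_mises_gt0 c y : 0 < von_mises kappa c y.
Proof.
by rewrite /von_mises mulr_gt0 ?expR_gt0// invr_gt0 !mulr_gt0 ?besselI0_gt0 ?pi_gt0.
Qed.

Lemma der_von_mises c y :
  is_derive y 1 (von_mises kappa c) (- kappa * sin (y - c) * von_mises kappa c y).
Proof. by rewrite /von_mises; der; ring. Qed.

Lemma continuous_von_mises c : continuous (von_mises kappa c).
Proof. exact: derives_continuous (der_von_mises c). Qed.

Lemma circ_von_mises_cosX j : (j <= 1)%N ->
  circ (fun x => cos x ^+ j * N x) = besselI j kappa / besselI 0 kappa.
Proof.
move=> j1.
have Z0 : besselI 0 kappa != 0 by rewrite gt_eqF// besselI0_gt0.
have p0 : pi != 0 :> R by rewrite gt_eqF// pi_gt0.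
transitivity ((2 * pi * besselI 0 kappa)^-1 * circ (fun x => cos x ^+ j * expR (kappa * cos x))).
  rewrite -circZl; last exact: continuous_von_mises_weight.
  by apply: eq_circ => x; rewrite von_misesE; ring.
rewrite -besselI_circ//; move: (pi) p0 => P p0.
by field; rewrite Z0 p0.
Qed.

Lemma circ_von_mises : circ N = 1.
Proof.
have := @circ_von_mises_cosX 0 isT.
rewrite divff ?gt_eqF ?besselI0_gt0// => <-.
by apply: eq_circ => x; rewrite expr0 mul1r.
Qed.

Lemma circ_von_mises_cos : circ (fun x => cos x * N x) = c1 kappa.
Proof. by rewrite /c1 -circ_von_mises_cosX. Qed.

Lemma K1_circ : K1 kappa = circ (fun x => sin x * N x * gci kappa x).
Proof. by []. Qed.

(** By the equation for [gci], (N gci')' = - sin N, so integrating by parts against [gci] gives K1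
    as the integral of N gci'^2. *)
Lemma K1_gt0 : 0 < K1 kappa.
Proof.
pose h x := N x * dgci x ^+ 2.
have ch : continuous h.
  move=> x; apply: (@der_continuous _ _ _ ((- kappa * sin (x - 0) * N x) * dgci x ^+ 2 + N x *
      (2 * dgci x * ddgci x))).
  have d1 := der_von_mises 0 x; have d2 := der_dgci x.
  by rewrite /h; der; rewrite /= expr1; ring.
have h0 x : 0 <= h x by rewrite mulr_ge0 ?sqr_ge0// ltW// von_mises_gt0.
have ck : continuous (fun x => sin x * N x * gci kappa x).
  move=> x; apply: cvgM; last exact: continuous_gci.
  by apply: cvgM; [exact: continuous_sin|exact: continuous_von_mises].
have KE : K1 kappa = circ h.
  apply/eqP; rewrite K1_circ -subr_eq0 -[X in _ - X]mul1r -mulNr -circZl//.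
  apply/eqP; rewrite -circD//; last by move=> x; apply: cvgM; [exact: cvg_cst|exact: ch].
  (* Primitive of the difference of the two integrands; it vanishes at both ends because [gci]
     does. *)
  pose F x := - (N x * dgci x * gci kappa x).
  transitivity (F pi - F (- pi)).
    apply: circ_primitive => x.
  - have d1 := der_von_mises 0 x; have d2 := der_dgci x; have d3 := der_gci x.
    rewrite /F; der; rewrite /h subr0.
    have -> : ddgci x = kappa * sin x * dgci x - sin x by rewrite -gci_ode; ring.
    by ring.
  - apply: cvgD; first exact: ck.
    by apply: cvgM; [exact: cvg_cst|exact: ch].
  by rewrite /F gciN gci_pi oppr0 !mulr0 subrr.
rewrite KE lt0r; apply/andP; split; last by apply: Rintegral_ge0.
apply/negP => /eqP I0.
have p0 := pi_gt0 R.
have hz := int_segment_ge0_eq0 ch h0 I0.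
have dz x : - pi < x < pi -> dgci x = 0.
  move=> /hz /eqP; rewrite mulf_eq0 gt_eqF ?von_mises_gt0//= sqrf_eq0 => /eqP.
  exact.
(* If the integral were 0, [dgci] would vanish on the open period. At 0 and pi / 2 the exponents of
   [e] are - kappa and 0, which would force kappa = 0. *)
have : dgci 0 = dgci (pi / 2).
  by rewrite !dz//; apply/andP; split; lra.
rewrite /dgci => /addrI /oppr_inj /(mulfI _) => H.
have : e 0 / E = e (pi / 2) / E by apply: H; rewrite mulf_neq0 ?invr_eq0 ?gt_eqF.
move=> /(mulIf _) => {}H.
have : e 0 = e (pi / 2) by apply: H; rewrite invr_eq0 gt_eqF.
move=> /expR_inj /eqP; rewrite cos0 cos_pihalf mulr0 mulr1 oppr_eq0.
by rewrite gt_eqF.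
Qed.

End CollisionInvariant.

(** * Uniqueness of the equilibrium *)

Section Continuity.
Context {R : realType} {T : topologicalType}.
Implicit Types (f g : T -> R).

Lemma contD f g : continuous f -> continuous g -> continuous (fun p => f p + g p).
Proof. by move=> cf cg x; apply: cvgD; [exact: cf|exact: cg]. Qed.

Lemma contN f : continuous f -> continuous (fun p => - f p).
Proof. by move=> cf x; apply: cvgN; exact: cf. Qed.

Lemma contM f g : continuous f -> continuous g -> continuous (fun p => f p * g p).
Proof. by move=> cf cg x; apply: cvgM; [exact: cf|exact: cg]. Qed.

Lemma contX f n : continuous f -> continuous (fun p => f p ^+ n).
Proof.
move=> cf; elim: n => [|n IH]; first exact: cst_continuous.
by under eq_fun do rewrite exprS; exact: contM.
Qed.

Lemma contV f : (forall p, f p != 0) -> continuous f -> continuous (fun p => (f p)^-1).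
Proof. by move=> f0 cf x; apply: cvgV => //; exact: cf. Qed.

Lemma cont_comp (F : R -> R) f : continuous F -> continuous f -> continuous (fun p => F (f p)).
Proof. by move=> cF cf x; apply: (@continuous_comp _ _ _ f F); [exact: cf|exact: cF]. Qed.

End Continuity.

Ltac cont_step :=
  first [eassumption |
  lazymatch goal with
  | |- continuous (fun p => p) => move=> ?; exact: cvg_id
  | |- continuous fst => move=> ?; exact: cvg_fst
  | |- continuous snd => move=> ?; exact: cvg_snd
  | |- continuous -%R => move=> ?; apply: cvgN; exact: cvg_id
  | |- continuous ( *%R ?k) => move=> ?; apply: cvgM; [exact: cvg_cst|exact: cvg_id]
  | |- continuous id => move=> ?; exact: cvg_id
  | |- continuous cos => exact: continuous_cos
  | |- continuous sin => exact: continuous_sin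
  | |- continuous (fun p => p.1) => move=> ?; exact: cvg_fst
  | |- continuous (fun p => p.2) => move=> ?; exact: cvg_snd
  | |- continuous (fun p => @?f p + @?g p) => apply: contD
  | |- continuous (fun p => - @?f p) => apply: contN
  | |- continuous (fun p => @?f p * @?g p) => apply: contM
  | |- continuous (fun p => @?f p ^+ _) => apply: contX
  | |- continuous (fun p => (@?f p)^-1) => first [exact: cst_continuous | apply: contV]
  | |- continuous (fun p => expR (@?f p)) => apply: (@cont_comp _ _ expR f); [exact:
      continuous_expR|]
  | |- continuous (fun p => sin (@?f p)) => apply: (@cont_comp _ _ sin f); [exact: continuous_sin|]
  | |- continuous (fun p => cos (@?f p)) => apply: (@cont_comp _ _ cos f); [exact: continuous_cos|]
  | |- continuous _ => exact: cst_continuous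
  end].
Ltac cont := repeat cont_step.

(** * Parametric integrals and bounded solutions *)

Section Liouville.
Context {R : realType}.
Notation mu := (@lebesgue_measure R).
Implicit Types (x y c a th om : R) (h : R -> R -> R).

Definition cont2 h := continuous (fun p : R * R => h p.1 p.2).

Lemma cont2_l h om : cont2 h -> continuous (h ^~ om).
Proof.
move=> ch x; apply: (@continuous_comp _ _ _ (fun y : R => (y, om)) (fun p => h p.1 p.2)).
  by apply: (@cvg_pair _ _ _ (nbhs x) (nbhs x) (nbhs om) _ _ _ id (cst om)); [exact:
      cvg_id|exact: cvg_cst].
exact: ch.
Qed.

Lemma cont2_r h th : cont2 h -> continuous (h th).
Proof.
move=> ch x; apply: (@continuous_comp _ _ _ (fun y : R => (th, y)) (fun p => h p.1 p.2)).
  by apply: (@cvg_pair _ _ _ (nbhs x) (nbhs th) (nbhs x) _ _ _ (cst th) id); [exact: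
      cvg_cst|exact: cvg_id].
exact: ch.
Qed.

Lemma cont2_bounded h a b : cont2 h -> exists2 M, 0 <= M &
  forall th om, - pi <= th <= pi -> a <= om <= b -> `|h th om| <= M.
Proof.
move=> ch; have [ab|ba] := leP a b; last first.
  by exists 0 => // th om _ /andP[ao ob]; have := le_lt_trans ob (lt_le_trans ba ao); rewrite ltxx.
have cK : compact (`[- pi, pi]%classic `*` `[a, b]%classic : set (R * R)).
  by apply: compact_setX; exact: segment_compact.
have cn : continuous (fun p : R * R => `|h p.1 p.2|).
  by move=> p; apply: cvg_norm; exact: ch.
have [|c _ Hc] := @compact_EVT_max (R * R)%type R _ _ _ cK (continuous_subspaceT cn).
  by exists (0, a) => /=; rewrite !in_itv /= lexx ab oppr_le0 pi_ge0.
exists `|h c.1 c.2| => // th om thp omp.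
by apply: (Hc (th, om)); rewrite inE /=; rewrite !in_itv.
Qed.

(** Differentiation under the integral; by compactness a constant dominates [h2] for parameters
    within distance 1 of [om]. *)
Lemma der_circ_param h h2 om :
  (forall th y, is_derive y 1 (h th) (h2 th y)) -> cont2 h -> cont2 h2 ->
  is_derive om 1 (fun y => circ (h ^~ y)) (circ (h2 ^~ om)).
Proof.
move=> dh ch ch2.
have [M M0 HM] := cont2_bounded (om - 1) (om + 1) ch2.
have omI : `]om - 1, om + 1[%classic om by rewrite /= in_itv /=; lra.
have dE : partial1of2 (fun y th => h th y) = fun y th => h2 th y.
  by apply/funext => y; apply/funext => th; rewrite /partial1of2 (der_derive1 (dh th y)).
have intf x : `]om - 1, om + 1[%classic x -> mu.-integrable `[- pi, pi] (EFin \o (h ^~ x)).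
  by move=> _; apply: segment_integrable; exact: cont2_l.
have derf x y : `]om - 1, om + 1[%classic x -> `[- pi, pi]%classic y -> derivable (fun z => h y
    z) x 1.
  by move=> _ _; exact: ex_derive.
have intM : mu.-integrable `[- pi, pi] (EFin \o (fun=> M)).
  by apply: segment_integrable; exact: cst_continuous.
have ub x y : `]om - 1, om + 1[%classic x -> `[- pi, pi]%classic y ->
   `|partial1of2 (fun z th => h th z) x y| <= M.
  rewrite dE /= !in_itv /= => /andP[x1 x2] yp; apply: HM => //.
  by rewrite !ltW.
have mI : measurable (`[- pi, pi]%classic : set (measurableTypeR R)) by exact: measurable_itv.
have D := @derivable_under_integral R _ _ mu (fun y th => h th y) _ mI om _ _ omI intf derf _
    (fun=> M0) intM ub.
have E := @differentiation_under_integral R _ _ mu (fun y th => h th y) _ mI om _ _ omI intf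
    derf _ (fun=> M0) intM ub.
rewrite dE in E.
by apply: DeriveDef; [exact: D | rewrite -derive1E; exact: E].
Qed.

(** If [V] is nonzero somewhere, monotonicity keeps it at least as far from 0 on a whole half-line,
    to the left when negative and to the right when positive. As [E] is at most 1, the slope of [W]
    there is at least as large in absolute value, which contradicts its boundedness. *)
Lemma bounded_flux_eq0 (W W1 V V1 E : R -> R) M :
  (forall y, is_derive y 1 W (W1 y)) -> (forall y, is_derive y 1 V (V1 y)) ->
  (forall y, 0 <= V1 y) -> (forall y, V y = E y * W1 y) ->
  (forall y, 0 < E y <= 1) -> (forall y, 0 <= W y <= M) -> forall y, V y = 0.
Proof.
move=> dW dV V10 VE E01 WM y0.
have mono x y : x <= y -> V x <= V y.
  move=> xy; have [|z _ e] := @MVT_segment R V V1 x y xy (fun z _ => dV z).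
    by apply: continuous_subspaceT; exact: derives_continuous dV.
  by rewrite -subr_ge0 e mulr_ge0 ?subr_ge0.
have incr x y : x <= y -> exists2 z, x <= z <= y & W y - W x = W1 z * (y - x).
  move=> xy; have [|z zI e] := @MVT_segment R W W1 x y xy (fun z _ => dW z).
    by apply: continuous_subspaceT; exact: derives_continuous dW.
  by exists z; rewrite ?(itvP zI).
have M0 : 0 <= M by have /andP[] := WM 0; exact: le_trans.
apply/eqP/contraT; rewrite neq_lt => /orP[Vn|Vp].
(* Over a length [d] the slope forces [W] to move by at least M + 1, more than its range allows. *)
- pose d := (M + 1) / - V y0.
  have d0 : 0 < d by rewrite divr_gt0 ?oppr_gt0// ltr_wpDl.
  have [|z /andP[_ zy] e] := incr (y0 - d) y0; first by rewrite gerBl ltW.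
  have /andP[Ez E1] := E01 z.
  have W1z : W1 z <= V y0.
    have Vz := mono _ _ zy; rewrite (le_trans _ Vz)// VE.
    have W1n : W1 z <= 0.
      by rewrite -(pmulr_rle0 _ Ez) -VE (le_trans Vz)// ltW.
    by rewrite ler_niMl.
  have : W y0 - W (y0 - d) <= - (M + 1).
    rewrite e opprB addrC subrK.
    have -> : - (M + 1) = V y0 * d by rewrite /d; field; rewrite lt_eqF.
    by rewrite ler_pM2r.
  have := WM y0; have := WM (y0 - d); lra.
- pose d := (M + 1) / V y0.
  have d0 : 0 < d by rewrite divr_gt0// ltr_wpDl.
  have [|z /andP[yz _] e] := incr y0 (y0 + d); first by rewrite lerDl ltW.
  have /andP[Ez E1] := E01 z.
  have W1z : V y0 <= W1 z.
    have Vz := mono _ _ yz; rewrite (le_trans Vz)// VE.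
    have W1n : 0 <= W1 z.
      by rewrite -(pmulr_rge0 _ Ez) -VE (le_trans _ Vz)// ltW.
    by rewrite ler_piMl.
  have : M + 1 <= W (y0 + d) - W y0.
    rewrite e addrAC subrr add0r.
    have -> : M + 1 = V y0 * d by rewrite /d; field; rewrite gt_eqF.
    by rewrite ler_pM2r.
  have := WM y0; have := WM (y0 + d); lra.
Qed.

Lemma der_periodic (f f1 : R -> R) :
  (forall x, is_derive x 1 f (f1 x)) -> (forall x, f (x + 2 * pi) = f x) ->
  forall x, f1 (x + 2 * pi) = f1 x.
Proof.
move=> df fp x.
have := der_shift (df (x + 2 * pi)).
have -> : (fun y => f (y + 2 * pi)) = f by apply/funext => y; rewrite fp.
by move/der_derive1 <-; rewrite (der_derive1 (df x)).
Qed.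

End Liouville.

Section Equilibrium.
Context {R : realType}.
Notation mu := (@lebesgue_measure R).
Implicit Types (x y a th om : R) (h : R -> R -> R).

(* Testing the equation against the bounded subharmonic function 1 / (1 + g)
   makes the argument work without any integrability of g in om. *)
Lemma liouville (kappa c s m A B : R) (g g1 g2 g11 g22 : R -> R -> R) :
  0 <= s -> 0 < A -> 0 < B ->
  (forall th om, 0 <= g th om) ->
  (forall th om, g (th + 2 * pi) om = g th om) ->
  (forall th om, is_derive th 1 (g ^~ om) (g1 th om)) ->
  (forall th om, is_derive th 1 (g1 ^~ om) (g11 th om)) ->
  (forall th om, is_derive om 1 (g th) (g2 th om)) ->
  (forall th om, is_derive om 1 (g2 th) (g22 th om)) ->
  cont2 g -> cont2 g1 -> cont2 g2 -> cont2 g11 -> cont2 g22 ->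
  (forall th om, A * (g11 th om - kappa * sin (th - c) * g1 th om) +
     B * (g22 th om - 2 * s * (om - m) * g2 th om) = 0) ->
  forall th om, g th om = g 0 0.
Proof.
move=> s0 A0 B0 g0 gp dg1 dg11 dg2 dg22 cg cg1 cg2 cg11 cg22 pde.
pose q th om := 1 + g th om.
have q0 th om : 0 < q th om by rewrite /q ltr_pwDl.
have qn0 th om : q th om != 0 by rewrite gt_eqF.
(* [E1] and [E2] are the unnormalised von Mises and Gaussian weights, which put the two halves of
   the operator in divergence form. *)
pose E1 th := expR (kappa * cos (th - c)).
pose E2 om := expR (- s * (om - m) ^+ 2).
have cq : continuous (fun p : R * R => q p.1 p.2) by rewrite /q; cont.
have cE1 : continuous (fun p : R * R => E1 p.1) by rewrite /E1; cont.
(* With q = 1 + g, [u] is the weighted test function, [u2] and [u22] its omega-derivatives, [F] is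
   E1 times the theta-derivative of 1 / q, and [F1] the derivative of [F]. [D] is E1 L(1 / q): since
   L g = 0, only the quadratic terms of the chain rule remain. *)
pose u th om := E1 th * (q th om)^-1.
pose u2 th om := - (E1 th * g2 th om * (q th om) ^- 2).
pose u22 th om := E1 th * (- g22 th om * (q th om) ^- 2 + 2 * g2 th om ^+ 2 * (q th om) ^- 3).
pose F th om := - (E1 th * g1 th om * (q th om) ^- 2).
pose F1 th om := E1 th * (kappa * sin (th - c) * g1 th om * (q th om) ^- 2 - g11 th om * (q th
    om) ^- 2 + 2 * g1 th om ^+ 2 * (q th om) ^- 3).
pose D th om := 2 * E1 th * (A * g1 th om ^+ 2 + B * g2 th om ^+ 2) * (q th om) ^- 3.
have cu : cont2 u by rewrite /cont2 /u; cont => // p.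
have cu2 : cont2 u2 by rewrite /cont2 /u2; cont => // p; rewrite expf_neq0.
have cu22 : cont2 u22 by rewrite /cont2 /u22; cont => // p; rewrite expf_neq0.
have cF1 : cont2 F1 by rewrite /cont2 /F1; cont => // p; rewrite expf_neq0.
have cD : cont2 D by rewrite /cont2 /D; cont => // p; rewrite expf_neq0.
have du th y : is_derive y 1 (u th) (u2 th y).
  have d := dg2 th y; rewrite /u /q; der; first exact: qn0.
  by rewrite /u2 /q; ring.
have du2 th y : is_derive y 1 (u2 th) (u22 th y).
  have d := dg2 th y; have d' := dg22 th y; rewrite /u2 /q; der.
    by rewrite expf_neq0// qn0.
  have := qn0 th y; rewrite /u22 /q => q1; field; exact: q1.
have dF y th : is_derive th 1 (F ^~ y) (F1 th y).
  have d := dg1 th y; have d' := dg11 th y; rewrite /F /q /E1; der.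
    by rewrite expf_neq0// qn0.
  have := qn0 th y; rewrite /F1 /q /E1 => q1; field; exact: q1.
pose W y := circ (u ^~ y); pose W1 y := circ (u2 ^~ y); pose W2 y := circ (u22 ^~ y).
have dW y : is_derive y 1 W (W1 y) by exact: der_circ_param.
have dW1 y : is_derive y 1 W1 (W2 y) by exact: der_circ_param.
have Fp y : F pi y = F (- pi) y.
  have e : pi = - pi + 2 * pi :> R by ring.
  rewrite /F /q /E1 [in LHS]e gp.
  have -> : cos (- pi + 2 * pi - c) = cos (- pi - c).
    by rewrite -[in RHS]cosD2; congr cos; ring.
  by have -> : g1 (- pi + 2 * pi) y = g1 (- pi) y by exact: (der_periodic (dg1 ^~ y)).
have cF1y y : circ (F1 ^~ y) = 0.
  have -> : circ (F1 ^~ y) = F pi y - F (- pi) y.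
    by apply: (@circ_primitive _ (F ^~ y)); exact: cont2_l.
  by rewrite Fp subrr.
have WD y : B * (W2 y - 2 * s * (y - m) * W1 y) = circ (D ^~ y).
  have c1 := cont2_l (om := y) cu2; have c2 := cont2_l (om := y) cu22; have c3 := cont2_l (om :=
      y) cF1.
  have c4 := cont2_l (om := y) cD.
  (* The theta part of the operator is the exact derivative [F1], whose integral over a period is 0,
     so it may be subtracted freely; what is left is the pointwise identity given by the
     equation. *)
  have -> : circ (D ^~ y) = circ (D ^~ y) + - A * circ (F1 ^~ y) by rewrite cF1y mulr0 addr0.
  have -> : - A * circ (F1 ^~ y) = circ (fun th => - A * F1 th y) by rewrite circZl.
  rewrite -circD//; last by cont.
  rewrite /W1 -circZl// -[X in _ - X]mul1r -mulNr -circZl; last by cont.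
  rewrite /W2 -circD//; last by cont.
  rewrite -circZl; last by cont.
  apply: eq_circ => th.
  have H : B * g22 th y = - (A * (g11 th y - kappa * sin (th - c) * g1 th y)) + B * (2 * s * (y
      - m) * g2 th y).
    by have := pde th y; lra.
  rewrite /u22 /u2 /D /F1; move: ((q th y) ^- 2) ((q th y) ^- 3) => Q2 Q3.
  transitivity (E1 th * (- (B * g22 th y - B * (2 * s * (y - m) * g2 th y)) * Q2 + 2 * B * g2 th
      y ^+ 2 * Q3)).
    by ring.
  by rewrite H; ring.
have D0 th y : 0 <= D th y.
  rewrite /D mulr_ge0// ?invr_ge0 ?exprn_ge0 ?(ltW (q0 _ _))// mulr_ge0//.
    by rewrite mulr_ge0// expR_ge0.
  by rewrite addr_ge0// mulr_ge0 ?sqr_ge0// ltW.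
(* E2' = - 2 s (y - m) E2, so [E2] absorbs the drift and the flux E2 W1 has a derivative of constant
   sign. *)
have dV y : is_derive y 1 (fun y => E2 y * W1 y) (E2 y * (B^-1 * circ (D ^~ y))).
  have d := dW1 y; rewrite /E2; der.
  by rewrite -WD; field; rewrite gt_eqF.
have V0 : forall y, E2 y * W1 y = 0.
  apply: (bounded_flux_eq0 (E := E2) (M := circ E1) dW dV) => // y.
  - by rewrite !mulr_ge0 ?expR_ge0 ?invr_ge0 ?(ltW B0)//; exact: Rintegral_ge0.
  - by rewrite expR_gt0 -[X in _ <= X]expR0 ler_expR mulNr oppr_le0 mulr_ge0// sqr_ge0.
  - have ubd th : 0 <= u th y <= E1 th.
      rewrite /u mulr_ge0 ?expR_ge0 ?invr_ge0 ?(ltW (q0 _ _))//=.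
      by rewrite ler_piMr ?expR_ge0// invf_le1// lerDl.
    apply/andP; split; first by apply: Rintegral_ge0 => th _; case/andP: (ubd th).
    apply: le_Rintegral => //.
    + by apply: segment_integrable; exact: cont2_l.
    + by apply: segment_integrable; rewrite /E1; cont.
    + by move=> th _; case/andP: (ubd th).
have cD0 y : circ (D ^~ y) = 0.
  have : is_derive y 1 (fun y => E2 y * W1 y) 0.
    have -> : (fun y => E2 y * W1 y) = cst 0 by apply/funext.
    exact: der_cst.
  move/der_derive1; rewrite (der_derive1 (dV y)) => /eqP.
  by rewrite !mulf_eq0 invr_eq0 (gt_eqF B0) (gt_eqF (expR_gt0 _))/= => /eqP.
have Dp th y : D (th + 2 * pi) y = D th y.
  rewrite /D /q gp (der_periodic (dg1 ^~ y) (gp ^~ y)).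
  have -> : g2 (th + 2 * pi) y = g2 th y.
    rewrite -(der_derive1 (dg2 th y)) -(der_derive1 (dg2 (th + 2 * pi) y)).
    by congr (derive1 _ y); apply/funext => z; rewrite gp.
  rewrite /E1; have -> : th + 2 * pi - c = th - c + 2 * pi by ring.
  by rewrite cosD2.
(* A vanishing integral controls the integrand only inside ]-pi, pi[; shifting the period brings an
   arbitrary [th] to the interior point 0. *)
have Dz th y : D th y = 0.
  have cDy : continuous (D ^~ y) by exact: cont2_l.
  have := circ_shift (- th) cDy (Dp ^~ y); rewrite cD0 => I0.
  have := int_segment_ge0_eq0 (continuous_shift (c := - th) cDy) (fun x => D0 _ _) I0 (x := 0).
  by rewrite oppr_lt0 pi_gt0 => /(_ isT); rewrite opprK add0r.
have gz th y : g1 th y = 0 /\ g2 th y = 0.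
  have /eqP := Dz th y; rewrite !mulf_eq0 invr_eq0 expf_eq0/= (negbTE (qn0 _ _)) orbF.
  rewrite pnatr_eq0/= (gt_eqF (expR_gt0 _))/= paddr_eq0; last 2 first.
  - by rewrite mulr_ge0 ?sqr_ge0// ltW.
  - by rewrite mulr_ge0 ?sqr_ge0// ltW.
  case/andP; rewrite mulf_eq0 (gt_eqF A0)/= sqrf_eq0 => /eqP->.
  by rewrite mulf_eq0 (gt_eqF B0)/= sqrf_eq0 => /eqP->.
move=> th om; transitivity (g 0 om).
  apply: (@derivative0_cst _ (g ^~ om)) => z.
  by rewrite -(gz z om).1.
apply: (@derivative0_cst _ (g 0)) => z.
by have := dg2 0 z; rewrite (gz 0 z).2.
Qed.

(** Here [c] and [m] are fixed parameters, so the equation is linear in [f]. Passing to the quotient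
    by the equilibrium removes its zeroth-order terms, which is the form needed by [liouville]. *)
Lemma equilibrium_unique (kt kw A B c m : R) (f f1 f2 f11 f22 : R -> R -> R) :
  0 < kw -> 0 < A -> 0 < B ->
  (forall th om, 0 <= f th om) ->
  (forall th om, f (th + 2 * pi) om = f th om) ->
  (forall th om, is_derive th 1 (f ^~ om) (f1 th om)) ->
  (forall th om, is_derive th 1 (f1 ^~ om) (f11 th om)) ->
  (forall th om, is_derive om 1 (f th) (f2 th om)) ->
  (forall th om, is_derive om 1 (f2 th) (f22 th om)) ->
  cont2 f -> cont2 f1 -> cont2 f2 -> cont2 f11 -> cont2 f22 ->
  (forall th om,
     - kt * (f1 th om * sin (c - th) - f th om * cos (c - th))
     - kw * (f2 th om * (m - om) - f th om) + A * f11 th om + B * f22 th om = 0) ->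
  exists C, forall th om, f th om =
    C * expR (kt / A * cos (th - c)) * expR (- (kw / (2 * B)) * (om - m) ^+ 2).
Proof.
move=> kw0 A0 B0 f0 fp d1 d11 d2 d22 cf cf1 cf2 cf11 cf22 pde.
pose k := kt / A; pose s := kw / (2 * B).
have s0 : 0 <= s by rewrite divr_ge0 ?mulr_ge0 ?ltW.
(* [e] is the reciprocal of the equilibrium up to a constant; [g1], [g2], [g11], [g22] are the
   derivatives of g = f e. *)
pose e th om := expR (- k * cos (th - c)) * expR (s * (om - m) ^+ 2).
pose g th om := f th om * e th om.
pose g1 th om := (f1 th om + k * sin (th - c) * f th om) * e th om.
pose g2 th om := (f2 th om + 2 * s * (om - m) * f th om) * e th om.
pose g11 th om := (f11 th om + k * cos (th - c) * f th om + 2 * k * sin (th - c) * f1 th om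
  + (k * sin (th - c)) ^+ 2 * f th om) * e th om.
pose g22 th om := (f22 th om + 2 * s * f th om + 4 * s * (om - m) * f2 th om
  + (2 * s * (om - m)) ^+ 2 * f th om) * e th om.
have ce : continuous (fun p : R * R => e p.1 p.2) by rewrite /e; cont.
have e_neq0 th om : e th om != 0 by rewrite mulf_neq0// gt_eqF// expR_gt0.
have H : forall th om, g th om = g 0 0.
  apply: (@liouville k c s m A B g g1 g2 g11 g22 s0 A0 B0).
  - by move=> th om; rewrite mulr_ge0// mulr_ge0// expR_ge0.
  - move=> th om; rewrite /g /e fp.
    have -> : th + 2 * pi - c = th - c + 2 * pi by ring.
    by rewrite cosD2.
  - by move=> th om; have d := d1 th om; rewrite /g /e; der; rewrite /g1 /e; ring.
  - move=> th om; have d := d1 th om; have d' := d11 th om; rewrite /g1 /e; der.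
    by rewrite /g11 /e; ring.
  - by move=> th om; have d := d2 th om; rewrite /g /e; der; rewrite /g2 /e /=; ring.
  - move=> th om; have d := d2 th om; have d' := d22 th om; rewrite /g2 /e; der.
    by rewrite /g22 /e /=; ring.
  - by rewrite /cont2 /g; cont.
  - by rewrite /cont2 /g1; cont.
  - by rewrite /cont2 /g2; cont.
  - by rewrite /cont2 /g11; cont.
  - by rewrite /cont2 /g22; cont.
  - move=> th om; rewrite -[RHS](mul0r (e th om)) -(pde th om).
    have -> : c - th = - (th - c) by ring.
    rewrite sinN cosN /g11 /g1 /g22 /g2.
    have -> : kt = k * A by rewrite /k divfK// gt_eqF.
    have -> : kw = 2 * s * B by rewrite /s; field; rewrite gt_eqF.
    by ring.
exists (g 0 0) => th om; rewrite -(H th om) /g /e -/k -/s.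
have -> : expR (- k * cos (th - c)) = (expR (k * cos (th - c)))^-1 by rewrite mulNr expRN.
have -> : expR (- s * (om - m) ^+ 2) = (expR (s * (om - m) ^+ 2))^-1 by rewrite mulNr expRN.
have e1 := expR_gt0 (k * cos (th - c)); have e2 := expR_gt0 (s * (om - m) ^+ 2).
by field; rewrite !gt_eqF.
Qed.

End Equilibrium.

(** * Averages over the cell *)

Section Averages.
Context {R : realType}.
Notation mu := (@lebesgue_measure R).
Implicit Types (x y a th om : R) (h : R -> R -> R).
Let I : set R := `]- pi, pi]%classic.
Let mI : measurable (I : set (measurableTypeR R)). Proof. exact: measurable_itv. Qed.

Let in_cell x y : ((x, y) \in (@cell R)) = (x \in I).
Proof. by apply/idP/idP; rewrite !inE /cell /=; tauto. Qed.

Lemma measurable_cell : measurable (@cell R).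
Proof. by apply: measurableX => //; exact: measurable_itv. Qed.

(** Extension by zero from the cell to the whole plane, where Fubini's theorem is applied. *)
Let hr h (p : measurableTypeR R * measurableTypeR R) : \bar R :=
  ((fun p => (h p.1 p.2)%:E) \_ (@cell R)) p.

Let hr_in h x y : x \in I -> hr h (x, y) = (h x y)%:E.
Proof. by move=> xI; rewrite /hr patchE in_cell xI. Qed.

Let hr_out h x y : x \notin I -> hr h (x, y) = 0%E.
Proof. by move=> xI; rewrite /hr patchE in_cell (negbTE xI). Qed.

Let hr_integrable h : avg_integrable h ->
  (lebesgue_measure \x lebesgue_measure)%E.-integrable setT (hr h).
Proof. by move=> hi; apply/(integrable_mkcond _ measurable_cell).1. Qed.

Let avgE h : avg h = fine (\int[(lebesgue_measure \x lebesgue_measure)%E]_p hr h p).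
Proof. by rewrite /avg /Rintegral integral_mkcond. Qed.

Lemma avg_theta0 h : avg_integrable h ->
  (forall om, \int[mu]_(th in `]- pi, pi]) h th om = 0) ->
  (forall om, mu.-integrable `]- pi, pi] (EFin \o (h ^~ om))) -> avg h = 0.
Proof.
move=> hi h0 hI; rewrite avgE -integral21_prod_meas1; last exact: hr_integrable.
rewrite [X in fine X](_ : _ = 0%E)//.
apply: integral0_eq => y _.
transitivity (\int[mu]_(x in I) (h x y)%:E)%E.
  rewrite [RHS]integral_mkcond; apply: eq_integral => x _; rewrite patchE.
  by case: ifPn => xI; [rewrite hr_in|rewrite hr_out].
rewrite -[LHS]fineK; first by congr EFin; exact: h0.
by apply: integrable_fin_num; [exact: mI|exact: hI].
Qed.

(** Lines in omega are unbounded, and Fubini's theorem gives integrability only on almost every one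
    of them; the vanishing is therefore asked only where the slice is integrable. *)
Lemma avg_omega0 h : avg_integrable h ->
  (forall th, mu.-integrable setT (EFin \o (h th)) -> \int[mu]_om h th om = 0) ->
  avg h = 0.
Proof.
move=> hi h0; rewrite avgE -integral12_prod_meas1; last exact: hr_integrable.
rewrite [X in fine X](_ : _ = 0%E)//.
rewrite -(integral0 mu setT); apply: ae_eq_integral => //.
- exact: measurable_fubini_F (hr_integrable hi).
- apply: filterS (ae_integrable1 (hr_integrable hi)) => x ix _.
  rewrite /fubini_F; case: (boolP (x \in I)) => xI; last first.
    by apply: integral0_eq => y _; rewrite hr_out.
  have ixh : mu.-integrable setT (EFin \o (h x)).
    by apply: eq_integrable ix => // y _; rewrite hr_in.
  under eq_integral do rewrite hr_in//.
  rewrite -[LHS]fineK; first by congr EFin; exact: h0.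
  exact: integrable_fin_num.
Qed.

(** Tonelli's theorem on absolute values gives the integrability, Fubini's theorem then the product
    formula. Every average of the equilibrium reduces to this. *)
Lemma avg_prod (a b : R -> R) : continuous a -> mu.-integrable setT (EFin \o b) ->
  avg_integrable (fun th om => a th * b om) /\
  avg (fun th om => a th * b om) = circ a * \int[mu]_om b om.
Proof.
move=> ca ib; pose h th om := a th * b om.
have iaI : mu.-integrable I (EFin \o a).
  apply: integrableS (segment_integrable (- pi) pi ca) => //.
  by apply: subset_itv; rewrite bnd_simp.
have hrE x y : hr h (x, y) = ((EFin \o a) \_ I x * (b y)%:E)%E.
  by rewrite /hr !patchE in_cell; case: ifPn => _ //=; rewrite mul0e.
have mb : measurable_fun setT b by apply/measurable_EFinP; exact: measurable_int ib.
have ma : measurable_fun setT ((EFin \o a) \_ I).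
  apply/(measurable_restrictT _ _).1; first exact: mI.
  exact: measurable_int iaI.
have mh : measurable_fun setT (hr h).
  have -> : hr h = (fun p => ((EFin \o a) \_ I p.1 * (EFin \o b) p.2)%E).
    by apply/funext => -[x y]; rewrite hrE.
  apply: emeasurable_funM.
    exact: (measurableT_comp ma measurable_fst).
  by apply: (measurableT_comp _ measurable_snd); exact/measurable_EFinP.
have Ifin : (\int[mu]_x (EFin \o a) \_ I x = (circ a)%:E)%E.
  rewrite -integral_mkcond -[LHS]fineK; last exact: integrable_fin_num.
  by congr EFin; apply: Rintegral_itv_obnd_cbnd.
have hint : (lebesgue_measure \x lebesgue_measure)%E.-integrable setT (hr h).
  apply/integrable12ltyP => //.
  have -> : (\int[mu]_x \int[mu]_y `|hr h (x, y)| =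
     \int[mu]_x (`|(EFin \o a) \_ I x| * \int[mu]_y `|(b y)%:E|))%E.
    apply: eq_integral => x _; rewrite -ge0_integralZl//.
    - by apply: eq_integral => y _; rewrite hrE abseM.
    - by apply: measurableT_comp => //; exact/measurable_EFinP.
  have /integrableP[_ bfin] := ib.
  have bE : (\int[mu]_y `|(b y)%:E| \is a fin_num)%E.
    by rewrite ge0_fin_numE// integral_ge0.
  rewrite -(fineK bE) ge0_integralZr//.
  - have /integrableP[_ afin] := (integrable_mkcond (mu := mu) (EFin \o a) mI).1 iaI.
    by apply: lte_mul_pinfty => //; [exact: integral_ge0| rewrite ge0_fin_numE//
        integral_ge0|rewrite ltry].
  - exact: measurableT_comp.
  - by rewrite fineK// integral_ge0.
split; first by apply/(integrable_mkcond _ measurable_cell).2.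
rewrite avgE -integral12_prod_meas1// /fubini_F.
rewrite [X in fine X](_ : _ = \int[mu]_x ((EFin \o a) \_ I x * (\int[mu]_om b om)%:E))%E.
  rewrite integralZr//; first by rewrite Ifin.
  by apply/(integrable_mkcond _ mI).1.
apply: eq_integral => x _.
under eq_integral do rewrite hrE.
have -> : (\int[mu]_om b om)%:E = (\int[mu]_y (b y)%:E)%E.
  by rewrite /Rintegral fineK//; exact: integrable_fin_num.
rewrite patchE; case: ifPn => _ /=; first by rewrite integralZl.
by rewrite integral0_eq ?mul0e// => y _; rewrite mul0e.
Qed.

End Averages.

(** * Averages of exact derivatives, multipliers, angles *)

Section Moments.
Context {R : realType}.
Notation mu := (@lebesgue_measure R).
Implicit Types (x y th om : R) (h : R -> R -> R).

Lemma avg_der_theta h H : avg_integrable h -> (forall om, continuous (h ^~ om)) ->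
  (forall th om, is_derive th 1 (H ^~ om) (h th om)) ->
  (forall om, H pi om = H (- pi) om) -> avg h = 0.
Proof.
move=> hi ch dH Hp.
have iI om : mu.-integrable `]- pi, pi] (EFin \o (h ^~ om)).
  apply: integrableS (segment_integrable (- pi) pi (ch om)) => //.
  by apply: subset_itv; rewrite bnd_simp.
apply: avg_theta0 => // om; rewrite Rintegral_itv_obnd_cbnd//.
transitivity (H pi om - H (- pi) om); last by rewrite Hp subrr.
exact: (@circ_primitive _ (H ^~ om)).
Qed.

(** The integrals over [-n, n] are boundary differences tending to 0, and they tend to the full
    integral by dominated convergence with |h| as majorant. *)
Lemma Rintegral_der_line (h H : R -> R) : continuous h ->
  mu.-integrable setT (EFin \o h) -> (forall x, is_derive x 1 H (h x)) ->
  H x @[x --> +oo] --> 0 -> H x @[x --> -oo] --> 0 -> \int[mu]_x h x = 0.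
Proof.
move=> ch ih dH Hy HNy.
have mh : measurable_fun setT (EFin \o h) by exact: measurable_int ih.
pose J (n : nat) : set R := `[- n%:R, n%:R]%classic.
have mJ n : measurable (J n : set (measurableTypeR R)) by exact: measurable_itv.
have [|||||_ _ cvgI] := @dominated_convergence _ _ R mu setT measurableT
  (fun n => (EFin \o h) \_ (J n)) (EFin \o h) (abse \o (EFin \o h)).
- move=> n; apply/(measurable_restrictT _ _).1; first exact: mJ.
  exact: measurable_funS mh.
- exact: mh.
- apply: aeW => x _; apply: cvg_near_cst; near=> n; rewrite patchE ifT// inE /J /= in_itv /=.
  rewrite -ler_norml; near: n; exact: nbhs_infty_ger.
- exact: integrable_abse.
- apply: aeW => x n _; rewrite patchE; case: ifPn => //= _.
  by rewrite normr0 lee_fin.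
have JE n : (\int[mu]_x ((EFin \o h) \_ (J n)) x = (H n%:R - H (- n%:R))%:E)%E.
  rewrite -integral_mkcond -[LHS]fineK.
    by congr EFin; apply: FTC_segment => //; rewrite ge0_cp.
  by apply: integrable_fin_num => //; exact: segment_integrable.
have cH : (H n%:R - H (- n%:R)) @[n --> \oo] --> (0 - 0 : R).
  apply: cvgB.
    by apply: (cvg_comp (fun n : nat => n%:R : R) H _ Hy); exact: cvgr_idn.
  apply: (cvg_comp (fun n : nat => - n%:R : R) H _ HNy).
  by apply/cvgNrNy; exact: cvgr_idn.
have : (fun n => \int[mu]_x ((EFin \o h) \_ (J n)) x)%E @ \oo --> (0 - 0)%:E.
  under eq_fun do rewrite JE.
  by apply: cvg_EFin; [apply: nearW|exact: cH].
rewrite subrr => c0.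
have := cvg_unique _ cvgI c0 => /(_ (@ereal_hausdorff R)).
by rewrite /Rintegral => ->.
Unshelve. all: by end_near. Qed.

Lemma avg_der_omega h H : avg_integrable h -> (forall th, continuous (h th)) ->
  (forall th om, is_derive om 1 (H th) (h th om)) ->
  (forall th, H th om @[om --> +oo] --> 0 /\ H th om @[om --> -oo] --> 0) ->
  avg h = 0.
Proof.
move=> hi ch dH H0; apply: avg_omega0 => // th ih.
by apply: (@Rintegral_der_line _ (H th)) => //; [exact: (H0 th).1|exact: (H0 th).2].
Qed.

Lemma avg_integrableD h1 h2 : avg_integrable h1 -> avg_integrable h2 ->
  avg_integrable (fun th om => h1 th om + h2 th om).
Proof.
move=> i1 i2; have := integrableD (measurable_cell (R := R)) i1 i2.
by apply: eq_integrable => //; exact: measurable_cell.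
Qed.

Lemma avg_integrableZ k h : avg_integrable h ->
  avg_integrable (fun th om => k * h th om).
Proof.
move=> i1; have := integrableZl (measurable_cell (R := R)) k i1.
by apply: eq_integrable => //; exact: measurable_cell.
Qed.

Lemma avgD h1 h2 : avg_integrable h1 -> avg_integrable h2 ->
  avg (fun th om => h1 th om + h2 th om) = avg h1 + avg h2.
Proof. by move=> i1 i2; rewrite /avg RintegralD//; exact: measurable_cell. Qed.

Lemma avgZ k h : avg_integrable h -> avg (fun th om => k * h th om) = k * avg h.
Proof. by move=> i1; rewrite /avg RintegralZl//; exact: measurable_cell. Qed.

Lemma eq_avg h1 h2 : (forall th om, h1 th om = h2 th om) -> avg h1 = avg h2.
Proof. by move=> e; apply: eq_Rintegral => p _; rewrite e. Qed.

Lemma continuous_multiplier (a : R -> R) : continuous a -> multiplier a.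
Proof.
move=> ca; split.
  by apply: measurable_funS (measurableT) _ (continuous_measurable_fun ca).
have cK : compact (`[- pi, pi]%classic : set R) by exact: segment_compact.
have cn : continuous (fun x => `|a x|) by move=> x; apply: cvg_norm; exact: ca.
have [|c _ Hc] := @compact_EVT_max R R _ _ _ cK (continuous_subspaceT cn).
  by exists 0 => /=; rewrite in_itv /= oppr_le0 pi_ge0.
exists `|a c|; split => // M cM x /=; rewrite in_itv /= => /andP[x1 x2].
by apply: (le_trans (Hc x _) (ltW cM)); rewrite inE /= in_itv /= x2 ltW.
Qed.

Lemma multiplier_familyI (a : R -> R -> R) (a0 : R -> R) :
  (forall eps, continuous (a eps)) -> continuous a0 ->
  (forall e, 0 < e -> \forall eps \near 0^'+,
     forall x, - pi < x <= pi -> `|a0 x - a eps x| < e) ->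
  multiplier_family a a0.
Proof.
move=> ca ca0 H; split.
- by move=> eps _; exact: continuous_multiplier.
- exact: continuous_multiplier.
- move=> P /uniform_nbhs[E [[e /= e0 eE] EP]].
  have := H _ e0; apply: filterS => eps Heps.
  by apply: EP => x /=; rewrite in_itv /= => /Heps xe; apply: eE.
Qed.

Lemma multiplier_family_cst (a : R -> R) : continuous a -> multiplier_family (fun=> a) a.
Proof.
move=> ca; apply: multiplier_familyI => // e e0; near=> eps => x _.
by rewrite subrr normr0.
Unshelve. all: by end_near. Qed.

Lemma circle_angle (v w : R) : v ^+ 2 + w ^+ 2 = 1 ->
  exists2 a : R, - pi < a <= pi & cos a = v /\ sin a = w.
Proof.
move=> vw.
have v1 : -1 <= v <= 1.
  by rewrite -ler_norml -(@expr_le1 _ 2)// real_normK ?num_real// -vw lerDl sqr_ge0.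
have cv : cos (acos v) = v by rewrite acosK// in_itv.
have a0 := acos_ge0 v1; have api := acos_lepi v1.
have sv : sin (acos v) = `|w|.
  by rewrite sin_acos// -sqrtr_sqr -vw addrAC subrr add0r.
have p0 := pi_gt0 R.
have [w0|w0] := leP 0 w.
  exists (acos v); first by rewrite api andbT; lra.
  by rewrite sv ger0_norm.
exists (- acos v); last by rewrite cosN sinN cv sv ltr0_norm// opprK.
rewrite lerNl (le_trans _ a0) ?oppr_le0 ?ltW// ltrN2 lt_neqAle api !andbT.
(* The angle - acos v must avoid -pi: acos v = pi would make the sine, hence [w], equal to 0. *)
apply/eqP => e; have := sv; rewrite e sinpi => /esym/eqP.
by rewrite normr_eq0 lt_eqF.
Qed.

End Moments.

(** * Derivatives along a filter of increments *)

Section Slopes.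
Context {R : realType} (F : set_system R).
Hypothesis FF : ProperFilter F.
#[local] Existing Instance FF.
(** Every punctured neighbourhood of 0 belongs to [F]: increments tend to 0 and are eventually
    nonzero. *)
Hypothesis F0 : 0^' `<=` F.

(* derive_t and 'D_v are both slopes at 0 along a filter of nonzero increments. *)
Definition slope {V : normedModType R} (g : R -> V) (l : V) : Prop :=
  h^-1 *: (g h - g 0) @[h --> F] --> l.

Lemma slope_unique (V : normedModType R) (g : R -> V) l1 l2 :
  slope g l1 -> slope g l2 -> l1 = l2.
Proof. by move=> s1 s2; apply: (cvg_unique _ s1 s2); exact: norm_hausdorff. Qed.

Lemma near_neq0 : F [set h : R | h != 0].
Proof. by apply: F0; exists 1 => //=. Qed.

Lemma cvg_id0 : h @[h --> F] --> (0 : R).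
Proof. by move=> P P0; apply: F0; exact: (@cvg_within _ (nbhs (0 : R))). Qed.

Lemma slope_eq (V : normedModType R) (g k : R -> V) l :
  (\forall h \near F, g h = k h) -> g 0 = k 0 -> slope g l -> slope k l.
Proof.
move=> gk gk0; apply: cvg_trans; apply: near_eq_cvg.
by apply: filterS gk => h; rewrite gk0 => ->.
Qed.

Lemma slope_cst (V : normedModType R) (c : V) : slope (fun=> c) 0.
Proof. by rewrite /slope; under eq_fun do rewrite subrr scaler0; exact: cvg_cst. Qed.

Lemma slopeD (V : normedModType R) (g k : R -> V) a b :
  slope g a -> slope k b -> slope (fun h => g h + k h) (a + b).
Proof.
move=> ga kb; rewrite /slope.
have -> : (fun h => h^-1 *: (g h + k h - (g 0 + k 0))) =
    (fun h => h^-1 *: (g h - g 0) + h^-1 *: (k h - k 0)).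
  by apply/funext => h; rewrite -scalerDr opprD addrACA.
exact: cvgD.
Qed.

Lemma slopeZv (V : normedModType R) (g : R -> R) a (e : V) :
  slope g a -> slope (fun h => g h *: e) (a *: e).
Proof.
move=> ga; rewrite /slope.
have -> : (fun h => h^-1 *: (g h *: e - g 0 *: e)) =
    (fun h => (h^-1 *: (g h - g 0)) *: e).
  by apply/funext => h; rewrite -scalerBl scalerA.
by apply: cvgZr_tmp.
Qed.

Implicit Types (g k : R -> R).

Lemma slope_cvg g a : slope g a -> g h @[h --> F] --> g 0.
Proof.
move=> ga.
have : h * (h^-1 *: (g h - g 0)) + g 0 @[h --> F] --> 0 * a + g 0.
  by apply: cvgD; [apply: cvgM => //; exact: cvg_id0|exact: cvg_cst].
rewrite mul0r add0r; apply: cvg_trans; apply: near_eq_cvg.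
near=> h; rewrite /GRing.scale /= mulrA divff ?mul1r ?subrK//.
by near: h; exact: near_neq0.
Unshelve. all: by end_near. Qed.

Lemma slopeM g k a b : slope g a -> slope k b ->
  slope (fun h => g h * k h) (a * k 0 + g 0 * b).
Proof.
move=> ga kb; rewrite /slope.
have -> : (fun h => h^-1 *: (g h * k h - g 0 * k 0)) =
    (fun h => (h^-1 *: (g h - g 0)) * k h + g 0 * (h^-1 *: (k h - k 0))).
  by apply/funext => h; rewrite /GRing.scale /=; ring.
by apply: cvgD; apply: cvgM => //; [exact: slope_cvg kb|exact: cvg_cst].
Qed.

(** Caratheodory's factorisation of [phi] avoids dividing by [g h - g 0], which may vanish for
    nonzero h. *)
Lemma slope_comp (phi : R -> R) g a l : is_derive (g 0) 1 phi a -> slope g l ->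
  slope (fun h => phi (g h)) (a * l).
Proof.
move=> /is_derive1_caratheodory[psi [pE cpsi <-]] gl; rewrite /slope.
have -> : (fun h => h^-1 *: (phi (g h) - phi (g 0))) =
    (fun h => psi (g h) * (h^-1 *: (g h - g 0))).
  by apply/funext => h; rewrite pE /GRing.scale /=; ring.
apply: cvgM => //.
by apply: (cvg_comp g psi _ cpsi); exact: slope_cvg gl.
Qed.

Lemma slopeV g a : g 0 != 0 -> slope g a ->
  slope (fun h => (g h)^-1) (- (g 0) ^- 2 * a).
Proof.
move=> g0 ga; apply: slope_comp ga.
by apply: der_eq (derV g0 (der_id _)) _; rewrite mulN1r.
Qed.

End Slopes.

Section Directions.
Context {R : realType}.
Implicit Types (t : R) (x : 'rV[R]_2).

Definition time_filter t := within [set h : R | 0 <= t + h] 0^'.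

Lemma time_filter_proper t : 0 <= t -> ProperFilter (time_filter t).
Proof.
move=> t0; apply: Build_ProperFilter_ex => P [e /= e0 eP].
(* A positive increment stays in the half-line even at t = 0, so the one-sided filter is proper. *)
have e2 : 0 < e / 2 by rewrite divr_gt0.
exists (e / 2); apply: eP => /=.
- by rewrite sub0r normrN gtr0_norm// ltr_pdivrMr// ltr_pMr// ltr1n.
- by rewrite gt_eqF.
- by rewrite addr_ge0// ltW.
Qed.

Lemma time_filter_dnbhs t : 0^' `<=` time_filter t.
Proof. by move=> P; apply: filterS. Qed.

Lemma derivable_tP (V : normedModType R) (g : R -> V) t l : 0 <= t ->
  slope (time_filter t) (fun h => g (t + h)) l -> derivable_t g t /\ derive_t g t = l.
Proof.
move=> t0; rewrite /slope addr0 => gl; have tP := time_filter_proper t0.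
by split; [apply/cvg_ex; exists l | apply: cvg_lim => //; exact: norm_hausdorff].
Qed.

Lemma derive_t_slope (V : normedModType R) (g : R -> V) t : derivable_t g t ->
  slope (time_filter t) (fun h => g (t + h)) (derive_t g t).
Proof. by move=> dg; rewrite /slope addr0; exact: dg. Qed.

Lemma derivable_dirP (V : normedModType R) (g : 'rV[R]_2 -> V) x v l :
  slope 0^' (fun h => g (h *: v + x)) l -> derivable g x v /\ 'D_v g x = l.
Proof.
rewrite /slope scale0r add0r => gl.
by split; [apply/cvg_ex; exists l | apply: cvg_lim => //; exact: norm_hausdorff].
Qed.

Lemma derive_dir_slope (V : normedModType R) (g : 'rV[R]_2 -> V) x v :
  derivable g x v -> slope 0^' (fun h => g (h *: v + x)) ('D_v g x).
Proof. by move=> dg; rewrite /slope scale0r add0r; exact: dg. Qed.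

End Directions.

(** * Moments of the collision operator *)

Section CollisionMoments.
Context {R : realType}.
Notation mu := (@lebesgue_measure R).
Implicit Types (th om : R).

Lemma cvg_pair_fun (I U V : topologicalType) (F : set_system I) (FF : Filter F)
    (u : I -> U) (v : I -> V) (a : U) (b : V) :
  u @ F --> a -> v @ F --> b -> (u i, v i) @[i --> F] --> (a, b).
Proof. by move=> ua vb; apply: (cvg_pair ua vb). Qed.

Lemma eq_continuous_fun (g h : R -> R) : h =1 g -> continuous g -> continuous h.
Proof. by move=> /funext ->. Qed.

Lemma ord2P (j : 'I_2) : j = 0 \/ j = 1.
Proof. by case: j => [[|[|//]] ?]; [left|right]; exact: val_inj. Qed.

(** Joint continuity on the half-space restricts to the slice of fixed (t, x), and derivatives up to
    order two suffice. *)
Lemma smooth_classical (f : state R) : smooth f -> classical_state f.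
Proof.
move=> fs.
have joint s t x : 0 <= t -> continuous (fun p : R * R => foldr pd f s t x p.1 p.2).
  move=> t0 p; have [/(@subspace_continuousP _ _ _ _) cs _] := fs s.
  have ci : (t, x, q.1, q.2) @[q --> p] --> (t, x, p.1, p.2).
    by apply: cvg_pair_fun; [apply: cvg_pair_fun; [exact: cvg_cst|exact: cvg_fst]|exact: cvg_snd].
  apply: (cvg_comp (fun q : R * R => (t, x, q.1, q.2)) _ _ (cs (t, x, p.1, p.2) t0)).
  move=> P HP; have := ci [set q | 0 <= q.1.1.1 -> P q] HP.
  by apply: (@filterS _ (nbhs p)) => q H; exact: (H t0).
split=> [t x th om t0|t x t0 /=]; split.
- by move=> v; exact: (fs [::]).2.
- exact: (fs [:: Vtheta]).2.
- exact: (fs [:: Vomega]).2.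
- exact: (joint [::]).
- exact: (joint [:: Vtheta]).
- exact: (joint [:: Vomega]).
- exact: (joint [:: Vtheta; Vtheta]).
- exact: (joint [:: Vomega; Vomega]).
Qed.

Lemma enormE (J : 'rV[R]_2) : enorm J = Num.sqrt (J 0 0 ^+ 2 + J 0 1 ^+ 2).
Proof.
rewrite /enorm big_ord_recl big_ord1; congr (Num.sqrt (_ + J 0 _ ^+ 2)).
exact: val_inj.
Qed.

Variables (f : state R) (t : R) (x : 'rV[R]_2).
Hypotheses (t_ge0 : 0 <= t) (f_classical : classical_state f) (f_periodic : periodic_theta f).
Let phi := f t x.
Let phi1 := pd Vtheta f t x.
Let phi11 := pd Vtheta (pd Vtheta f) t x.
Let phi2 := pd Vomega f t x.
Let phi22 := pd Vomega (pd Vomega f) t x.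

Lemma state_der_th th om : is_derive th 1 (phi ^~ om) (phi1 th om).
Proof.
have [H _ _] := f_classical.1 t x th om t_ge0.
have d : derivable (fun s => f t x s om) th 1 := H Vtheta.
exact: (derivable_der d).
Qed.

Lemma state_der_thth th om : is_derive th 1 (phi1 ^~ om) (phi11 th om).
Proof.
have [_ H _] := f_classical.1 t x th om t_ge0.
have d : derivable (fun s => pd Vtheta f t x s om) th 1 := H.
exact: (derivable_der d).
Qed.

Lemma state_der_om th om : is_derive om 1 (phi th) (phi2 th om).
Proof.
have [H _ _] := f_classical.1 t x th om t_ge0.
have d : derivable (fun s => f t x th s) om 1 := H Vomega.
exact: (derivable_der d).
Qed.

Lemma state_der_omom th om : is_derive om 1 (phi2 th) (phi22 th om).
Proof.
have [_ _ H] := f_classical.1 t x th om t_ge0.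
have d : derivable (fun s => pd Vomega f t x th s) om 1 := H.
exact: (derivable_der d).
Qed.

Lemma state_cont : [/\ cont2 phi, cont2 phi1, cont2 phi2, cont2 phi11 & cont2 phi22].
Proof. exact: f_classical.2. Qed.

Let c := thetabar f t x.
Let m := omegabar f t x.

Lemma pd_fF th om : pd Vtheta (fF f) t x th om =
  phi1 th om * sin (c - th) - phi th om * cos (c - th).
Proof.
apply: der_derive1; have d := state_der_th th om.
by rewrite /fF -/phi -/c; der; ring.
Qed.

Lemma pd_fG th om : pd Vomega (fG f) t x th om =
  phi2 th om * (m - om) - phi th om.
Proof.
apply: der_derive1; have d := state_der_om th om.
by rewrite /fG -/phi -/m; der; ring.
Qed.

Lemma pd_omf th om : pd Vtheta (omf f) t x th om = om * phi1 th om.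
Proof.
apply: der_derive1; have d := state_der_th th om.
by rewrite /omf -/phi; der; ring.
Qed.

Let phi_per om : phi pi om = phi (- pi) om.
Proof.
rewrite /phi -(f_periodic _ (- pi) _ t_ge0); congr (f t x _ om); ring.
Qed.

Let phi1_per om : phi1 pi om = phi1 (- pi) om.
Proof.
have e : pi = - pi + 2 * pi :> R by ring.
rewrite [in LHS]e.
apply: (@der_periodic _ (phi ^~ om)) => th; first exact: state_der_th.
exact: f_periodic.
Qed.

Hypothesis f_int : integrable_terms f.

Let c1m : continuous (fun _ : R => 1 : R). Proof. exact: cst_continuous. Qed.
Let int_term k b a (ca : continuous a) : avg_integrable (weighted b a (term k f t x)) :=
  @f_int k t x b a t_ge0 (continuous_multiplier ca).

Let sin_cpi : sin (c - pi) = sin (c - - pi).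
Proof. by rewrite -sinD2; congr sin; ring. Qed.

Lemma avg_th_omf b : avg (weighted b (fun=> 1) (term Tpd_th_omf f t x)) = 0.
Proof.
have [cp cp1 _ _ _] := state_cont.
apply: (avg_der_theta (int_term Tpd_th_omf b c1m) (H := fun th om => om ^+ b * om * phi th om)).
- move=> om; have := cont2_l (om := om) cp1 => cc.
  apply: (@eq_continuous_fun (fun th => om ^+ b * 1 * (om * phi1 th om))) => [th|].
    by rewrite /weighted /term pd_omf.
  by cont.
- move=> th om; have d := state_der_th th om.
  by der; rewrite /weighted /term pd_omf; ring.
- by move=> om; rewrite phi_per.
Qed.

Lemma avg_th_fF b : avg (weighted b (fun=> 1) (term Tpd_th_fF f t x)) = 0.
Proof.
have [cp cp1 _ _ _] := state_cont.
apply: (avg_der_theta (int_term Tpd_th_fF b c1m) (H := fun th om => om ^+ b * (phi th om * sin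
    (c - th)))).
- move=> om; have := cont2_l (om := om) cp1 => cc; have := cont2_l (om := om) cp => cc'.
  apply: (@eq_continuous_fun (fun th => om ^+ b * 1 * (phi1 th om * sin (c - th) - phi th om *
      cos (c - th)))) => [th|].
    by rewrite /weighted /term pd_fF.
  by cont.
- move=> th om; have d := state_der_th th om.
  by der; rewrite /weighted /term pd_fF; ring.
- by move=> om; rewrite phi_per sin_cpi.
Qed.

Lemma avg_th_th b : avg (weighted b (fun=> 1) (term Tpd_th_th f t x)) = 0.
Proof.
have [_ _ _ cp11 _] := state_cont.
apply: (avg_der_theta (int_term Tpd_th_th b c1m) (H := fun th om => om ^+ b * phi1 th om)).
- by move=> om; have := cont2_l (om := om) cp11 => cc; rewrite /weighted /term -/phi11; cont.
- move=> th om; have d := state_der_thth th om.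
  by der; rewrite /weighted /term -/phi11; ring.
- by move=> om; rewrite phi1_per.
Qed.

Hypothesis f_decay : omega_decay f.

(** Each boundary term below is a combination of om^n f with n <= 2 and om^n d_om f with n <= 1,
    exactly the quantities controlled by [omega_decay]. *)
Let lim_comb th (G : R -> R) (k0 k1 k2 l0 l1 : R) :
  (forall om, G om = k0 * (om ^+ 0 * phi th om) + k1 * (om ^+ 1 * phi th om)
     + k2 * (om ^+ 2 * phi th om) + l0 * (om ^+ 0 * phi2 th om)
     + l1 * (om ^+ 1 * phi2 th om)) ->
  G om @[om --> +oo] --> 0 /\ G om @[om --> -oo] --> 0.
Proof.
move=> /funext ->; have [d1 d2] := f_decay x th t_ge0.
have -> : 0 = k0 * 0 + k1 * 0 + k2 * 0 + l0 * 0 + l1 * 0 by ring.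
by split; (apply: cvgD; [apply: cvgD; [apply: cvgD; [apply: cvgD|]|]|]);
  (apply: cvgM; [exact: cvg_cst|]);
  first [exact: (d1 0%N isT).1|exact: (d1 1%N isT).1|exact: (d1 2%N isT).1|exact: (d2 0%N
      isT).1|exact: (d2 1%N isT).1
  |exact: (d1 0%N isT).2|exact: (d1 1%N isT).2|exact: (d1 2%N isT).2|exact: (d2 0%N
      isT).2|exact: (d2 1%N isT).2].
Qed.

Lemma avg_om_fG (a : R -> R) : continuous a ->
  avg (weighted false a (term Tpd_om_fG f t x)) = 0.
Proof.
move=> ca; have [cp _ cp2 _ _] := state_cont.
apply: (avg_der_omega (int_term Tpd_om_fG false ca) (H := fun th om => a th * (phi th om * (m -
    om)))).
- move=> th; have := cont2_r (th := th) cp2 => cc; have := cont2_r (th := th) cp => cc'.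
  apply: (@eq_continuous_fun (fun om => om ^+ false * a th * (phi2 th om * (m - om) - phi th
      om))) => [om|].
    by rewrite /weighted /term pd_fG.
  by cont.
- move=> th om; have d := state_der_om th om.
  by der; rewrite /weighted /term pd_fG; ring.
- by move=> th; apply: (@lim_comb th _ (a th * m) (- a th) 0 0 0) => om; ring.
Qed.

Lemma avg_om_om (a : R -> R) : continuous a ->
  avg (weighted false a (term Tpd_om_om f t x)) = 0.
Proof.
move=> ca; have [_ _ _ _ cp22] := state_cont.
apply: (avg_der_omega (int_term Tpd_om_om false ca) (H := fun th om => a th * phi2 th om)).
- by move=> th; have := cont2_r (th := th) cp22 => cc; rewrite /weighted /term -/phi22; cont.
- move=> th om; have d := state_der_omom th om.
  by der; rewrite /weighted /term -/phi22; ring.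
- by move=> th; apply: (@lim_comb th _ 0 0 0 (a th) 0) => om; ring.
Qed.

Lemma avg_om_om1 : avg (weighted true (fun=> 1) (term Tpd_om_om f t x)) = 0.
Proof.
have [_ _ _ _ cp22] := state_cont.
apply: (avg_der_omega (int_term Tpd_om_om true c1m) (H := fun th om => om * phi2 th om - phi th
    om)).
- by move=> th; have := cont2_r (th := th) cp22 => cc; rewrite /weighted /term -/phi22; cont.
- move=> th om; have d := state_der_omom th om; have d' := state_der_om th om.
  by der; rewrite /weighted /term -/phi22; ring.
- by move=> th; apply: (@lim_comb th _ (-1) 0 0 0 1) => om; ring.
Qed.

Hypothesis f_nondeg : moments_nondegenerate f.

(** Integration by parts against omega leaves minus the average of f (m - omega), which is 0 because
    [m] is by definition the mean of omega under [f]. The auxiliary integrand adds this average to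
    obtain an exact derivative. *)
Lemma avg_om_fG1 : avg (weighted true (fun=> 1) (term Tpd_om_fG f t x)) = 0.
Proof.
have [cp _ cp2 _ _] := state_cont.
have i0 := int_term Tid false c1m; have i1 := int_term Tid true c1m.
have iG := int_term Tpd_om_fG true c1m.
have [rho0 _] := f_nondeg x t_ge0.
have E : avg (fun th om => weighted true (fun=> 1) (term Tpd_om_fG f t x) th om +
   (m * weighted false (fun=> 1) phi th om + -1 * weighted true (fun=> 1) phi th om)) = 0.
  apply: (avg_der_omega _ (H := fun th om => om * (phi th om * (m - om)))).
  - by apply: avg_integrableD => //; apply: avg_integrableD; exact: avg_integrableZ.
  - move=> th; have := cont2_r (th := th) cp2 => cc; have := cont2_r (th := th) cp => cc'.
    apply: (@eq_continuous_fun (fun om => om ^+ true * 1 * (phi2 th om * (m - om) - phi th om) +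
      (m * (om ^+ false * 1 * phi th om) + -1 * (om ^+ true * 1 * phi th om)))) => [om|].
      by rewrite /weighted /term pd_fG.
    by cont.
  - move=> th om; have d := state_der_om th om.
    by der; rewrite /weighted /term pd_fG; ring.
  - by move=> th; apply: (@lim_comb th _ 0 m (-1) 0 0) => om; ring.
move: E; rewrite avgD//; last by apply: avg_integrableD; exact: avg_integrableZ.
rewrite avgD; [|exact: avg_integrableZ..].
rewrite avgZ// avgZ//.
have -> : avg (weighted false (fun=> 1) phi) = rho f t x.
  by apply: eq_avg => th om; rewrite /weighted expr0 !mul1r.
have -> : avg (weighted true (fun=> 1) phi) = avg (fun th om => om * phi th om).
  by apply: eq_avg => th om; rewrite /weighted expr1 mulr1.
have -> : m * rho f t x = avg (fun th om => om * phi th om).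
  by rewrite /m /omegabar mulrC mulVKf// gt_eqF.
by rewrite mulN1r subrr addr0.
Qed.

Lemma orientation_thetabar : orientation f t x = tau c /\ flux f t x = enorm (flux f t x) *: tau c.
Proof.
have [_ J0] := f_nondeg x t_ge0; set J := flux f t x in J0 *.
have S0 : 0 < J 0 0 ^+ 2 + J 0 1 ^+ 2.
  rewrite lt0r addr_ge0 ?sqr_ge0// andbT; apply: contra J0.
  rewrite paddr_eq0 ?sqr_ge0// !sqrf_eq0 => /andP[/eqP e0 /eqP e1].
  by apply/eqP/rowP => j; rewrite [RHS]mxE; case: (ord2P j) => ->.
have EJ := enormE J.
have N0 : 0 < enorm J by rewrite EJ sqrtr_gt0.
have N2 : enorm J ^+ 2 = J 0 0 ^+ 2 + J 0 1 ^+ 2.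
  by rewrite EJ sqr_sqrtr// ltW.
have [a aI [ca sa]] : exists2 a : R, - pi < a <= pi & cos a = (enorm J)^-1 * J 0 0 /\ sin a =
    (enorm J)^-1 * J 0 1.
  by apply: circle_angle; rewrite !exprMn -mulrDr -N2 -exprMn mulVf ?expr1n// gt_eqF.
have oa : orientation f t x = tau a.
  apply/rowP => j; rewrite /orientation -/J [LHS]mxE [RHS]mxE; by case: (ord2P j) => -> /=;
      rewrite ?ca ?sa.
have oc : orientation f t x = tau c.
  by have [] := @xgetPex _ 0 [set a | - pi < a <= pi /\ orientation f t x = tau a] (ex_intro _ a
      (conj aI oa)).
by split => //; rewrite -oc /orientation -/J scalerA divff ?scale1r// gt_eqF.
Qed.

(** At a = c this vanishes: the flux has no component along [tau_perp c]. This makes [gci] a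
    collision invariant. *)
Lemma avg_sin_flux (a : R) : avg (fun th om => sin (th - a) * phi th om) =
  enorm (flux f t x) * sin (c - a).
Proof.
have [_ JE] := orientation_thetabar.
have is_ := int_term Tid false (@continuous_sin R).
have ic_ := int_term Tid false (@continuous_cos R).
transitivity (cos a * avg (weighted false sin phi) + - sin a * avg (weighted false cos phi)).
  rewrite -avgZ// -[in X in _ + X]avgZ// -avgD; [|exact: avg_integrableZ..].
  by apply: eq_avg => th om; rewrite /weighted sinB; ring.
have -> : avg (weighted false sin phi) = flux f t x 0 1.
  by rewrite mxE; apply: eq_avg => th om; rewrite /weighted expr0 mul1r mxE.
have -> : avg (weighted false cos phi) = flux f t x 0 0.
  by rewrite mxE; apply: eq_avg => th om; rewrite /weighted expr0 mul1r mxE.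
have e j : flux f t x 0 j = enorm (flux f t x) * tau c 0 j by rewrite {1}JE mxE.
by rewrite !e !mxE /= sinB; ring.
Qed.

Variable kappa : R.
Hypothesis kappa_gt0 : 0 < kappa.

(* H = A (- ktheta f F + alpha2 d_theta f) - alpha2 A' f with A = gci (theta - c)
   integrates the collision terms by parts twice. *)
Lemma avg_gci_collision (alpha2 : R) (A := fun th => gci kappa (th - c)) :
  - (kappa * alpha2) * avg (weighted false A (term Tpd_th_fF f t x)) +
  alpha2 * avg (weighted false A (term Tpd_th_th f t x)) = 0.
Proof.
have [cp cp1 _ cp11 _] := state_cont.
have cA : continuous A by apply: continuous_shift; exact: continuous_gci.
have csin : continuous (fun th : R => sin (th - c)) by cont.
have i1 := int_term Tpd_th_fF false cA; have i2 := int_term Tpd_th_th false cA.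
have i3 := int_term Tid false csin.
(* The collision terms alone are not an exact derivative; by the equation for [gci] the defect is
   alpha2 sin (th - c) f. Adding it makes [h] exact, and its own average is 0 by the direction of
   the flux. *)
pose h th om := - (kappa * alpha2) * weighted false A (term Tpd_th_fF f t x) th om +
  (alpha2 * weighted false A (term Tpd_th_th f t x) th om +
   alpha2 * weighted false (fun th => sin (th - c)) phi th om).
have hE th om : h th om = - (kappa * alpha2) * (A th * (phi1 th om * sin (c - th) - phi th om *
    cos (c - th))) +
  (alpha2 * (A th * phi11 th om) + alpha2 * (sin (th - c) * phi th om)).
  by rewrite /h /weighted /term pd_fF expr0 !mul1r.
have h0 : avg h = 0.
  pose H th om := A th * (kappa * alpha2 * (phi th om * sin (th - c)) + alpha2 * phi1 th om)
     - alpha2 * dgci kappa (th - c) * phi th om.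
  have ih : avg_integrable h.
    by apply: avg_integrableD; [|apply: avg_integrableD]; exact: avg_integrableZ.
  have ch om : continuous (h ^~ om).
    have c1 := cont2_l (om := om) cp1; have c2 := cont2_l (om := om) cp.
    have c3 := cont2_l (om := om) cp11.
    apply: (@eq_continuous_fun (fun th => - (kappa * alpha2) * (A th * (phi1 th om * sin (c -
        th) - phi th om * cos (c - th))) +
      (alpha2 * (A th * phi11 th om) + alpha2 * (sin (th - c) * phi th om)))) => [th|].
      by rewrite hE.
    by cont.
  have dH th om : is_derive th 1 (H ^~ om) (h th om).
    have d1 := state_der_th th om; have d2 := state_der_thth th om.
    have d3 : is_derive th 1 A (dgci kappa (th - c)) by apply: der_shift; exact: der_gci.
    have d4 : is_derive th 1 (fun th => dgci kappa (th - c)) (ddgci kappa (th - c)).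
      by apply: der_shift; exact: der_dgci.
    rewrite /H; der; rewrite hE.
    have -> : ddgci kappa (th - c) = kappa * sin (th - c) * dgci kappa (th - c) - sin (th - c).
      by rewrite -(gci_ode kappa_gt0); ring.
    have -> : c - th = - (th - c) by ring.
    by rewrite sinN cosN; ring.
  have Hp om : H pi om = H (- pi) om.
    rewrite /H; have -> : A pi = A (- pi).
      by rewrite /A -(gciD2 kappa (- pi - c)); congr gci; ring.
    have -> : pi - c = (- pi - c) + 2 * pi by ring.
    by rewrite sinD2 dgciD2 phi_per phi1_per.
  exact: (avg_der_theta ih ch dH Hp).
move: h0; rewrite avgD; [|exact: avg_integrableZ|by apply: avg_integrableD; exact: avg_integrableZ].
rewrite avgD; [|exact: avg_integrableZ..]; rewrite !avgZ//.
have -> : avg (weighted false (fun th => sin (th - c)) phi) = 0.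
  rewrite -(mulr0 (enorm (flux f t x))) -(sin0 R) -(subrr c) -avg_sin_flux.
  by apply: eq_avg => th om; rewrite /weighted expr0 mul1r.
move: (avg (weighted false A (term Tpd_th_fF f t x))) => X.
move: (avg (weighted false A (term Tpd_th_th f t x))) => Y.
by rewrite mulr0 addr0.
Qed.

End CollisionMoments.

(** * Averages of the equilibrium *)

Section VonMisesAverages.
Context {R : realType}.
Notation mu := (@lebesgue_measure R).
Implicit Types (h : R -> R) (th om : R).
Variable kappa : R.
Local Notation N := (von_mises kappa 0).

Lemma von_mises_shift c th : von_mises kappa c th = N (th - c).
Proof. by rewrite /von_mises subr0. Qed.

Lemma circ_von_mises_shift h c : continuous h -> (forall x, h (x + 2 * pi) = h x) ->
  circ (fun th => h (th - c) * von_mises kappa c th) = circ (fun x => h x * N x).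
Proof.
move=> ch hp; rewrite -(@circ_shift _ (fun x => h x * N x) c).
- by apply: eq_circ => th; rewrite von_mises_shift.
- by have := @continuous_von_mises R kappa 0 => cN; cont.
- by move=> x; rewrite hp !von_misesE cosD2.
Qed.

Lemma circ_von_mises_odd h : continuous h -> (forall x, h (- x) = - h x) ->
  circ (fun x => h x * N x) = 0.
Proof.
move=> ch ho; apply: circ_odd => [|x].
  by have := @continuous_von_mises R kappa 0 => cN; cont.
by rewrite ho !von_misesE cosN mulNr.
Qed.

(** In the frame of the mean direction the coefficients are the even cos and the odd sin of th - c,
    so parity decides which component survives in each average below. *)
Lemma tau_shift c th (j : 'I_2) :
  tau th 0 j = cos (th - c) * tau c 0 j + sin (th - c) * tau_perp c 0 j.
Proof.
have e := cos2Dsin2 c.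
have C : cos c * cos c = 1 - sin c * sin c by rewrite -e; ring.
rewrite !mxE cosB sinB; case: (ord2P j) => -> /=.
  transitivity (cos th * (cos c * cos c) + cos th * (sin c * sin c)); last by ring.
  by rewrite C; ring.
transitivity (sin th * (cos c * cos c) + sin th * (sin c * sin c)); last by ring.
by rewrite C; ring.
Qed.

Lemma continuous_tau (j : 'I_2) : continuous (fun th : R => tau th 0 j).
Proof.
case: (ord2P j) => ->.
  by rewrite (_ : (fun _ => _) = cos); [exact: continuous_cos|apply/funext => th; rewrite mxE].
by rewrite (_ : (fun _ => _) = sin); [exact: continuous_sin|apply/funext => th; rewrite mxE].
Qed.

Lemma circ_tau c (j : 'I_2) :
  circ (fun th => tau th 0 j * von_mises kappa c th) = c1 kappa * tau c 0 j.
Proof.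
pose h x := cos x * tau c 0 j + sin x * tau_perp c 0 j.
transitivity (circ (fun th => h (th - c) * von_mises kappa c th)).
  by apply: eq_circ => th; rewrite (tau_shift c).
have cN := @continuous_von_mises R kappa 0.
rewrite circ_von_mises_shift; [|by rewrite /h; cont|by move=> x; rewrite /h cosD2 sinD2].
transitivity (tau c 0 j * circ (fun x => cos x * N x) + tau_perp c 0 j * circ (fun x => sin x *
    N x)).
  rewrite -circZl; last by cont.
  rewrite -[in X in _ + X]circZl; last by cont.
  rewrite -circD; [|by cont..].
  by apply: eq_circ => x; rewrite /h; ring.
rewrite circ_von_mises_cos (circ_von_mises_odd (h := sin)); [|by cont|by move=> x; rewrite sinN].
by rewrite mulr0 addr0 mulrC.
Qed.

Lemma circ_one c : circ (von_mises kappa c) = 1.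
Proof.
have c1 : continuous (fun _ : R => 1 : R) by exact: cst_continuous.
have := @circ_von_mises_shift (fun=> 1) c c1 (fun=> erefl).
have -> : (fun th => 1 * von_mises kappa c th) = von_mises kappa c.
  by apply/funext => th; rewrite mul1r.
move=> ->; transitivity (circ N); last exact: circ_von_mises.
by apply: eq_circ => x; rewrite mul1r.
Qed.

(** Oddness of [gci] against an even weight. This is why the time derivative of the density drops
    out of the orientation equation. *)
Lemma circ_gci c :
  circ (fun th => gci kappa (th - c) * von_mises kappa c th) = 0.
Proof.
rewrite circ_von_mises_shift; [|exact: continuous_gci|exact: gciD2].
by apply: circ_von_mises_odd; [exact: continuous_gci|exact: gciN].
Qed.

Lemma circ_gci_sin c :
  circ (fun th => gci kappa (th - c) * sin (th - c) * von_mises kappa c th) = K1 kappa.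
Proof.
have cg := @continuous_gci R kappa.
rewrite (@circ_von_mises_shift (fun x => gci kappa x * sin x)); first last.
- by move=> x; rewrite gciD2 sinD2.
- by cont.
by rewrite K1_circ; apply: eq_circ => x; ring.
Qed.

Lemma circ_gci_tau c (j : 'I_2) :
  circ (fun th => gci kappa (th - c) * tau th 0 j * von_mises kappa c th) =
  K1 kappa * tau_perp c 0 j.
Proof.
have cg := @continuous_gci R kappa; have cN := @continuous_von_mises R kappa 0.
pose h x := gci kappa x * (cos x * tau c 0 j + sin x * tau_perp c 0 j).
transitivity (circ (fun th => h (th - c) * von_mises kappa c th)).
  by apply: eq_circ => th; rewrite (tau_shift c).
rewrite circ_von_mises_shift; [|by rewrite /h; cont|by move=> x; rewrite /h gciD2 cosD2 sinD2].
transitivity (tau c 0 j * circ (fun x => gci kappa x * cos x * N x) +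
    tau_perp c 0 j * circ (fun x => sin x * N x * gci kappa x)).
  rewrite -circZl; last by cont.
  rewrite -[in X in _ + X]circZl; last by cont.
  rewrite -circD; [|by cont..].
  by apply: eq_circ => x; rewrite /h; ring.
rewrite (circ_von_mises_odd (h := fun x => gci kappa x * cos x)).
- by rewrite mulr0 add0r -K1_circ mulrC.
- by cont.
- by move=> x; rewrite gciN cosN mulNr.
Qed.

Lemma circ_gci_tau_sin c (j : 'I_2) :
  circ (fun th => gci kappa (th - c) * tau th 0 j * sin (th - c) * von_mises kappa c th) =
  K2 kappa * tau c 0 j.
Proof.
have cg := @continuous_gci R kappa; have cN := @continuous_von_mises R kappa 0.
pose h x := gci kappa x * (cos x * tau c 0 j + sin x * tau_perp c 0 j) * sin x.
transitivity (circ (fun th => h (th - c) * von_mises kappa c th)).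
  by apply: eq_circ => th; rewrite (tau_shift c).
rewrite circ_von_mises_shift; [|by rewrite /h; cont|by move=> x; rewrite /h gciD2 cosD2 sinD2].
transitivity (tau c 0 j * circ (fun x => cos x * sin x * N x * gci kappa x) +
    tau_perp c 0 j * circ (fun x => gci kappa x * sin x * sin x * N x)).
  rewrite -circZl; last by cont.
  rewrite -[in X in _ + X]circZl; last by cont.
  rewrite -circD; [|by cont..].
  by apply: eq_circ => x; rewrite /h; ring.
rewrite (circ_von_mises_odd (h := fun x => gci kappa x * sin x * sin x)).
- by rewrite mulr0 addr0 mulrC.
- by cont.
- by move=> x; rewrite gciN sinN; ring.
Qed.

End VonMisesAverages.

(** * The Gaussian factor in omega *)

Section Gaussian.
Context {R : realType}.
Notation mu := (@lebesgue_measure R).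
Implicit Types (h : R -> R) (th om m : R).
Variables komega beta : R.
Hypotheses (komega_gt0 : 0 < komega) (beta_gt0 : 0 < beta).

(** The variance is beta^2 / komega; integrability and total mass follow from the normal density. *)
Lemma gaussian_normal_pdf m :
  gaussian komega beta m = normal_pdf m (Num.sqrt (beta ^+ 2 / komega)).
Proof.
have v0 : 0 < beta ^+ 2 / komega by rewrite divr_gt0 ?exprn_gt0.
have s0 : Num.sqrt (beta ^+ 2 / komega) != 0 by rewrite gt_eqF// sqrtr_gt0.
apply/funext => om; rewrite normal_pdfE// /gaussian /normal_peak /normal_fun.
rewrite sqr_sqrtr ?ltW//; congr (_ * expR _).
  rewrite -sqrtrV; last by rewrite mulrn_wge0// mulr_ge0 ?pi_ge0// ltW.
  congr Num.sqrt; have := pi_gt0 R; move: (pi) => P P0.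
  by field; rewrite !gt_eqF.
by field; rewrite !gt_eqF.
Qed.

Lemma integrable_gaussian m : mu.-integrable setT (EFin \o gaussian komega beta m).
Proof. by rewrite gaussian_normal_pdf; exact: integrable_normal_pdf. Qed.

Lemma Rintegral_gaussian m : \int[mu]_om gaussian komega beta m om = 1.
Proof. by rewrite gaussian_normal_pdf /Rintegral integral_normal_pdf. Qed.

Lemma continuous_gaussian m : continuous (gaussian komega beta m).
Proof. by rewrite /gaussian; cont. Qed.

Lemma gaussian_gt0 m om : 0 < gaussian komega beta m om.
Proof.
rewrite /gaussian mulr_gt0 ?expR_gt0// sqrtr_gt0 divr_gt0//.
by rewrite !mulr_gt0 ?pi_gt0.
Qed.

End Gaussian.

Section GaussianMoment.
Context {R : realType}.
Notation mu := (@lebesgue_measure R).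
Implicit Types (om m : R).

(* |y| <= (1 + 2 / s) exp (s y^2 / 2) compares with a Gaussian of halved rate. *)
Lemma integrable_gaussian_id (k b m : R) : 0 < k -> 0 < b ->
  mu.-integrable setT (EFin \o (fun om => om * gaussian k b m om)).
Proof.
move=> k0 b0.
have k20 : 0 < k / 2 by rewrite divr_gt0.
pose s := k / (2 * b ^+ 2).
have s0 : 0 < s by rewrite divr_gt0 ?mulr_gt0 ?exprn_gt0.
pose P : R := Num.sqrt (k / (2 * pi * b ^+ 2)); pose P' : R := Num.sqrt (k / 2 / (2 * pi * b ^+ 2)).
have P0 : 0 <= P by exact: sqrtr_ge0.
have P'0 : 0 < P' by rewrite sqrtr_gt0 divr_gt0// !mulr_gt0 ?pi_gt0.
(* P / P' compensates the two normalisations. The other factor bounds |om| e, from |om| <= |m| + 1 +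
   y^2, e <= 1 and y^2 e <= 2 / s. *)
pose C : R := P / P' * (`|m| + 1 + 2 / s).
have C0 : 0 <= C.
  rewrite mulr_ge0 ?divr_ge0 ?(ltW P'0)// addr_ge0//.
  by rewrite divr_ge0// ltW.
have idom := integrableZl measurableT C (integrable_gaussian k20 b0 m).
have cid : continuous (fun om => om * gaussian k b m om).
  by have := @continuous_gaussian R k b m => cg; cont.
have mid : measurable_fun setT (EFin \o (fun om => om * gaussian k b m om)).
  by apply/measurable_EFinP; exact: continuous_measurable_fun.
suff bound (om : R) : `|om * gaussian k b m om| <= C * gaussian (k / 2) b m om.
  apply: (le_integrable _ _ _ idom) => // om _ /=; rewrite lee_fin.
  by apply: le_trans (bound om) _; exact: ler_norm.
have g0 := gaussian_gt0 k0 b0 m om.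
rewrite normrM (gtr0_norm g0) /gaussian -/P -/P' -/s.
pose y := om - m.
have -> : k / 2 / (2 * b ^+ 2) = s / 2 by rewrite /s; field; rewrite gt_eqF.
have -> : expR (- s * (om - m) ^+ 2) = expR (- (s / 2) * y ^+ 2) * expR (- (s / 2) * y ^+ 2).
  by rewrite -expRD; congr expR; rewrite /y; field.
set e := expR _.
have e0 : 0 < e by exact: expR_gt0.
have -> : C * (P' * e) = P * e * (`|m| + 1 + 2 / s).
  by rewrite /C; field; rewrite !gt_eqF.
have -> : `|om| * (P * (e * e)) = P * e * (`|om| * e) by ring.
rewrite ler_wpM2l ?mulr_ge0 ?(ltW e0)//.
have ee : e * expR (s / 2 * y ^+ 2) = 1 by rewrite /e -expRD mulNr addrC subrr expR0.
have q0 : 0 <= s / 2 * y ^+ 2 by rewrite mulr_ge0 ?sqr_ge0// divr_ge0// ltW.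
have e1 : e <= 1 by rewrite -expR0 ler_expR mulNr oppr_le0.
have ge1 := expR_ge1Dx (s / 2 * y ^+ 2).
have y2e : y ^+ 2 * e <= 2 / s.
  have H : s / 2 * y ^+ 2 <= expR (s / 2 * y ^+ 2) by apply: le_trans ge1; rewrite lerDr.
  have : s / 2 * y ^+ 2 * e <= 1 by rewrite (le_trans (ler_wpM2r (ltW e0) H))// mulrC ee.
  move=> H1; have s20 : 0 < s / 2 by rewrite divr_gt0.
  rewrite -(ler_pM2l s20).
  have -> : s / 2 * (2 / s) = 1 by field; rewrite gt_eqF.
  by rewrite mulrA.
have omy : `|om| <= `|m| + (1 + y ^+ 2).
  have -> : om = m + y by rewrite /y addrC subrK.
  rewrite (le_trans (ler_normD _ _))// lerD2l.
  have : 0 <= (`|y| - 1) ^+ 2 by exact: sqr_ge0.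
  rewrite sqrrB1 real_normK ?num_real//; have := normr_ge0 y; lra.
apply: (@le_trans _ _ ((`|m| + (1 + y ^+ 2)) * e)); first by rewrite ler_wpM2r// ltW.
rewrite mulrDl mulrDl mul1r -addrA lerD//; first by rewrite ler_piMr.
by rewrite lerD.
Qed.

End GaussianMoment.

(** * Moments and slopes of the equilibrium *)

Section EquilibriumState.
Context {R : realType}.
Notation mu := (@lebesgue_measure R).
Implicit Types (th om : R).
Variables kappa komega beta : R.
Hypotheses (komega_gt0 : 0 < komega) (beta_gt0 : 0 < beta).

Lemma avg_equilibrium (a : R -> R) (b : bool) c m : continuous a ->
  avg_integrable (fun th om => a th * von_mises kappa c th * (om ^+ b * gaussian komega beta m
      om)) /\
  avg (fun th om => a th * von_mises kappa c th * (om ^+ b * gaussian komega beta m om)) =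
  circ (fun th => a th * von_mises kappa c th) * \int[mu]_om (om ^+ b * gaussian komega beta m om).
Proof.
move=> ca; have cN := @continuous_von_mises R kappa c.
apply: (@avg_prod _ (fun th => a th * von_mises kappa c th) (fun om => om ^+ b * gaussian komega
    beta m om)).
  by cont.
case: b => /=.
  by under eq_fun do rewrite expr1; exact: integrable_gaussian_id.
under eq_fun do rewrite expr0 mul1r.
exact: (integrable_gaussian komega_gt0 beta_gt0 m).
Qed.

(** The parameters are moments of [f] itself, so self-consistency relations come with the
    formula. *)
Definition is_equilibrium (f : state R) t x := forall th om,
  f t x th om = rho f t x * von_mises kappa (thetabar f t x) th
                * gaussian komega beta (omegabar f t x) om.

Section OnePoint.
Variables (f : state R) (t : R) (x : 'rV[R]_2).
Hypothesis (rho_gt0 : 0 < rho f t x).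
Hypothesis fE : is_equilibrium f t x.
Let r := rho f t x.
Let c := thetabar f t x.
Let m := omegabar f t x.
Let G := gaussian komega beta m.
Let c1c : continuous (fun _ : R => 1 : R). Proof. exact: cst_continuous. Qed.

(** For b = true the first moment is not computed: [m] is the mean frequency of [f], and the average
    defining it factorises into the density times this very integral. *)
Lemma gaussian_mean (b : bool) : \int[mu]_om (om ^+ b * G om) = m ^+ b.
Proof.
case: b => /=; last first.
  rewrite expr0 -(Rintegral_gaussian komega_gt0 beta_gt0 m).
  by apply: eq_Rintegral => om _; rewrite expr0 mul1r.
have [i0 e0] := @avg_equilibrium (fun=> 1) true c m c1c.
have e : avg (fun th om => om * f t x th om) = r * \int[mu]_om (om ^+ true * G om).
  transitivity (r * avg (fun th om => 1 * von_mises kappa c th * (om ^+ true * G om))).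
    rewrite -avgZ//; apply: eq_avg => th om; rewrite fE -/r -/c -/m -/G /=; ring.
  rewrite e0; congr (_ * _); rewrite -[RHS]mul1r; congr (_ * _).
  transitivity (circ (von_mises kappa c)); last exact: circ_one.
  by apply: eq_circ => th; rewrite mul1r.
by rewrite expr1 /m /omegabar e mulKf// gt_eqF.
Qed.

Lemma avg_weighted_equilibrium (b : bool) (a : R -> R) : continuous a ->
  avg (weighted b a (f t x)) = r * circ (fun th => a th * von_mises kappa c th) * m ^+ b.
Proof.
move=> ca; have [i0 e0] := @avg_equilibrium a b c m ca.
transitivity (r * avg (fun th om => a th * von_mises kappa c th * (om ^+ b * G om))).
  by rewrite -avgZ//; apply: eq_avg => th om; rewrite /weighted fE -/r -/c -/m -/G; ring.
by rewrite e0 gaussian_mean mulrA.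
Qed.

Lemma flux_equilibrium (j : 'I_2) : flux f t x 0 j = r * c1 kappa * tau c 0 j.
Proof.
rewrite mxE -mulrA -circ_tau -[RHS]mulr1 -[X in _ * X](expr0 m).
rewrite -(avg_weighted_equilibrium false); last exact: continuous_tau.
by apply: eq_avg => th om; rewrite /weighted expr0 mul1r.
Qed.

(* The derivative of the equilibrium in a direction along which the density,
   the angle and the mean frequency have derivatives dr, l and dm. *)
Definition dequilibrium (dr l dm : R) th om :=
  f t x th om * (dr / r + kappa * l * sin (th - c) + komega / beta ^+ 2 * (om - m) * dm).

(** For weights independent of omega the [dm] term disappears, since om - m has mean 0 under the
    Gaussian. *)
Lemma avg_dequilibrium (a : R -> R) dr l dm : continuous a ->
  avg (weighted false a (dequilibrium dr l dm)) =
  dr * circ (fun th => a th * von_mises kappa c th) +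
  kappa * r * l * circ (fun th => a th * sin (th - c) * von_mises kappa c th).
Proof.
move=> ca; have cas : continuous (fun th => a th * sin (th - c)) by cont.
have [i0 e0] := @avg_equilibrium a false c m ca.
have [i1 e1] := @avg_equilibrium a true c m ca.
have [i2 e2] := @avg_equilibrium _ false c m cas.
(* The factor om - m is split so that every piece is a product of a function of th and a function of
   om; the two pieces carrying [k] cancel afterwards. *)
pose k := r * (komega / beta ^+ 2) * dm.
transitivity (avg (fun th om =>
  (dr - k * m) * (a th * von_mises kappa c th * (om ^+ false * G om)) +
  (k * (a th * von_mises kappa c th * (om ^+ true * G om)) +
   kappa * r * l * (a th * sin (th - c) * von_mises kappa c th * (om ^+ false * G om))))).
  apply: eq_avg => th om; rewrite /weighted /dequilibrium fE -/r -/c -/m -/G /k /= expr0 expr1.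
  by field; rewrite !gt_eqF.
rewrite avgD; [|exact: avg_integrableZ|by apply: avg_integrableD; exact: avg_integrableZ].
rewrite avgD; [|exact: avg_integrableZ..].
by rewrite !avgZ// e0 e1 e2 !gaussian_mean expr0 expr1; ring.
Qed.

End OnePoint.

Lemma tauE (a : R) : tau a = tau a 0 0 *: dirx 0 + tau a 0 1 *: dirx 1.
Proof.
by apply/rowP => j; case: (ord2P j) => ->; rewrite !mxE /= ?mulr1 ?mulr0 ?addr0 ?add0r.
Qed.

Lemma tau_perpE (a : R) : tau_perp a = tau_perp a 0 0 *: dirx 0 + tau_perp a 0 1 *: dirx 1.
Proof.
by apply/rowP => j; case: (ord2P j) => ->; rewrite !mxE /= ?mulr1 ?mulr0 ?addr0 ?add0r.
Qed.

Section Curve.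
Context (F : set_system R).
Hypothesis FF : ProperFilter F.
Hypothesis F0 : 0^' `<=` F.
Variables (f : state R) (T : R -> R) (X : R -> 'rV[R]_2).
Hypothesis T_ge0 : F [set h | 0 <= T h].
Hypothesis T0_ge0 : 0 <= T 0.
Hypothesis f_nondeg : moments_nondegenerate f.
Hypothesis f_eq : forall t x, 0 <= t -> is_equilibrium f t x.
Let r h := rho f (T h) (X h).
Let c h := thetabar f (T h) (X h).
Let m h := omegabar f (T h) (X h).
Variables (dr dM : R) (dJ : 'I_2 -> R).
Hypothesis sr : slope F r dr.
Hypothesis sJ : forall j, slope F (fun h => flux f (T h) (X h) 0 j) (dJ j).
Hypothesis sM : slope F (fun h => avg (fun th om => om * f (T h) (X h) th om)) dM.

(** The slopes of density, flux and first frequency moment determine those of all parameters, and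
    then of [f] through its formula. The angle enters only through [tau], so its jumps do no
    harm. *)
Lemma equilibrium_slopes : exists l dm,
  [/\ slope F (fun h => tau (c h)) (l *: tau_perp (c 0)), slope F m dm &
      forall th om, slope F (fun h => f (T h) (X h) th om)
        (dequilibrium f (T 0) (X 0) dr l dm th om)].
Proof.
have r0 : r 0 != 0 by rewrite gt_eqF//; exact: (f_nondeg (X 0) T0_ge0).1.
(* Otherwise the flux of the equilibrium would vanish, against nondegeneracy. This allows recovering
   the direction from the flux. *)
have k0 : c1 kappa != 0.
  apply/eqP => k0; have [rp /eqP] := f_nondeg (X 0) T0_ge0; apply.
  apply/rowP => j; rewrite (flux_equilibrium rp (f_eq (X 0) T0_ge0)) k0 [RHS]mxE.
  by rewrite mulr0 mul0r.
have srV := slopeV FF F0 r0 sr.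
have JE t x j : 0 <= t -> tau (thetabar f t x) 0 j = (c1 kappa)^-1 * (flux f t x 0 j * (rho f t
    x)^-1).
  move=> t0; have [rp _] := f_nondeg x t0.
  rewrite (flux_equilibrium rp (f_eq x t0)); field.
  by rewrite k0 gt_eqF.
have [dO sO] : exists dO : 'I_2 -> R, forall j, slope F (fun h => tau (c h) 0 j) (dO j).
  pose dO j := (c1 kappa)^-1 * (dJ j * (r 0)^-1 + flux f (T 0) (X 0) 0 j * (- (r 0) ^- 2 * dr)).
  exists dO => j.
  have := slopeM FF F0 (slope_cst FF (c1 kappa)^-1) (slopeM FF F0 (@sJ j) srV).
  rewrite mul0r add0r; apply: (slope_eq FF); last by rewrite -JE.
  by apply: filterS T_ge0 => h Th; rewrite -JE.
have sm : exists dm, slope F m dm.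
  eexists; exact: (slopeM FF F0 srV sM).
have [dm sdm] := sm.
(* [tau] has unit length, so its slope is orthogonal to it; [l] below is the remaining coordinate,
   along [tau_perp]. *)
have ort : cos (c 0) * dO 0 + sin (c 0) * dO 1 = 0.
  have tau0 (a : R) : tau a 0 0 = cos a by rewrite mxE.
  have tau1 (a : R) : tau a 0 1 = sin a by rewrite mxE.
  have unit_tau (a : R) : tau a 0 0 * tau a 0 0 + tau a 0 1 * tau a 0 1 = 1.
    by rewrite tau0 tau1 -!expr2 cos2Dsin2.
  have s1 := slopeD FF (slopeM FF F0 (sO 0) (sO 0)) (slopeM FF F0 (sO 1) (sO 1)).
  have nr : \forall h \near F, tau (c h) 0 0 * tau (c h) 0 0 + tau (c h) 0 1 * tau (c h) 0 1 = 1.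
    by apply: nearW => h; exact: unit_tau.
  have s0 := slope_eq FF nr (unit_tau (c 0)) s1.
  have := slope_unique FF s0 (slope_cst FF (1 : R)).
  rewrite !tau0 !tau1 => H3.
  have : 2 * (cos (c 0) * dO 0 + sin (c 0) * dO 1) = 0 by apply: etrans H3; ring.
  by move/eqP; rewrite mulf_eq0 pnatr_eq0 /= => /eqP.
pose l := - sin (c 0) * dO 0 + cos (c 0) * dO 1.
have e2 := cos2Dsin2 (c 0).
have lO j : dO j = l * tau_perp (c 0) 0 j.
  rewrite mxE /l; case: (ord2P j) => -> /=.
    transitivity (dO 0 * (cos (c 0) ^+ 2 + sin (c 0) ^+ 2) - cos (c 0) * (cos (c 0) * dO 0 + sin
        (c 0) * dO 1)).
      by rewrite e2 ort; ring.
    by ring.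
  transitivity (dO 1 * (cos (c 0) ^+ 2 + sin (c 0) ^+ 2) - sin (c 0) * (cos (c 0) * dO 0 + sin
      (c 0) * dO 1)).
    by rewrite e2 ort; ring.
  by ring.
exists l, dm; split=> //.
  have -> : (fun h => tau (c h)) = (fun h => tau (c h) 0 0 *: dirx 0 + tau (c h) 0 1 *: dirx 1).
    by apply/funext => h; rewrite -tauE.
  rewrite tau_perpE scalerDr !scalerA -!lO.
  by apply: (slopeD FF); apply: (slopeZv FF); exact: sO.
move=> th om.
(* cos (th - c) is expanded as cos th cos c + sin th sin c, so that only the components of [tau] are
   differentiated. *)
have sE : slope F (fun h => expR (kappa * (cos th * tau (c h) 0 0 + sin th * tau (c h) 0 1)))
    (expR (kappa * (cos th * tau (c 0) 0 0 + sin th * tau (c 0) 0 1)) *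
     (kappa * (cos th * dO 0 + sin th * dO 1))).
  have sA : slope F (fun h => kappa * (cos th * tau (c h) 0 0 + sin th * tau (c h) 0 1))
      (kappa * (cos th * dO 0 + sin th * dO 1)).
    have := slopeM FF F0 (slope_cst FF kappa) (slopeD FF (slopeM FF F0 (slope_cst FF (cos th))
        (sO 0))
       (slopeM FF F0 (slope_cst FF (sin th)) (sO 1))).
    by rewrite !mul0r !add0r.
  exact: (slope_comp FF F0 (is_derive_expR _) sA).
have sG : slope F (fun h => gaussian komega beta (m h) om)
    (komega / beta ^+ 2 * (om - m 0) * gaussian komega beta (m 0) om * dm).
  have dG : is_derive (m 0) 1 (fun m => gaussian komega beta m om)
      (komega / beta ^+ 2 * (om - m 0) * gaussian komega beta (m 0) om).
    by rewrite /gaussian; der => /=; field; rewrite gt_eqF.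
  exact: (slope_comp FF F0 dG sdm).
pose Zi := (2 * pi * besselI 0 kappa)^-1.
have vE a : von_mises kappa a th = Zi * expR (kappa * (cos th * tau a 0 0 + sin th * tau a 0 1)).
  by rewrite /von_mises cosB !mxE.
have := slopeM FF F0 (slopeM FF F0 sr (slopeM FF F0 (slope_cst FF Zi) sE)) sG.
have -> : dequilibrium f (T 0) (X 0) dr l dm th om =
  (dr * (Zi * expR (kappa * (cos th * tau (c 0) 0 0 + sin th * tau (c 0) 0 1))) +
   r 0 * (0 * expR (kappa * (cos th * tau (c 0) 0 0 + sin th * tau (c 0) 0 1)) +
   Zi * (expR (kappa * (cos th * tau (c 0) 0 0 + sin th * tau (c 0) 0 1)) *
      (kappa * (cos th * dO 0 + sin th * dO 1))))) * gaussian komega beta (m 0) om +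
  r 0 * (Zi * expR (kappa * (cos th * tau (c 0) 0 0 + sin th * tau (c 0) 0 1))) *
  (komega / beta ^+ 2 * (om - m 0) * gaussian komega beta (m 0) om * dm).
  rewrite /dequilibrium (f_eq (X 0) T0_ge0) -/(r 0) -/(c 0) -/(m 0) vE !lO sinB.
  set e := expR _; rewrite !mxE /=.
  by field; rewrite r0 gt_eqF.
apply: (slope_eq FF).
- by apply: filterS T_ge0 => h Th; rewrite (f_eq (X h) Th) vE.
- by rewrite (f_eq (X 0) T0_ge0) vE.
Qed.

End Curve.

End EquilibriumState.

(** * The limit of the kinetic equation *)

Section HydrodynamicLimit.
Context {R : realType}.
Implicit Types (t th om eps : R) (x : 'rV[R]_2).

Lemma near_eps_gt0 : \forall eps \near (0 : R)^'+, 0 < eps.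
Proof. exact: nbhs_right_gt. Qed.

Lemma lim_at_right_unique (g : R -> R) (a b : R) : g eps @[eps --> 0^'+] --> a ->
  g eps @[eps --> 0^'+] --> b -> a = b.
Proof.
move=> ga gb; apply: (cvg_unique _ _ gb); first exact: norm_hausdorff.
exact: ga.
Qed.

Section LinearCombinations.
Variables (h1 h2 h3 h4 : R -> R -> R).
Hypotheses (i1 : avg_integrable h1) (i2 : avg_integrable h2).
Hypotheses (i3 : avg_integrable h3) (i4 : avg_integrable h4).

Lemma avg_sum4 :
  avg_integrable (fun th om => h1 th om + (h2 th om + h3 th om) + h4 th om) /\
  avg (fun th om => h1 th om + (h2 th om + h3 th om) + h4 th om) =
  avg h1 + (avg h2 + avg h3) + avg h4.
Proof.
have i23 := avg_integrableD i2 i3; have i123 := avg_integrableD i1 i23.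
split; first exact: avg_integrableD i123 i4.
by rewrite (avgD i123 i4) (avgD i1 i23) (avgD i2 i3).
Qed.

Lemma avg_lin4 k1 k2 k3 k4 :
  avg_integrable (fun th om =>
    k1 * h1 th om + k2 * h2 th om + k3 * h3 th om + k4 * h4 th om) /\
  avg (fun th om =>
    k1 * h1 th om + k2 * h2 th om + k3 * h3 th om + k4 * h4 th om) =
  k1 * avg h1 + k2 * avg h2 + k3 * avg h3 + k4 * avg h4.
Proof.
have j1 := avg_integrableZ k1 i1; have j2 := avg_integrableZ k2 i2.
have j3 := avg_integrableZ k3 i3; have j4 := avg_integrableZ k4 i4.
have j12 := avg_integrableD j1 j2; have j123 := avg_integrableD j12 j3.
split; first exact: avg_integrableD j123 j4.
by rewrite (avgD j123 j4) (avgD j12 j3) (avgD j1 j2) !avgZ.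
Qed.

End LinearCombinations.

Lemma sum_ord2 (V : nmodType) (h : 'I_2 -> V) : \sum_j h j = h 0 + h 1.
Proof. by rewrite big_ord_recl big_ord1; congr (_ + h _); exact: val_inj. Qed.

Lemma tau_bounded th (j : 'I_2) : `|tau th 0 j : R| <= 1.
Proof. by rewrite mxE; case: ifP => _; [exact: cos_max|exact: sin_max]. Qed.

(* Only cos and sin of the angle are assumed to converge: gci is 2 pi-periodic,
   so c eps may be replaced by c0 + asin (sin (c eps - c0)). *)
Lemma gci_multiplier_family (kappa : R) (c : R -> R) (c0 : R) (b : R -> R) :
  0 < kappa -> continuous b -> (forall th, `|b th| <= 1) ->
  cos (c eps) @[eps --> 0^'+] --> cos c0 -> sin (c eps) @[eps --> 0^'+] --> sin c0 ->
  multiplier_family (fun eps th => gci kappa (th - c eps) * b th)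
    (fun th => gci kappa (th - c0) * b th).
Proof.
move=> k0 cb b1 cc sc; have cg := @continuous_gci R kappa.
have cgs a : continuous (fun th => gci kappa (th - a)) by exact: continuous_shift.
apply: multiplier_familyI => [eps||e e0].
- by have := cgs (c eps) => ?; cont.
- by have := cgs c0 => ?; cont.
have [L L0 HL] := gci_lipschitz k0.
pose s eps := sin (c eps - c0).
have s0 : s eps @[eps --> 0^'+] --> (0 : R).
  have -> : s = fun eps => sin (c eps) * cos c0 - cos (c eps) * sin c0.
    by apply/funext => eps; rewrite /s sinB.
  have e1 : sin c0 * cos c0 - cos c0 * sin c0 = 0 by ring.
  rewrite -[X in _ --> X]e1.
  by apply: cvgB; apply: cvgM => //; exact: cvg_cst.
have d0 : asin (s eps) @[eps --> 0^'+] --> (0 : R).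
  have a0 : asin (0 : R) = 0.
    have p0 := pi_gt0 R.
    by rewrite -[X in asin X](sin0 R) sinK// in_itv /=; apply/andP; split; lra.
  rewrite -[X in _ --> X]a0; apply: (cvg_comp s asin s0).
  by apply: continuous_asin; rewrite ltrN10 ltr01.
have cos1 : cos (c eps - c0) @[eps --> 0^'+] --> (1 : R).
  have -> : (fun eps => cos (c eps - c0)) = fun eps => cos (c eps) * cos c0 + sin (c eps) * sin c0.
    by apply/funext => eps; rewrite cosB.
  rewrite -[X in _ --> X](cos2Dsin2 c0) !expr2.
  by apply: cvgD; apply: cvgM => //; exact: cvg_cst.
(* A positive cosine selects the branch on which asin inverts the sine, so asin (s eps) agrees with
   c eps - c0 modulo 2 pi. *)
have cosp : \forall eps \near (0 : R)^'+, 0 < cos (c eps - c0).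
  exact: (cvgr_gt _ cos1 _ ltr01).
(* [L] may be 0, hence the denominator L + 1. *)
have eL : 0 < e / (L + 1) by rewrite divr_gt0// ltr_wpDl.
have dsmall : \forall eps \near (0 : R)^'+, `|asin (s eps)| < e / (L + 1).
  exact: (cvgr0_norm_lt _ d0 _ eL).
apply: filterS2 cosp dsmall => eps cp ds th _.
pose d := asin (s eps).
have sI : s eps \in `[-1, 1] by rewrite in_itv /= sin_geN1 sin_le1.
have sd : sin d = sin (c eps - c0) by rewrite /d asinK.
have cd : cos d = cos (c eps - c0).
  rewrite /d cos_asin; last by rewrite sin_geN1 sin_le1.
  by rewrite -cos2sin2 sqrtr_sqr gtr0_norm.
have -> : gci kappa (th - c eps) = gci kappa (th - c0 - d).
  apply: periodic_angle; first exact: gciD2.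
    have -> : th - c eps = th - c0 - (c eps - c0) by ring.
    by rewrite cosB [RHS]cosB sd cd.
  have -> : th - c eps = th - c0 - (c eps - c0) by ring.
  by rewrite sinB [RHS]sinB sd cd.
rewrite -mulrBl normrM (le_lt_trans (ler_wpM2l (normr_ge0 _) (b1 th)))// mulr1.
apply: (le_lt_trans (HL _ _)).
have -> : th - c0 - (th - c0 - d) = d by ring.
apply: (@le_lt_trans _ _ ((L + 1) * `|d|)); first by rewrite ler_wpM2r// lerDl.
by rewrite mulrC -ltr_pdivlMr// ltr_wpDl.
Qed.

Variables (ktheta komega alpha beta : R).
Hypotheses (ktheta_gt0 : 0 < ktheta) (komega_gt0 : 0 < komega).
Hypotheses (alpha_gt0 : 0 < alpha) (beta_gt0 : 0 < beta).
Variables (f : R -> state R) (f0 : state R) (r : R -> state R).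
Hypothesis f_smooth : forall eps, 0 < eps -> smooth (f eps).
Hypothesis f_periodic : forall eps, 0 < eps -> periodic_theta (f eps).
Hypothesis f_ge0 : forall eps t x th om, 0 < eps -> 0 <= t -> 0 <= f eps t x th om.
Hypothesis f_nondegenerate : forall eps, 0 < eps -> moments_nondegenerate (f eps).
Hypothesis f0_nondegenerate : moments_nondegenerate f0.
Hypothesis f_kinetic : forall eps t x th om, 0 < eps -> 0 <= t ->
  transport (f eps) t x th om =
  eps^-1 * Q ktheta komega alpha beta (f eps) t x th om + r eps t x th om.
Hypothesis r_negligible : negligible_remainder r.
Hypothesis f_cvg : strongly_converges ktheta komega alpha beta f f0.

Let kappa := ktheta / alpha ^+ 2.
Let kappa_gt0 : 0 < kappa. Proof. by rewrite divr_gt0// exprn_gt0. Qed.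
Let f0_classical : classical_state f0. Proof. by case: f_cvg. Qed.
Let term_cvg k t x th om : 0 <= t ->
  term k (f eps) t x th om @[eps --> 0^'+] --> term k f0 t x th om.
Proof. by case: f_cvg => _ [H _] t0; exact: H. Qed.
Let Q_cvg t x th om : 0 <= t -> Q ktheta komega alpha beta (f eps) t x th om @[eps --> 0^'+]
  --> Q ktheta komega alpha beta f0 t x th om.
Proof. by case: f_cvg => _ [_ [H _]] t0; exact: H. Qed.
Let f_int eps : 0 < eps -> integrable_terms (f eps).
Proof. by case: f_cvg => _ [_ [_ [H _]]] e0; exact: H. Qed.
Lemma limit_integrable : integrable_terms f0.
Proof. by case: f_cvg => _ [_ [_ [_ [H _]]]]. Qed.
Let avg_cvg k t x b a a0 : 0 <= t -> multiplier_family a a0 ->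
  avg (weighted b (a eps) (term k (f eps) t x)) @[eps --> 0^'+]
    --> avg (weighted b a0 (term k f0 t x)).
Proof. by case: f_cvg => _ [_ [_ [_ [_ [H _]]]]]; exact: H. Qed.
Let f_decay eps : 0 < eps -> omega_decay (f eps).
Proof. by case: f_cvg => _ [_ [_ [_ [_ [_ [_ [_ [H _]]]]]]]] e0; exact: H. Qed.

Let f_classical eps : 0 < eps -> classical_state (f eps).
Proof. by move=> e0; apply: smooth_classical; exact: f_smooth. Qed.

Lemma limit_periodic : periodic_theta f0.
Proof.
move=> t x th om t0.
have l1 := @term_cvg Tid t x (th + 2 * pi) om t0; have l2 := @term_cvg Tid t x th om t0.
apply: (cvg_unique _ _ l2); first exact: norm_hausdorff.
apply: cvg_trans l1; apply: near_eq_cvg.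
by apply: filterS near_eps_gt0 => eps e0 /=; rewrite f_periodic.
Qed.

Lemma limit_ge0 t x th om : 0 <= t -> 0 <= f0 t x th om.
Proof.
move=> t0; have l0 : (0 : R) @[eps --> (0 : R)^'+] --> (0 : R) by exact: cvg_cst.
apply: (ler_cvg_to l0 (@term_cvg Tid t x th om t0)).
by apply: filterS near_eps_gt0 => eps e0 /=; exact: f_ge0.
Qed.

(** The equation multiplied by eps reads Q (f eps) = eps (transport - r), where the bracket
    converges. *)
Lemma limit_Q0 t x th om : 0 <= t -> Q ktheta komega alpha beta f0 t x th om = 0.
Proof.
move=> t0.
have tr : transport (f eps) t x th om @[eps --> 0^'+] --> transport f0 t x th om.
  rewrite /transport; under eq_fun do rewrite sum_ord2; rewrite sum_ord2.
  apply: cvgD; last exact: (@term_cvg Tpd_th_omf t x th om t0).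
  apply: cvgD; first exact: (@term_cvg Tpd_t t x th om t0).
  by apply: cvgD; apply: cvgM; [exact: cvg_cst|exact: (@term_cvg (Tpd_x 0) t x th om t0)
    |exact: cvg_cst|exact: (@term_cvg (Tpd_x 1) t x th om t0)].
have id0 : eps @[eps --> 0^'+] --> (0 : R) by apply: cvg_at_right_filter; exact: cvg_id.
have r0 : r eps t x th om @[eps --> 0^'+] --> (0 : R).
  have [C HC] := r_negligible.1 t x th om t0.
  apply: norm_cvg0; apply: (@squeeze_cvgr _ _ _ _ (cst 0) (fun eps => C * eps)).
  - by apply: filterS HC => eps H; rewrite normr_ge0.
  - exact: cvg_cst.
  - by rewrite -[X in _ --> X](mulr0 C); apply: cvgM => //; exact: cvg_cst.
have Q0 : Q ktheta komega alpha beta (f eps) t x th om @[eps --> 0^'+] --> 0.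
  rewrite -[X in _ --> X](mul0r (transport f0 t x th om - 0)).
  have : eps * (transport (f eps) t x th om - r eps t x th om) @[eps --> 0^'+]
      --> 0 * (transport f0 t x th om - 0).
    by apply: cvgM => //; apply: cvgB.
  apply: cvg_trans; apply: near_eq_cvg.
  apply: filterS near_eps_gt0 => eps e0 /=.
  by rewrite f_kinetic// addrK mulVKf// gt_eqF.
exact: (lim_at_right_unique (g := fun eps => Q ktheta komega alpha beta (f eps) t x th om)
  (@Q_cvg t x th om t0) Q0).
Qed.

Lemma limit_equilibrium t x : 0 <= t -> is_equilibrium kappa komega beta f0 t x.
Proof.
move=> t0; have [rp _] := f0_nondegenerate x t0.
pose c := thetabar f0 t x; pose m := omegabar f0 t x.
have [cp cp1 cp2 cp11 cp22] := state_cont x t0 f0_classical.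
have pde th om : - ktheta * (pd Vtheta f0 t x th om * sin (c - th) - f0 t x th om * cos (c - th))
     - komega * (pd Vomega f0 t x th om * (m - om) - f0 t x th om)
     + alpha ^+ 2 * pd Vtheta (pd Vtheta f0) t x th om + beta ^+ 2 * pd Vomega (pd Vomega f0) t
         x th om = 0.
  rewrite -(limit_Q0 x th om t0) /Q.
  by rewrite (pd_fF x t0 f0_classical) (pd_fG x t0 f0_classical).
have [C HC] := equilibrium_unique komega_gt0 (exprn_gt0 2 alpha_gt0) (exprn_gt0 2 beta_gt0)
  (fun th om => limit_ge0 x th om t0) (fun th om => limit_periodic x th om t0)
  (state_der_th x t0 f0_classical) (state_der_thth x t0 f0_classical)
  (state_der_om x t0 f0_classical) (state_der_omom x t0 f0_classical)
  cp cp1 cp2 cp11 cp22 pde.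
pose Z := (2 * pi * besselI 0 kappa)^-1 * Num.sqrt (komega / (2 * pi * beta ^+ 2)).
have p0 := pi_gt0 R.
have Z0 : 0 < Z.
  by rewrite mulr_gt0 ?invr_gt0 ?sqrtr_gt0 ?divr_gt0 ?mulr_gt0 ?besselI0_gt0 ?exprn_gt0.
have E th om : f0 t x th om = C / Z * (von_mises kappa c th * gaussian komega beta m om).
  rewrite HC /von_mises /gaussian -/c -/m -/kappa.
  have -> : C / Z * ((2 * pi * besselI 0 kappa)^-1 * expR (kappa * cos (th - c)) *
   (Num.sqrt (komega / (2 * pi * beta ^+ 2)) * expR (- (komega / (2 * beta ^+ 2)) * (om - m) ^+
       2))) =
   C / Z * Z * (expR (kappa * cos (th - c)) * expR (- (komega / (2 * beta ^+ 2)) * (om - m) ^+ 2)).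
    by rewrite /Z; ring.
  by rewrite divfK ?gt_eqF// mulrA.
(* Uniqueness gives an unspecified multiple of the normalised equilibrium; averaging over the cell
   identifies the factor as the density. *)
suff CZ : rho f0 t x = C / Z by move=> th om; rewrite CZ E mulrA.
have [i0 e0] := @avg_equilibrium R kappa komega beta komega_gt0 beta_gt0 (fun=> 1) false c m
    (@cst_continuous _ _ (1 : R)).
transitivity (C / Z * avg (fun th om => 1 * von_mises kappa c th * (om ^+ false * gaussian
    komega beta m om))).
  by rewrite -avgZ//; apply: eq_avg => th om; rewrite E expr0 !mul1r.
rewrite e0.
have -> : circ (fun th => 1 * von_mises kappa c th) = 1.
  by rewrite -[RHS](circ_one kappa c); apply: eq_circ => th; rewrite mul1r.
have -> : (fun om => om ^+ false * gaussian komega beta m om) = gaussian komega beta m.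
  by apply/funext => om; rewrite expr0 mul1r.
by rewrite Rintegral_gaussian// !mulr1.
Qed.

(** For a weight whose collision moments sum to 0, the singular factor 1 / eps is gone before any
    limit is taken. *)
Lemma moment_balance eps t x (b : bool) (a : R -> R) : 0 < eps -> 0 <= t -> continuous a ->
  - ktheta * avg (weighted b a (term Tpd_th_fF (f eps) t x))
  - komega * avg (weighted b a (term Tpd_om_fG (f eps) t x))
  + alpha ^+ 2 * avg (weighted b a (term Tpd_th_th (f eps) t x))
  + beta ^+ 2 * avg (weighted b a (term Tpd_om_om (f eps) t x)) = 0 ->
  avg (weighted b a (term Tpd_t (f eps) t x))
  + (avg (weighted b (fun th => a th * tau th 0 0) (term (Tpd_x 0) (f eps) t x))
     + avg (weighted b (fun th => a th * tau th 0 1) (term (Tpd_x 1) (f eps) t x)))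
  + avg (weighted b a (term Tpd_th_omf (f eps) t x)) = avg (weighted b a (r eps t x)).
Proof.
move=> e0 t0 ca q0.
have ct j : continuous (fun th => a th * tau th 0 j).
  by have := @continuous_tau R j => ?; cont.
have ia k : avg_integrable (weighted b a (term k (f eps) t x)).
  by apply: f_int => //; exact: continuous_multiplier.
have it k j : avg_integrable (weighted b (fun th => a th * tau th 0 j) (term k (f eps) t x)).
  by apply: f_int => //; exact: continuous_multiplier.
have -> : avg (weighted b a (r eps t x)) = avg (fun th om =>
   (weighted b a (term Tpd_t (f eps) t x) th om + (weighted b (fun th => a th * tau th 0 0)
       (term (Tpd_x 0) (f eps) t x) th om
     + weighted b (fun th => a th * tau th 0 1) (term (Tpd_x 1) (f eps) t x) th om) + weighted b
         a (term Tpd_th_omf (f eps) t x) th om)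
   + - eps^-1 * (- ktheta * weighted b a (term Tpd_th_fF (f eps) t x) th om
     + - komega * weighted b a (term Tpd_om_fG (f eps) t x) th om
     + alpha ^+ 2 * weighted b a (term Tpd_th_th (f eps) t x) th om
     + beta ^+ 2 * weighted b a (term Tpd_om_om (f eps) t x) th om)).
  apply: eq_avg => th om.
  have H : r eps t x th om = transport (f eps) t x th om
      - eps^-1 * Q ktheta komega alpha beta (f eps) t x th om.
    by rewrite f_kinetic// addrC addKr.
  rewrite /weighted H /transport sum_ord2 /Q /term.
  move: (pd Vt _ t x th om) (pd (Vx 0) _ t x th om) (pd (Vx 1) _ t x th om).
  move: (pd Vtheta (omf _) t x th om) (pd Vtheta (fF _) t x th om).
  move: (pd Vomega (fG _) t x th om) (pd Vtheta (pd Vtheta _) t x th om).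
  move: (pd Vomega (pd Vomega _) t x th om) (tau th 0 0) (tau th 0 1) => *.
  by ring.
have [iT eT] := avg_sum4 (ia Tpd_t) (it (Tpd_x 0) 0) (it (Tpd_x 1) 1) (ia Tpd_th_omf).
have [iQ eQ] := avg_lin4 (ia Tpd_th_fF) (ia Tpd_om_fG) (ia Tpd_th_th) (ia Tpd_om_om)
  (- ktheta) (- komega) (alpha ^+ 2) (beta ^+ 2).
have lin0 (k1 k2 k3 k4 y1 y2 y3 y4 : R) : - k1 * y1 - k2 * y2 + k3 * y3 + k4 * y4 = 0 ->
    - k1 * y1 + - k2 * y2 + k3 * y3 + k4 * y4 = 0 by rewrite [- k2 * _]mulNr.
have eQ0 := etrans eQ (lin0 _ _ _ _ _ _ _ _ q0).
rewrite (avgD iT (avg_integrableZ _ iQ)) (avgZ _ iQ) eT eQ0.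
have cancel0 (S e : R) : S = S + - e * 0 by rewrite mulr0 addr0.
exact: cancel0.
Qed.

Lemma moment_limit t x (b : bool) (a : R -> R -> R) (a0 : R -> R) : 0 <= t ->
  (forall eps, continuous (a eps)) -> multiplier_family a a0 ->
  (forall j : 'I_2, multiplier_family (fun eps th => a eps th * tau th 0 j) (fun th => a0 th *
      tau th 0 j)) ->
  (forall eps, 0 < eps ->
   - ktheta * avg (weighted b (a eps) (term Tpd_th_fF (f eps) t x))
   - komega * avg (weighted b (a eps) (term Tpd_om_fG (f eps) t x))
   + alpha ^+ 2 * avg (weighted b (a eps) (term Tpd_th_th (f eps) t x))
   + beta ^+ 2 * avg (weighted b (a eps) (term Tpd_om_om (f eps) t x)) = 0) ->
  avg (weighted b a0 (pd Vt f0 t x))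
  + (avg (weighted b (fun th => a0 th * tau th 0 0) (pd (Vx 0) f0 t x))
     + avg (weighted b (fun th => a0 th * tau th 0 1) (pd (Vx 1) f0 t x)))
  + avg (weighted b a0 (pd Vtheta (omf f0) t x)) = 0.
Proof.
move=> t0 ca mf mft q0.
have L : avg (weighted b (a eps) (term Tpd_t (f eps) t x))
  + (avg (weighted b (fun th => a eps th * tau th 0 0) (term (Tpd_x 0) (f eps) t x))
     + avg (weighted b (fun th => a eps th * tau th 0 1) (term (Tpd_x 1) (f eps) t x)))
  + avg (weighted b (a eps) (term Tpd_th_omf (f eps) t x)) @[eps --> 0^'+] -->
  avg (weighted b a0 (term Tpd_t f0 t x))
  + (avg (weighted b (fun th => a0 th * tau th 0 0) (term (Tpd_x 0) f0 t x))
     + avg (weighted b (fun th => a0 th * tau th 0 1) (term (Tpd_x 1) f0 t x)))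
  + avg (weighted b a0 (term Tpd_th_omf f0 t x)).
  apply: cvgD; last exact: avg_cvg.
  apply: cvgD; first exact: avg_cvg.
  by apply: cvgD; exact: avg_cvg.
apply: (cvg_unique _ L); first exact: norm_hausdorff.
apply: cvg_trans ((r_negligible.2 t x b t0).2 a a0 mf).
apply: near_eq_cvg; apply: filterS near_eps_gt0 => eps e0 /=.
by rewrite moment_balance// q0.
Qed.

Let lin_zero (k1 k2 k3 k4 y1 y2 y3 y4 : R) : y1 = 0 -> y2 = 0 -> y3 = 0 -> y4 = 0 ->
  - k1 * y1 - k2 * y2 + k3 * y3 + k4 * y4 = 0.
Proof. by move=> -> -> -> ->; ring. Qed.

Let c1f : continuous (fun _ : R => 1 : R). Proof. exact: cst_continuous. Qed.

(** [b] false is conservation of mass, [b] true of total angular velocity; the rotation term is a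
    theta-derivative and averages to 0. *)
Lemma moment_limit1 t x (b : bool) : 0 <= t ->
  avg (weighted b (fun=> 1) (pd Vt f0 t x))
  + (avg (weighted b (fun th => 1 * tau th 0 0) (pd (Vx 0) f0 t x))
     + avg (weighted b (fun th => 1 * tau th 0 1) (pd (Vx 1) f0 t x))) = 0.
Proof.
move=> t0.
have <- := @moment_limit t x b (fun=> fun=> 1) (fun=> 1) t0.
- have := avg_th_omf x t0 f0_classical limit_periodic limit_integrable b.
  by rewrite /term => ->; rewrite addr0.
- by move=> _; exact: c1f.
- exact: multiplier_family_cst.
- move=> j; apply: multiplier_family_cst.
  by have := @continuous_tau R j => ?; cont.
- move=> eps e0; have fc := f_classical e0; have fi := f_int e0; have fd := f_decay e0.
  have fp := f_periodic e0; have fn := f_nondegenerate e0.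
  have h1 := avg_th_fF x t0 fc fp fi b; have h3 := avg_th_th x t0 fc fp fi b.
  case: b h1 h3 => h1 h3.
    exact: (@lin_zero _ _ _ _ _ _ _ _ h1 (avg_om_fG1 x t0 fc fi fd fn) h3 (avg_om_om1 x t0 fc fi
        fd)).
  exact: (@lin_zero _ _ _ _ _ _ _ _ h1 (avg_om_fG x t0 fc fi fd c1f) h3 (avg_om_om x t0 fc fi fd
      c1f)).
Qed.

(** The representative [thetabar] need not converge at the cut. Its [tau] does: the flux converges
    as an average, and its limit is nonzero, so normalising is continuous. *)
Lemma orientation_cvg t x (j : 'I_2) : 0 <= t ->
  tau (thetabar (f eps) t x) 0 j @[eps --> 0^'+] --> tau (thetabar f0 t x) 0 j.
Proof.
move=> t0.
have fluxE (g : state R) i : flux g t x 0 i = avg (weighted false (fun th => tau th 0 i) (g t x)).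
  by rewrite mxE; apply: eq_avg => th om; rewrite /weighted expr0 mul1r.
have Jc i : flux (f eps) t x 0 i @[eps --> 0^'+] --> flux f0 t x 0 i.
  rewrite fluxE; under eq_fun do rewrite fluxE.
  by apply: (@avg_cvg Tid) => //; apply: multiplier_family_cst; exact: continuous_tau.
have [_ Jn] := f0_nondegenerate x t0.
have [oE JE] := orientation_thetabar x t0 f0_nondegenerate.
have N0 : enorm (flux f0 t x) != 0.
  by apply: contra Jn => /eqP N0; rewrite JE N0 scale0r.
have Nc : enorm (flux (f eps) t x) @[eps --> 0^'+] --> enorm (flux f0 t x).
  rewrite enormE; under eq_fun do rewrite enormE.
  have sq : flux (f eps) t x 0 0 ^+ 2 + flux (f eps) t x 0 1 ^+ 2 @[eps --> 0^'+] -->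
      flux f0 t x 0 0 ^+ 2 + flux f0 t x 0 1 ^+ 2.
    by rewrite !expr2; under eq_fun do rewrite !expr2; apply: cvgD; apply: cvgM.
  exact: (cvg_comp (fun eps => flux (f eps) t x 0 0 ^+ 2 + flux (f eps) t x 0 1 ^+ 2)
    Num.sqrt sq (@sqrt_continuous R _)).
have : (enorm (flux (f eps) t x))^-1 * flux (f eps) t x 0 j @[eps --> 0^'+]
   --> (enorm (flux f0 t x))^-1 * flux f0 t x 0 j.
  by apply: cvgM => //; exact: cvgV.
have orE (g : state R) : (enorm (flux g t x))^-1 * flux g t x 0 j = orientation g t x 0 j.
  by rewrite [RHS]mxE.
rewrite orE oE; apply: cvg_trans; apply: near_eq_cvg.
apply: filterS near_eps_gt0 => eps e0.
by rewrite orE (orientation_thetabar x t0 (f_nondegenerate e0)).1.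
Qed.

(** The invariant must be centred at the mean angle of [f eps] to kill its collision moments, so the
    multiplier varies with eps and converges uniformly to [A]. *)
Lemma moment_limit_gci t x (A := fun th => gci kappa (th - thetabar f0 t x)) : 0 <= t ->
  avg (weighted false A (pd Vt f0 t x))
  + (avg (weighted false (fun th => A th * tau th 0 0) (pd (Vx 0) f0 t x))
     + avg (weighted false (fun th => A th * tau th 0 1) (pd (Vx 1) f0 t x)))
  + avg (weighted false A (pd Vtheta (omf f0) t x)) = 0.
Proof.
move=> t0.
have cc : cos (thetabar (f eps) t x) @[eps --> 0^'+] --> cos (thetabar f0 t x).
  have := @orientation_cvg t x 0 t0; rewrite mxE /=.
  by under eq_fun do rewrite mxE /=.
have cs : sin (thetabar (f eps) t x) @[eps --> 0^'+] --> sin (thetabar f0 t x).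
  have := @orientation_cvg t x 1 t0; rewrite mxE /=.
  by under eq_fun do rewrite mxE /=.
have cA c : continuous (fun th => gci kappa (th - c)).
  by apply: continuous_shift; exact: continuous_gci.
apply: (@moment_limit t x false (fun eps th => gci kappa (th - thetabar (f eps) t x))) => //.
- have norm1 (th : R) : `|1 : R| <= 1 by rewrite normr1.
  have := gci_multiplier_family kappa_gt0 c1f norm1 cc cs.
  under eq_fun do under eq_fun do rewrite mulr1.
  by under [X in multiplier_family _ X]eq_fun do rewrite mulr1.
- move=> j; apply: gci_multiplier_family => //; first exact: continuous_tau.
  by move=> th; exact: tau_bounded.
- move=> eps e0; have fc := f_classical e0; have fi := f_int e0; have fd := f_decay e0.
  have fp := f_periodic e0; have fn := f_nondegenerate e0.
  have kE : kappa * alpha ^+ 2 = ktheta by rewrite /kappa divfK// gt_eqF// exprn_gt0.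
  have drop0 (y1 y2 y3 y4 : R) : y2 = 0 -> y4 = 0 ->
      - (kappa * alpha ^+ 2) * y1 + alpha ^+ 2 * y3 = 0 ->
      - ktheta * y1 - komega * y2 + alpha ^+ 2 * y3 + beta ^+ 2 * y4 = 0.
    by move=> -> ->; rewrite !mulr0 subr0 addr0 kE.
  exact: (drop0 _ _ _ _ (avg_om_fG x t0 fc fi fd (cA _)) (avg_om_om x t0 fc fi fd (cA _))
    (avg_gci_collision x t0 fc fp fi fn kappa_gt0 (alpha ^+ 2))).
Qed.

End HydrodynamicLimit.

(** * Derivatives of the equilibrium *)

Section EquilibriumDerivatives.
Context {R : realType}.
Implicit Types (t th om : R) (x : 'rV[R]_2).
Variables (kappa komega beta : R) (f : state R).
Hypotheses (komega_gt0 : 0 < komega) (beta_gt0 : 0 < beta).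
Hypothesis f_nondeg : moments_nondegenerate f.
Hypothesis f_com : avg_commutes f.
Hypothesis f_eq : forall t x, 0 <= t -> is_equilibrium kappa komega beta f t x.

Let rhoE s y : rho f s y = avg (weighted false (fun=> 1) (f s y)).
Proof. by apply: eq_avg => th om; rewrite /weighted expr0 !mul1r. Qed.

Let fluxE s y j : flux f s y 0 j = avg (weighted false (fun th => tau th 0 j) (f s y)).
Proof. by rewrite mxE; apply: eq_avg => th om; rewrite /weighted expr0 mul1r. Qed.

Let momE s y : avg (fun th om => om * f s y th om) = avg (weighted true (fun=> 1) (f s y)).
Proof. by apply: eq_avg => th om; rewrite /weighted expr1 mulr1. Qed.

Let mul1 : multiplier (fun=> 1 : R).
Proof. by apply: continuous_multiplier; exact: cst_continuous. Qed.

Let mul_tau j : multiplier (fun th : R => tau th 0 j).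
Proof. by apply: continuous_multiplier; exact: continuous_tau. Qed.

Let slope_t t x b (a : R -> R) : 0 <= t -> multiplier a ->
  slope (time_filter t) (fun h => avg (weighted b a (f (t + h) x)))
    (avg (weighted b a (pd Vt f t x))).
Proof.
move=> t0 ma; have [[d _] [<- _]] := @f_com t x b a t0 ma.
exact: (@derive_t_slope _ _ (fun s => avg (weighted b a (f s x))) t d).
Qed.

Let slope_x t x j b (a : R -> R) : 0 <= t -> multiplier a ->
  slope 0^' (fun h => avg (weighted b a (f t (h *: dirx j + x))))
    (avg (weighted b a (pd (Vx j) f t x))).
Proof.
move=> t0 ma; have [[_ d] [_ <-]] := @f_com t x b a t0 ma.
exact: (@derive_dir_slope _ _ (fun y => avg (weighted b a (f t y))) x (dirx j) (d j)).
Qed.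

(** Uniqueness of limits identifies the time derivative of [f] with the slope of the equilibrium
    formula. The moments are differentiable because averages commute with derivatives. *)
Lemma equilibrium_derive_t t x : 0 <= t -> exists l dm,
  [/\ derivable_t (rho f ^~ x) t, derivable_t (omegabar f ^~ x) t,
      derivable_t (fun s => tau (thetabar f s x)) t,
      derive_t (fun s => tau (thetabar f s x)) t = l *: tau_perp (thetabar f t x) &
      pd Vt f t x =
        dequilibrium kappa komega beta f t x (derive_t (rho f ^~ x) t) l dm].
Proof.
move=> t0; have FF := time_filter_proper t0; have F0 := @time_filter_dnbhs R t.
have Tge : time_filter t [set h | 0 <= t + h] by exact: withinT.
have T0 : 0 <= t + 0 by rewrite addr0.
have sr : slope (time_filter t) (fun h => rho f (t + h) x) (avg (weighted false (fun=> 1) (pd Vt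
    f t x))).
  by under eq_fun do rewrite rhoE; exact: slope_t.
have sJ j : slope (time_filter t) (fun h => flux f (t + h) x 0 j) (avg (weighted false (fun th
    => tau th 0 j) (pd Vt f t x))).
  by under eq_fun do rewrite fluxE; exact: slope_t.
have sM : slope (time_filter t) (fun h => avg (fun th om => om * f (t + h) x th om)) (avg
    (weighted true (fun=> 1) (pd Vt f t x))).
  by under eq_fun do rewrite momE; exact: slope_t.
have [l [dm [sO sm sf]]] := @equilibrium_slopes R kappa komega beta komega_gt0 beta_gt0
  _ FF F0 f (fun h => t + h) (fun=> x) Tge T0 f_nondeg f_eq _ _ _ sr sJ sM.
have [dr drE] := @derivable_tP _ _ (rho f ^~ x) t _ t0 sr.
have [dO dOE] := @derivable_tP _ _ (fun s => tau (thetabar f s x)) t _ t0 sO.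
have [dm' _] := @derivable_tP _ _ (omegabar f ^~ x) t _ t0 sm.
exists l, dm; split; [exact: dr|exact: dm'|exact: dO|by rewrite dOE (addr0 t)|].

apply/funext => th; apply/funext => om.
by have [_] := @derivable_tP _ _ (fun s => f s x th om) t _ t0 (sf th om); rewrite drE addr0.
Qed.

Lemma equilibrium_derive_x t x j : 0 <= t -> exists l dm,
  [/\ derivable (rho f t) x (dirx j), derivable (omegabar f t) x (dirx j),
      derivable (fun y => tau (thetabar f t y)) x (dirx j),
      'D_(dirx j) (fun y => tau (thetabar f t y)) x = l *: tau_perp (thetabar f t x) &
      pd (Vx j) f t x =
        dequilibrium kappa komega beta f t x ('D_(dirx j) (rho f t) x) l dm].
Proof.
move=> t0; have FF : ProperFilter (0 : R)^' by exact: Proper_dnbhs_numFieldType.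
have F0 : (0 : R)^' `<=` (0 : R)^' by [].
have Tge : (0 : R)^' [set h | 0 <= t] by exact: nearW.
have sr : slope 0^' (fun h => rho f t (h *: dirx j + x)) (avg (weighted false (fun=> 1) (pd (Vx
    j) f t x))).
  by under eq_fun do rewrite rhoE; exact: slope_x.
have sJ i : slope 0^' (fun h => flux f t (h *: dirx j + x) 0 i) (avg (weighted false (fun th =>
    tau th 0 i) (pd (Vx j) f t x))).
  by under eq_fun do rewrite fluxE; exact: slope_x.
have sM : slope 0^' (fun h => avg (fun th om => om * f t (h *: dirx j + x) th om)) (avg
    (weighted true (fun=> 1) (pd (Vx j) f t x))).
  by under eq_fun do rewrite momE; exact: slope_x.
have [l [dm [sO sm sf]]] := @equilibrium_slopes R kappa komega beta komega_gt0 beta_gt0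
  _ FF F0 f (fun=> t) (fun h => h *: dirx j + x) Tge t0 f_nondeg f_eq _ _ _ sr sJ sM.
have X0 : 0 *: dirx j + x = x by rewrite scale0r add0r.
have [dr drE] := @derivable_dirP _ _ (rho f t) x _ _ sr.
have [dO dOE] := @derivable_dirP _ _ (fun y => tau (thetabar f t y)) x _ _ sO.
have [dm' _] := @derivable_dirP _ _ (omegabar f t) x _ _ sm.
exists l, dm; split; [exact: dr|exact: dm'|exact: dO|by rewrite dOE X0|].

apply/funext => th; apply/funext => om.
by have [_] := @derivable_dirP _ _ (fun y => f t y th om) x _ _ (sf th om); rewrite drE X0.
Qed.

Lemma derive_t_moment t x (b : bool) : 0 <= t ->
  derive_t (fun s => rho f s x * omegabar f s x ^+ b) t =
  avg (weighted b (fun=> 1) (pd Vt f t x)).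
Proof.
move=> t0; have FF := time_filter_proper t0.
have E s : 0 <= s -> avg (weighted b (fun=> 1) (f s x)) = rho f s x * omegabar f s x ^+ b.
  move=> s0; have [rp _] := f_nondeg x s0.
  rewrite (avg_weighted_equilibrium komega_gt0 beta_gt0 rp (f_eq x s0)); last exact: cst_continuous.
  under eq_fun do rewrite mul1r.
  by rewrite circ_one mulr1.
apply: (@derivable_tP _ _ (fun s => rho f s x * omegabar f s x ^+ b) t _ t0 _).2.
apply: (slope_eq FF _ _ (@slope_t t x b _ t0 mul1)); last by rewrite E ?addr0.
have Tge : time_filter t [set h | 0 <= t + h] by exact: withinT.
by apply: filterS Tge => h Th; exact: E.
Qed.

(** The flux moments of the equilibrium are c1 times the products on the left, so these are
    differentiated as averages divided by c1. *)
Lemma derive_x_moment t x j (b : bool) : 0 <= t ->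
  c1 kappa * 'D_(dirx j) (fun y => rho f t y * omegabar f t y ^+ b * tau (thetabar f t y) 0 j) x =
  avg (weighted b (fun th => 1 * tau th 0 j) (pd (Vx j) f t x)).
Proof.
move=> t0; have FF : ProperFilter (0 : R)^' by exact: Proper_dnbhs_numFieldType.
have k0 : c1 kappa != 0.
  apply/eqP => k0; have [rp /eqP] := f_nondeg x t0; apply.
  apply/rowP => i; rewrite (flux_equilibrium komega_gt0 beta_gt0 rp (f_eq x t0)) k0 [RHS]mxE.
  by rewrite mulr0 mul0r.
have E y : (c1 kappa)^-1 * avg (weighted b (fun th => tau th 0 j) (f t y)) =
    rho f t y * omegabar f t y ^+ b * tau (thetabar f t y) 0 j.
  have [rp _] := f_nondeg y t0.
  rewrite (avg_weighted_equilibrium komega_gt0 beta_gt0 rp (f_eq y t0)); last exact: continuous_tau.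
  by rewrite circ_tau; field.
have F0 : (0 : R)^' `<=` (0 : R)^' by [].
have s1 := slopeM FF F0 (slope_cst FF (c1 kappa)^-1) (@slope_x t x j b _ t0 (mul_tau j)).
have [_ dE] := @derivable_dirP _ _
  (fun y => (c1 kappa)^-1 * avg (weighted b (fun th => tau th 0 j) (f t y))) x (dirx j) _ s1.
rewrite -(funext E) dE.
rewrite mul0r add0r mulVKf//; congr avg; congr weighted.
by apply/funext => th; rewrite mul1r.
Qed.

Lemma pd_theta_equilibrium t x : 0 <= t ->
  pd Vtheta f t x = fun th om => - kappa * sin (th - thetabar f t x) * f t x th om.
Proof.
move=> t0; apply/funext => th; apply/funext => om; apply: der_derive1.
rewrite (f_eq x t0); under eq_fun do rewrite (f_eq x t0).
by rewrite /von_mises; der => /=; ring.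
Qed.

End EquilibriumDerivatives.

Section Projection.
Context {R : realType}.

(** In the plane, Id - tau (x) tau equals tau_perp (x) tau_perp. *)
Lemma mulmx_proj_perp (g : 'rV[R]_2) (a : R) :
  g *m proj_perp (tau a) = (g 0 0 * tau_perp a 0 0 + g 0 1 * tau_perp a 0 1) *: tau_perp a.
Proof.
have e2 := cos2Dsin2 a.
have C : cos a * cos a = 1 - sin a * sin a by rewrite -e2; ring.
apply/rowP => j; rewrite mxE sum_ord2 !mxE !big_ord1 !mxE /=.
by case: (ord2P j) => -> /=; ring: C.
Qed.

End Projection.

(** * Assembly of the macroscopic system *)

Unset Implicit Arguments.
Set Strict Implicit.
Set Printing Implicit Defensive.

Theorem theorem3p1 (R : realType) (ktheta komega alpha beta : R)
    (ktheta_gt0 : 0 < ktheta) (komega_gt0 : 0 < komega)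
    (alpha_gt0 : 0 < alpha) (beta_gt0 : 0 < beta)
    (f : R -> state R) (f0 : state R) (r : R -> state R)
    (f_smooth : forall eps : R, 0 < eps -> smooth (f eps))
    (f_periodic : forall eps : R, 0 < eps -> periodic_theta (f eps))
    (f_ge0 : forall (eps t : R) x th om, 0 < eps -> 0 <= t -> 0 <= f eps t x th om)
    (f_nondegenerate : forall eps : R, 0 < eps -> moments_nondegenerate (f eps))
    (f0_nondegenerate : moments_nondegenerate f0)
    (f_kinetic : forall (eps t : R) x th om, 0 < eps -> 0 <= t ->
       transport (f eps) t x th om =
       eps^-1 * Q ktheta komega alpha beta (f eps) t x th om + r eps t x th om)
    (r_negligible : negligible_remainder r)
    (f_cvg : strongly_converges ktheta komega alpha beta f f0) :
  let kappa := ktheta / alpha ^+ 2 in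
  let rho0 := rho f0 in
  let thb := thetabar f0 in
  let omb := omegabar f0 in
  let Om := fun t x => tau (thb t x) in
  (forall (t : R) x th om, 0 <= t ->
     f0 t x th om =
     rho0 t x * von_mises kappa (thb t x) th * gaussian komega beta (omb t x) om) /\
  (forall (t : R) x, 0 <= t ->
     [/\ pdifferentiable rho0 t x, pdifferentiable omb t x & pdifferentiable Om t x]) /\
  (forall (t : R) x, 0 <= t ->
     [/\ derive_t (fun s => rho0 s x) t
           + c1 kappa * div (fun y => rho0 t y *: Om t y) x = 0,
         derive_t (fun s => rho0 s x * omb s x) t
           + c1 kappa * div (fun y => (rho0 t y * omb t y) *: Om t y) x = 0 &
         rho0 t x *: (derive_t (fun s => Om s x) t
                      + c2 kappa *: advect (Om t x) (Om t) x
                      - omb t x *: tau_perp (thb t x))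
           + kappa^-1 *: (grad (rho0 t) x *m proj_perp (Om t x)) = 0]).
Proof.
move=> kappa rho0 thb omb Om.
have kappa_gt0 : 0 < kappa by rewrite divr_gt0 ?exprn_gt0.
have f0_com : avg_commutes f0 by case: f_cvg => _ [_ [_ [_ [_ [_ [_ []]]]]]].
have f0_classical : classical_state f0 by case: f_cvg.
have f0_eq (t : R) x (t0 : (0 : R) <= t) : is_equilibrium kappa komega beta f0 t x.
  exact: (limit_equilibrium komega_gt0 alpha_gt0 beta_gt0 f_periodic f_ge0
    f0_nondegenerate f_kinetic r_negligible f_cvg x t0).
have Dt (t : R) x (t0 : (0 : R) <= t) := equilibrium_derive_t komega_gt0 beta_gt0 f0_nondegenerate
  f0_com f0_eq x t0.
have Dx (t : R) x (t0 : (0 : R) <= t) j := equilibrium_derive_x komega_gt0 beta_gt0 f0_nondegenerate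
  f0_com f0_eq x j t0.
(* The density equation is the case [b] false, the frequency equation the case [b] true. *)
have balance (t : R) x (b : bool) : 0 <= t ->
    derive_t (fun s => rho0 s x * omb s x ^+ b) t
    + c1 kappa * div (fun y => (rho0 t y * omb t y ^+ b) *: Om t y) x = 0.
  move=> t0.
  have mt := derive_t_moment komega_gt0 beta_gt0 f0_nondegenerate f0_com f0_eq x b t0.
  have mx j := derive_x_moment komega_gt0 beta_gt0 f0_nondegenerate f0_com f0_eq x j b t0.
  have d j : c1 kappa * 'D_(dirx j) (fun y => ((rho0 t y * omb t y ^+ b) *: Om t y) 0 j) x =
      avg (weighted b (fun th => 1 * tau th 0 j) (pd (Vx j) f0 t x)).
    rewrite -mx; apply: (f_equal (fun g : 'rV[R]_2 -> R => c1 kappa * 'D_(dirx j) g x)).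
    by apply/funext => y; rewrite [LHS]mxE.
  rewrite /div sum_ord2 mulrDr.
  exact: (etrans (congr2 +%R mt (congr2 +%R (d 0) (d 1)))
    (moment_limit1 f_smooth f_periodic f_nondegenerate f_kinetic r_negligible f_cvg x b t0)).
split; [|split] => [t x th om t0|t x t0|t x t0]; first exact: f0_eq.
  have [lt [dmt [rt ot Ot _ _]]] := Dt t x t0.
  split; (split; [first [exact: rt|exact: ot|exact: Ot]|move=> j; have [l [dm [rx ox Ox _ _]]]
      := Dx t x t0 j]).
  - exact: rx.
  - exact: ox.
  - exact: Ox.
split.
- have := balance t x false t0.
  under eq_fun do rewrite expr0 mulr1.
  by under [X in div X]eq_fun do rewrite expr0 mulr1.
- have := balance t x true t0.
  under eq_fun do rewrite expr1.
  by under [X in div X]eq_fun do rewrite expr1.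
have [rp _] := f0_nondegenerate t x t0.
have [lt [dmt [_ _ _ OtE ft]]] := Dt t x t0.
have [l0 [dm0 [_ _ _ O0E fx0]]] := Dx t x t0 0.
have [l1 [dm1 [_ _ _ O1E fx1]]] := Dx t x t0 1.
pose c := thetabar f0 t x.
have gciL := moment_limit_gci ktheta_gt0 alpha_gt0 f_smooth f_periodic
  f_nondegenerate f0_nondegenerate f_kinetic r_negligible f_cvg x t0.
have cA : continuous (fun th => gci kappa (th - c)).
  by apply: continuous_shift; exact: continuous_gci.
have cAt j : continuous (fun th => gci kappa (th - c) * tau th 0 j).
  by have := @continuous_tau R j => ?; cont.
have avg_t := avg_dequilibrium komega_gt0 beta_gt0 rp (f0_eq t x t0)
  (derive_t (rho f0 ^~ x) t) lt dmt cA.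
have avg_x j dr l dm := avg_dequilibrium komega_gt0 beta_gt0 rp (f0_eq t x t0) dr l dm (cAt j).
(* On the equilibrium, d_theta (om f0) = - kappa om sin (th - c) f0, so the rotation term becomes a
   first moment in omega with weight [gci] sin, which yields K1. *)
have avg_rot : avg (weighted false (fun th => gci kappa (th - c)) (pd Vtheta (omf f0) t x)) =
    - kappa * (rho f0 t x * K1 kappa * omegabar f0 t x).
  have cAs : continuous (fun th => gci kappa (th - c) * sin (th - c)) by cont.
  have e := avg_weighted_equilibrium komega_gt0 beta_gt0 rp (f0_eq t x t0) true cAs.
  rewrite circ_gci_sin expr1 in e; rewrite -e.
  have i : avg_integrable (weighted true (fun th => gci kappa (th - c) * sin (th - c)) (term Tid
      f0 t x)).
    by apply: (limit_integrable f_cvg) => //; exact: continuous_multiplier.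
  rewrite -(avgZ _ i); apply: eq_avg => th om.
  rewrite /weighted (pd_omf x t0 f0_classical) (pd_theta_equilibrium f0_eq x t0) /=.
  by rewrite expr0 expr1 /c; ring.
have e_t : avg (weighted false (fun th => gci kappa (th - c)) (pd Vt f0 t x)) =
    kappa * rho f0 t x * lt * K1 kappa.
  by rewrite ft avg_t circ_gci circ_gci_sin mulr0 add0r.
have e_x j l dm : pd (Vx j) f0 t x =
      dequilibrium kappa komega beta f0 t x ('D_(dirx j) (rho f0 t) x) l dm ->
    avg (weighted false (fun th => gci kappa (th - c) * tau th 0 j) (pd (Vx j) f0 t x)) =
    'D_(dirx j) (rho f0 t) x * (K1 kappa * tau_perp c 0 j) +
    kappa * rho f0 t x * l * (K2 kappa * tau c 0 j).
  by move=> ->; rewrite avg_x circ_gci_tau circ_gci_tau_sin.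
have k1 := K1_gt0 kappa_gt0.
(* Division by kappa K1, nonzero by [K1_gt0], normalises the orientation balance and produces c2 =
   K2 / K1. *)
have alg (y1 y2 y3 y4 q m d0 d1 T0 T1 P0 P1 a b : R) :
    y1 = kappa * q * lt * a -> y2 = d0 * (a * P0) + kappa * q * l0 * (b * T0) ->
    y3 = d1 * (a * P1) + kappa * q * l1 * (b * T1) -> y4 = - kappa * (q * a * m) ->
    0 < a -> y1 + (y2 + y3) + y4 = 0 ->
    q * (lt + b / a * (T0 * l0 + T1 * l1) - m) + kappa^-1 * (d0 * P0 + d1 * P1) = 0.
  move=> -> -> -> -> a0 E.
  rewrite -[RHS](mulr0 (kappa * a)^-1) -E; field.
  by rewrite !gt_eqF.
have key := alg _ _ _ _ _ _ _ _ _ _ _ _ _ _ e_t (e_x _ _ _ fx0) (e_x _ _ _ fx1) avg_rot k1 gciL.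
(* Every term of the orientation equation is a multiple of [tau_perp], so the vector equation
   reduces to the scalar one in [key]. *)
have vec (v : 'rV[R]_2) (q m d T0 T1 b : R) :
    q *: (lt *: v + b *: (T0 *: (l0 *: v) + T1 *: (l1 *: v)) - m *: v) + kappa^-1 *: (d *: v) =
    (q * (lt + b * (T0 * l0 + T1 * l1) - m) + kappa^-1 * d) *: v.
  by apply/rowP => i; rewrite !mxE; ring.
rewrite /Om /thb OtE /advect sum_ord2 O0E O1E mulmx_proj_perp vec.
rewrite [grad _ _ 0 0]mxE [grad _ _ 0 1]mxE.
by rewrite -[RHS](scale0r (tau_perp c)) -key.
Qed.
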